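(* Let $\mathcal{P}_0\subset\mathcal{P}$ and $\mathcal{H}_0=\mathcal{P}_0\cap\mathcal{H}$. Suppose that there exist deterministic rate functions $g,h$ tending to zero as $n\to\infty$ and functions $\xi,\xi':[0,1]\times[0,1]^d\to\mathbb{R}$ such that (i) $\|F_{X\mid Z}-\hat F^{(n)}_{X\mid Z}\|_{\mathcal{T},\infty}\in\mathcal{O}_{\mathcal{P}_0}(g(n))$ and $\|F_{Y\mid Z}-\hat F^{(n)}_{Y\mid Z}\|'_{\mathcal{T},\infty}\in\mathcal{O}_{\mathcal{P}_0}(h(n))$; (ii) $\|\xi-\hat F^{(n)}_{X\mid Z}\|_{\mathcal{T}^c,\infty}\in\mathcal{O}_{\mathcal{P}_0}(g(n))$ and $\|\xi'-\hat F^{(n)}_{Y\mid Z}\|'_{\mathcal{T}^c,\infty}\in\mathcal{O}_{\mathcal{P}_0}(h(n))$; and that $\sqrt n\,g(n)h(n)\to0$ as $n\to\infty$. Let $\alpha\in(0,1)$ and $\hat\Psi_n=1(T_n>n^{-1}z_{1-\alpha})$, where $z_{1-\alpha}$ is the $(1-\alpha)$-quantile of the $\chi^2_{q^2}$-distribution. Then $\hat\Psi_n$ has asymptotic uniform level over $\mathcal{H}_0$, i.e. $$\limsup_{n\to\infty}\sup_{P\in\mathcal{H}_0}E_P(\hat\Psi_n)=\alpha.$$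
   Context: $\mathcal{P}$ is the set of distributions of $(X,Y,Z)$ on $[0,1]^{2+d}$ ($X,Y\in[0,1]$, $Z\in[0,1]^d$) absolutely continuous with respect to Lebesgue measure; $\mathcal{H}\subset\mathcal{P}$ is the subset for which $X$ and $Y$ are conditionally independent given $Z$. Throughout, for every $z$ the conditional distributions of $X$ and of $Y$ given $Z=z$ are continuous. $F_{X\mid Z}(t\mid z)=P(X\le t\mid Z=z)$ and $Q_{X\mid Z}(\tau\mid z)=\inf\{t\in[0,1]:F_{X\mid Z}(t\mid z)\ge\tau\}$; similarly for $Y$. $(X_i,Y_i,Z_i)_{i=1}^n$ is an i.i.d. sample from $P$. An estimator $\hat F^{(n)}_{X\mid Z}$ is a mapping from the sample $(X_i,Z_i)_{i=1}^n$ to functions $\hat F^{(n)}_{X\mid Z}(\cdot\mid z):[0,1]\to[0,1]$ that for every $z\in[0,1]^d$ are continuous and increasing with value $0$ at $0$ and $1$ at $1$; similarly $\hat F^{(n)}_{Y\mid Z}$ is such a mapping from $(Y_i,Z_i)_{i=1}^n$. Put $\hat U_{1,i}=\hat F^{(n)}_{X\mid Z}(X_i\mid Z_i)$ and $\hat U_{2,i}=\hat F^{(n)}_{Y\mid Z}(Y_i\mid Z_i)$. The function $\phi=(\phi_1,\dots,\phi_q):[0,1]\to\mathbb{R}^q$ satisfies: each $\phi_k$ has support $\mathcal{T}_k$ that is a compact subset of $(0,1)$; each $\phi_k$ is Lipschitz continuous; $\int_0^1\phi_k(u)\,\mathrm{d}u=0$ and $\int_0^1\phi_k(u)^2\,\mathrm{d}u=1$;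 $\phi_1,\dots,\phi_q$ are linearly independent. $\hat\rho_n=\frac1n\sum_{i=1}^n\phi(\hat U_{1,i})\phi(\hat U_{2,i})^T$, $\Sigma_{k,s}=\int_0^1\phi_k(u)\phi_s(u)\,\mathrm{d}u$, and $T_n=\|\Sigma^{-1/2}\hat\rho_n\Sigma^{-1/2}\|_F^2$ with $\|\cdot\|_F$ the Frobenius norm. $\tau_{\min}=\inf(\mathcal{T}_1\cup\dots\cup\mathcal{T}_q)$, $\tau_{\max}=\sup(\mathcal{T}_1\cup\dots\cup\mathcal{T}_q)$, $\mathcal{T}=[\tau_{\min},\tau_{\max}]$. $\|f\|_{\mathcal{T},\infty}=\sup_{z\in[0,1]^d}\sup_{t\in Q_{X\mid Z}(\mathcal{T}\mid z)}|f(t,z)|$ with $Q_{X\mid Z}(\mathcal{T}\mid z)=[Q_{X\mid Z}(\tau_{\min}\mid z),Q_{X\mid Z}(\tau_{\max}\mid z)]$, and $\|f\|_{\mathcal{T}^c,\infty}$ is the same with the inner supremum over the complement $[0,1]\setminus Q_{X\mid Z}(\mathcal{T}\mid z)$. $\|\cdot\|'_{\mathcal{T},\infty}$ and $\|\cdot\|'_{\mathcal{T}^c,\infty}$ are defined in the same way with $Q_{Y\mid Z}$ in place of $Q_{X\mid Z}$. For a set $\mathcal{M}$ of distributions, $X_n\in\mathcal{O}_{\mathcal{M}}(a_n)$ ($a_n$ nonzero) means: for every $\epsilon>0$ there is $M>0$ with $\sup_n\sup_{P\in\mathcal{M}}P(|X_n/a_n|>M)<\epsilon$. *)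

(* Defs.v *)
From HB Require Import structures.
From mathcomp Require Import all_boot all_order all_algebra.
From mathcomp Require Import all_classical all_reals all_analysis.
Set Implicit Arguments.
Unset Strict Implicit.
Unset Printing Implicit Defensive.
Import Order.TTheory GRing.Theory Num.Theory.
Import numFieldNormedType.Exports.
Local Open Scope classical_set_scope.
Local Open Scope ring_scope.

Section product_probability.
Local Open Scope ereal_scope.
Context d1 d2 (T1 : measurableType d1) (T2 : measurableType d2) (R : realType).
Variables (P1 : probability T1 R) (P2 : probability T2 R).

Definition product_prob_fun : set (T1 * T2) -> \bar R := P1 \x P2.

HB.instance Definition _ := Measure.on product_prob_fun.

Let product_prob_setT : product_prob_fun setT = 1.
Proof.
rewrite -setXTT [LHS]product_measure1E//.
by rewrite [X in X * _]probability_setT [X in _ * X]probability_setT mule1.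
Qed.

HB.instance Definition _ :=
  Measure_isProbability.Build _ _ _ product_prob_fun product_prob_setT.

Definition product_prob : probability (T1 * T2)%type R := product_prob_fun.

End product_probability.

Section iid.
Context d (T : measurableType d) (R : realType) (P : probability T R).

Definition tuple_cons n (x : T * n.-tuple T) : n.+1.-tuple T :=
  [the n.+1.-tuple T of x.1 :: x.2].

Lemma measurable_tuple_cons n : measurable_fun setT (@tuple_cons n).
Proof. exact: (@measurable_cons _ _ _ _ fst n snd). Qed.

HB.instance Definition _ n :=
  isMeasurableFun.Build _ _ _ _ (@tuple_cons n) (@measurable_tuple_cons n).

(* The n-fold product measure P x ... x P, i.e. the law of an i.i.d. sample of
   size n from P. *)
Fixpoint iid_law n : probability (n.-tuple T) R :=
  match n with
  | 0 => \d_([tuple] : 0.-tuple T)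
  | n'.+1 => distribution (product_prob P (iid_law n')) (@tuple_cons n')
  end.

End iid.

Section real_law.
Variable R : realType.

(* measurableTypeR R and R carry the same Borel sigma-algebra but are distinct
   measurable types; this transports a law from the former to the latter. *)
Definition to_real (x : measurableTypeR R) : R := x.

Lemma measurable_to_real : measurable_fun setT to_real.
Proof. by move=> _ A mA; rewrite setTI. Qed.

HB.instance Definition _ :=
  isMeasurableFun.Build _ _ _ _ to_real measurable_to_real.

Definition unif01 : probability R R := distribution (uniform_prob (@ltr01 R)) to_real.
Definition std_normal : probability R R := distribution (normal_prob 0 1) to_real.

End real_law.

Section conditioning.
Context dT dE dG (T : measurableType dT) (E : measurableType dE)
  (G : measurableType dG) (R : realType).
Variable P : probability T R.
Local Open Scope ereal_scope.

(* K is a regular version of the conditional distribution of X given Z. *)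
Definition cond_dist (X : T -> E) (Z : T -> G) (K : R.-pker G ~> E) : Prop :=
  forall (A : set E) (C : set G), measurable A -> measurable C ->
    P (X @^-1` A `&` Z @^-1` C) = \int[P]_(w in Z @^-1` C) K (Z w) A.

End conditioning.

(* Conditional independence of X and Y given Z; the factorization does not
   depend on the versions of the conditional distributions. *)
Definition cond_indep dT dE dE' dG (T : measurableType dT)
    (E : measurableType dE) (E' : measurableType dE') (G : measurableType dG)
    (R : realType) (P : probability T R)
    (X : T -> E) (Y : T -> E') (Z : T -> G) : Prop :=
  exists (KX : R.-pker G ~> E) (KY : R.-pker G ~> E'),
    [/\ cond_dist P X Z KX, cond_dist P Y Z KY &
      forall (A : set E) (B : set E') (C : set G),
        measurable A -> measurable B -> measurable C ->
        P (X @^-1` A `&` Y @^-1` B `&` Z @^-1` C) =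
        (\int[P]_(w in Z @^-1` C) (KX (Z w) A * KY (Z w) B))%E].

(* X_n \in O_M(a_n) for statistics X_n of an i.i.d. sample of size n >= 1.  The
   statistics below are suprema over uncountable sets, so probabilities of tail
   events are outer probabilities; these agree with the probabilities whenever
   the events are measurable. *)
Definition bigO_unif d (T : measurableType d) (R : realType)
    (M : set (probability T R))
    (X : forall n, probability T R -> n.-tuple T -> \bar R)
    (a : nat -> R) : Prop :=
  (forall n, (0 < n)%N -> a n != 0) /\
  forall e : R, 0 < e -> exists2 C : R, 0 < C &
    (ereal_sup [set ereal_sup
       [set ((iid_law P n)^*%mu
               [set s | C%:E < `|X n P s * ((a n)^-1)%:E|])
         | P in M]
      | n in [set n | (0 < n)%N]] < e%:E)%E.

Section model.
Variables (R : realType) (d : nat).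

Definition covariate : measurableType _ := d.-tuple R.
Definition obs : measurableType _ := (R * R * d.-tuple R)%type.
Definition law := probability obs R.

Definition obsX (w : obs) : R := w.1.1.
Definition obsY (w : obs) : R := w.1.2.
Definition obsZ (w : obs) : covariate := w.2.

Definition cube : set covariate := [set z | forall i, 0 <= tnth z i <= 1].

(* The uniform distribution on [0,1]^(2+d) is Lebesgue measure restricted to
   the unit cube, so absolute continuity with respect to it also forces the
   distribution to be carried by the cube. *)
Definition unif_cube : law :=
  product_prob (product_prob (unif01 R) (unif01 R)) (iid_law (unif01 R) d).

Definition ac_laws : set law := [set P | P `<< unif_cube].
Definition ci_laws : set law :=
  [set P | ac_laws P /\ cond_indep P obsX obsY obsZ].

Definition cond_cdf (K : R.-pker covariate ~> R) (t : R) (z : covariate) : R :=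
  fine (K z `]-oo, t]%classic).

Definition quantile (K : R.-pker covariate ~> R) (tau : R) (z : covariate) : R :=
  inf [set t | 0 <= t <= 1 /\ tau <= cond_cdf K t z].

(* K is a version of the conditional distribution of V given Z that, for every
   z, is a continuous distribution on [0,1]. *)
Definition continuous_version (P : law) (V : obs -> R)
    (K : R.-pker covariate ~> R) : Prop :=
  cond_dist P V obsZ K /\
  forall z, cube z ->
    K z `[0, 1]%classic = 1%E /\ continuous (fun t => cond_cdf K t z).

Definition sampleXZ n (s : n.-tuple obs) : n.-tuple (R * covariate) :=
  map_tuple (fun w => (obsX w, obsZ w)) s.
Definition sampleYZ n (s : n.-tuple obs) : n.-tuple (R * covariate) :=
  map_tuple (fun w => (obsY w, obsZ w)) s.

Definition estimator :=
  forall n, n.-tuple (R * covariate) -> R -> covariate -> R.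

Definition residual (F : estimator) n (s : n.-tuple (R * covariate))
    (i : 'I_n) : R :=
  F n s (tnth s i).1 (tnth s i).2.

Definition is_estimator (F : estimator) : Prop :=
  (forall n (s : n.-tuple (R * covariate)) (z : covariate),
     (forall i, 0 <= (tnth s i).1 <= 1 /\ cube (tnth s i).2) -> cube z ->
     [/\ {in `[0, 1] &, {homo (fun t => F n s t z) : t u / t <= u}},
         {within `[0, 1], continuous (fun t => F n s t z)},
         F n s 0 z = 0 & F n s 1 z = 1]) /\
  (forall n (i : 'I_n), measurable_fun setT (fun s => residual F s i)).

Definition sup_norm (D : covariate -> set R) (f : R -> covariate -> R) :
    \bar R :=
  ereal_sup [set ereal_sup [set `|f t z|%:E | t in D z] | z in cube].

Section scores.
Variables (q : nat) (phi : 'I_q -> R -> R).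

Definition supp (k : 'I_q) : set R := closure [set u | phi k u != 0].

(* Each phi_k, a function on [0,1] supported in (0,1), is extended by zero to
   the real line. *)
Definition is_score : Prop :=
  [/\ forall k, compact (supp k) /\ supp k `<=` `]0, 1[,
      forall k, [lipschitz (phi k u : R^o) | u in (`[0, 1] : set R^o)],
      forall k, \int[lebesgue_measure]_(u in `[0, 1]) phi k u = 0,
      forall k, \int[lebesgue_measure]_(u in `[0, 1]) (phi k u ^+ 2) = 1 &
      forall c : 'I_q -> R,
        (forall u, 0 <= u <= 1 -> \sum_k c k * phi k u = 0) ->
        forall k, c k = 0].

Definition tau_min : R := inf (\bigcup_k supp k).
Definition tau_max : R := sup (\bigcup_k supp k).

Definition central (K : R.-pker covariate ~> R) (z : covariate) : set R :=
  `[quantile K tau_min z, quantile K tau_max z]%classic.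

Definition normT (K : R.-pker covariate ~> R) : (R -> covariate -> R) -> \bar R :=
  sup_norm (central K).
Definition normTc (K : R.-pker covariate ~> R) : (R -> covariate -> R) -> \bar R :=
  sup_norm (fun z => `[0, 1]%classic `\` central K z).

Definition phi_vec (u : R) : 'cV[R]_q := \col_k phi k u.

Definition rho_hat (FX FY : estimator) n (s : n.-tuple obs) : 'M[R]_q :=
  n%:R^-1 *: \sum_(i < n) phi_vec (residual FX (sampleXZ s) i) *m
                          (phi_vec (residual FY (sampleYZ s) i))^T.

Definition Sigma : 'M[R]_q :=
  \matrix_(k, s) \int[lebesgue_measure]_(u in `[0, 1]) (phi k u * phi s u).

End scores.

Definition psd q (A : 'M[R]_q) : Prop :=
  A^T = A /\ forall v : 'cV[R]_q, 0 <= (v^T *m A *m v) ord0 ord0.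

(* The unique positive semidefinite square root of a positive semidefinite A. *)
Definition sqrtmx q (A : 'M[R]_q) : 'M[R]_q :=
  xget 0 [set B : 'M[R]_q | psd B /\ B *m B = A].

Definition frobenius q (A : 'M[R]_q) : R :=
  Num.sqrt (\sum_i \sum_j A i j ^+ 2).

Definition T_stat q (phi : 'I_q -> R -> R) (FX FY : estimator) n
    (s : n.-tuple obs) : R :=
  let S := invmx (sqrtmx (Sigma phi)) in
  frobenius (S *m rho_hat phi FX FY s *m S) ^+ 2.

(* The chi-squared distribution function with k degrees of freedom: the sum of
   squares of k independent standard normal variables. *)
Definition chi2_cdf (k : nat) (x : R) : R :=
  fine (iid_law (std_normal R) k
          [set v | \sum_(i < k) tnth v i ^+ 2 <= x]).

Definition chi2_quantile (k : nat) (p : R) : R :=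
  inf [set x | p <= chi2_cdf k x].

Definition test q (phi : 'I_q -> R -> R) (FX FY : estimator) (alpha : R) n
    (s : n.-tuple obs) : R :=
  (n%:R^-1 * chi2_quantile (q ^ 2) (1 - alpha) < T_stat phi FX FY s)%R%:R.

End model.

(* Main.v *)
Require Import Defs.
From mathcomp Require Import all_boot all_order all_algebra.
From mathcomp Require Import all_classical all_reals all_analysis.
From mathcomp Require Import spectral sesquilinear complex.
From mathcomp Require Import measurable_realfun ring lra zify.
Set Implicit Arguments.
Unset Strict Implicit.
Unset Printing Implicit Defensive.
Import Order.TTheory GRing.Theory Num.Theory.
Import numFieldNormedType.Exports.
Local Open Scope classical_set_scope.
Local Open Scope ring_scope.

(** The oracle. Let U = F_X|Z(X|Z) and V = F_Y|Z(Y|Z) be the true conditional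
    ranks. The rank of a draw from a continuous law is uniform whatever that
    law is, so that, if X and Y are conditionally independent given Z, the rank
    V is uniform and independent of the pair (X, Z), and likewise U of (Y, Z)
    [conditional_rank_uniform]. Multiplying the scores by the inverse square
    root of Sigma makes them orthonormal for the uniform law [whiteningK,
    has_mean_white_scoreM]; call the results psi_i. The q^2 products
    psi_i(U) psi_j(V) are then centred, orthonormal and bounded
    [isotropic_product_score], and the squared norm of their normalized sum
    over the sample tends in law to chi-squared with q^2 degrees of freedom.
    As the bound on the products does not depend on the law of the
    observations, neither does the speed of convergence [clt_sqnorm]. This form
    of the central limit theorem comes from Lindeberg's exchange argument:
    steps of the walk are replaced by Gaussian ones, one at a time, against a
    threshold of the squared norm that is smoothed enough to have a
    second-order Taylor expansion with cubic remainder, and two steps with the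
    same first and second moments differ by this remainder only.

    The estimated ranks. The statistic n T_n is the squared norm of the same
    vector with estimated ranks [T_statE]. The difference of the two vectors
    consists of three terms [estimated_scores_close]. A term that is linear in
    the errors of the X-scores is a sum of scores psi_j(V) weighted by functions
    of the sample of (X, Z); given that sample the summands are independent and
    centred, so the second moment of the normalized sum is of the order of the
    squared error, which tends to zero [weighted_score_tail]. The term that is
    linear in the errors of the Y-scores is symmetric. The product of both errors
    is bounded by sqrt n g(n) h(n) up to a constant, and tends to zero by
    assumption. The errors of the scores are controlled everywhere by the error
    of the estimator in the central region: outside of that region the true
    score vanishes, and the monotone estimated distribution function is pinned
    by its value at the boundary of the region [score_error].

    The level. Outside an exceptional set of small outer probability, n T_n
    exceeds the critical value z if the squared norm of the oracle exceeds
    z + eta, and only if it exceeds z - eta [level_bracket]. The chi-squared law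
    has no atoms [chi2_small], so both events have probability close to alpha
    [chi2_quantile_bracket]. All choices are uniform over the laws in the null
    hypothesis [uniform_level]; hence the rejection probabilities converge to
    alpha uniformly, and so does their supremum. *)

(** * Integration against the law of an i.i.d. sample *)

Lemma integral_cst_prob d (T : measurableType d) (R : realType)
    (P : probability T R) (r : \bar R) : (\int[P]_x r = r)%E.
Proof.
by rewrite (_ : (fun=> r) = cst r)// integral_cst//= probability_setT mule1.
Qed.

Section iid_integration.
Local Open Scope ereal_scope.
Context d (T : measurableType d) (R : realType) (P : probability T R).

Lemma ge0_integral_product_prob (d' : measure_display) (T' : measurableType d')
    (Q : probability T' R) (f : (T * T')%type -> \bar R) :
  measurable_fun setT f -> (forall z, 0 <= f z) ->
  \int[product_prob P Q]_z f z = \int[P]_x \int[Q]_y f (x, y).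
Proof. by move=> mf f0; rewrite fubini_tonelli1. Qed.

Lemma ge0_integral_iid0 (f : 0.-tuple T -> \bar R) :
  measurable_fun setT f -> \int[iid_law P 0]_s f s = f [tuple].
Proof. by move=> mf; rewrite integral_dirac// diracT mul1e. Qed.

Lemma measurable_tuple_cons_comp d' (T' : measurableType d') n
    (f : T' -> T) (g : T' -> n.-tuple T) :
  measurable_fun setT f -> measurable_fun setT g ->
  measurable_fun setT (fun z => tuple_cons (f z, g z)).
Proof. exact: measurable_cons. Qed.

Lemma measurable_consl n (x : T) :
  measurable_fun setT (fun t : n.-tuple T => tuple_cons (x, t)).
Proof. exact: (measurableT_comp (@measurable_tuple_cons _ _ n)). Qed.

Lemma ge0_integral_iidS n (f : n.+1.-tuple T -> \bar R) :
  measurable_fun setT f -> (forall s, 0 <= f s) ->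
  \int[iid_law P n.+1]_s f s =
  \int[P]_x \int[iid_law P n]_t f (tuple_cons (x, t)).
Proof.
move=> mf f0; transitivity (\int[distribution (product_prob P (iid_law P n))
    (@tuple_cons _ T n)]_s f s); first by [].
rewrite ge0_integral_distribution// ge0_integral_product_prob//.
- exact: measurableT_comp.
- by move=> z; exact: f0.
Qed.

Lemma ge0_integral_iid_marginal n (i : 'I_n) (f : T -> \bar R) :
  measurable_fun setT f -> (forall x, 0 <= f x) ->
  \int[iid_law P n]_s f (tnth s i) = \int[P]_x f x.
Proof.
move=> mf f0; elim: n i => [[]//|n IH] i.
rewrite (ge0_integral_iidS (f := fun s => f (tnth s i)))//; last first.
  exact: (measurableT_comp mf (@measurable_tnth _ _ _ i)).
case: (unliftP ord0 i) => [j ->|->].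
  rewrite -[RHS](integral_cst_prob P (\int[P]_x f x)); apply: eq_integral => x _.
  by rewrite -(IH j); apply: eq_integral => t _; rewrite tnthS.
by apply: eq_integral => x _; exact: (integral_cst_prob _ (f x)).
Qed.

End iid_integration.

Lemma tuple_consE d (T : measurableType d) n (x : T) (t : n.-tuple T) :
  (tnth (tuple_cons (x, t)) ord0 = x) *
  (forall i, tnth (tuple_cons (x, t)) (lift ord0 i) = tnth t i).
Proof. by split=> // i; rewrite tnthS. Qed.

Lemma map_tuple_cons d d' (T : measurableType d) (U : measurableType d')
    (f : T -> U) n x (t : n.-tuple T) :
  map_tuple f (tuple_cons (x, t)) = tuple_cons (f x, map_tuple f t).
Proof. exact: val_inj. Qed.

Lemma measurable_map_tuple d d' (T : measurableType d) (U : measurableType d')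
    (f : T -> U) n :
  measurable_fun setT f -> measurable_fun setT (@map_tuple n _ _ f).
Proof.
move=> mf; apply/measurable_fun_tnthP => i /=.
rewrite (_ : _ \o _ = fun t => f (tnth t i)); last first.
  by apply/funext => t /=; rewrite tnth_map.
apply: (measurableT_comp mf); exact: measurable_tnth.
Qed.

Section iid_coupling.
Local Open Scope ereal_scope.
Context d (T : measurableType d) (R : realType) (P : probability T R).
Context d1 (T1 : measurableType d1) d2 (T2 : measurableType d2).
Variables (P1 : probability T1 R) (P2 : probability T2 R).
Variables (A : T -> T1) (B : T -> T2).
Hypotheses (mA : measurable_fun setT A) (mB : measurable_fun setT B).
Hypothesis indep : forall f : T1 * T2 -> \bar R, measurable_fun setT f ->
  (forall z, 0 <= f z) ->
  \int[P]_w f (A w, B w) = \int[P1]_a \int[P2]_b f (a, b).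

(** Samples of the two components may be integrated one after the other: with
    the first sample frozen, only the second one is random. By induction on the
    sample size, exchanging at each stage the integral over the new second
    component with the one over the rest of the first sample. *)
Lemma ge0_integral_iid_indep n (f : n.-tuple T1 * n.-tuple T2 -> \bar R) :
  measurable_fun setT f -> (forall z, 0 <= f z) ->
  \int[iid_law P n]_s f (map_tuple A s, map_tuple B s) =
  \int[iid_law P1 n]_x \int[iid_law P2 n]_u f (x, u).
Proof.
elim: n f => [|n IH] f mf f0.
  rewrite !ge0_integral_iid0//.
  - by congr f; congr (_, _); exact: val_inj.
  - exact: (measurableT_comp mf).
  - exact: measurable_fun_fubini_tonelli_F.
  - apply: (measurableT_comp mf); apply/measurable_fun_pairP; split.
      exact: measurable_map_tuple.
    exact: measurable_map_tuple.
have mAB : measurable_fun setT (fun s : n.+1.-tuple T => (map_tuple A s, map_tuple B s)).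
  by apply/measurable_fun_pairP; split; exact: measurable_map_tuple.
rewrite ge0_integral_iidS//; last exact: (measurableT_comp mf).
pose h (ab : T1 * T2) : \bar R := \int[iid_law P1 n]_x \int[iid_law P2 n]_u
  f (tuple_cons (ab.1, x), tuple_cons (ab.2, u)).
have mF : measurable_fun setT (fun z : (T1 * T2 * n.-tuple T1) * n.-tuple T2 =>
    f (tuple_cons (z.1.1.1, z.1.2), tuple_cons (z.1.1.2, z.2))).
  apply: (measurableT_comp mf); apply: measurable_fun_pair => /=.
    apply: measurable_tuple_cons_comp.
      by do 3 apply: (measurableT_comp measurable_fst).
    exact: (measurableT_comp measurable_snd).
  apply: measurable_tuple_cons_comp => //.
  by apply: (measurableT_comp measurable_snd); apply: (measurableT_comp measurable_fst).
have mh : measurable_fun setT h.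
  apply: (@measurable_fun_fubini_tonelli_F _ _ _ _ _ _
    (fun z => \int[iid_law P2 n]_u
      f (tuple_cons (z.1.1, z.2), tuple_cons (z.1.2, u)))) => [|z].
    by apply: (@measurable_fun_fubini_tonelli_F _ _ _ _ _ _ _ mF) => z; exact: f0.
  exact: integral_ge0.
transitivity (\int[P]_w h (A w, B w)).
  apply: eq_integral => w _ /=.
  under eq_integral do rewrite !map_tuple_cons.
  pose g (z : n.-tuple T1 * n.-tuple T2) :=
    f (tuple_cons (A w, z.1), tuple_cons (B w, z.2)).
  rewrite (IH g)// => [|z]; last exact: f0.
  by apply: (measurableT_comp mf); apply: measurable_fun_pair => /=;
    apply: measurable_tuple_cons_comp.
rewrite indep// => [|z]; last by apply: integral_ge0 => x _; exact: integral_ge0.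
rewrite ge0_integral_iidS; last 2 first.
- exact: measurable_fun_fubini_tonelli_F.
- by move=> s; exact: integral_ge0.
apply: eq_integral => a _.
transitivity (\int[P2]_b \int[iid_law P1 n]_x \int[iid_law P2 n]_u
    f (tuple_cons (a, x), tuple_cons (b, u))); first by [].
pose k (z : T2 * n.-tuple T1) : \bar R := \int[iid_law P2 n]_u
    f (tuple_cons (a, z.2), tuple_cons (z.1, u)).
have mk : measurable_fun setT k.
  apply: (@measurable_fun_fubini_tonelli_F _ _ _ _ _ _ (fun z =>
    f (tuple_cons (a, z.1.2), tuple_cons (z.1.1, z.2)))) => // .
  apply: (measurableT_comp mf); apply: measurable_fun_pair => /=.
    by apply: measurable_tuple_cons_comp => //; apply: (measurableT_comp measurable_snd).
  by apply: measurable_tuple_cons_comp => //; apply: (measurableT_comp measurable_fst).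
rewrite (@fubini_tonelli _ _ _ _ _ P2 (iid_law P1 n) k)//; last first.
  by move=> z; exact: integral_ge0.
apply: eq_integral => x _.
rewrite ge0_integral_iidS//.
exact: (measurableT_comp mf).
Qed.

End iid_coupling.

Section iid_orthogonality.
Local Open Scope ereal_scope.
Context d (T : measurableType d) (R : realType) (P : probability T R).
Variable b : T -> R.
Hypothesis mb : measurable_fun setT b.
Hypothesis var_b : forall c a : R,
  \int[P]_x ((c + a * b x) ^+ 2)%:E = (c ^+ 2 + a ^+ 2)%:E.

Lemma measurable_tnth_comp (f : T -> R) n (i : 'I_n) : measurable_fun setT f ->
  measurable_fun setT (fun s : n.-tuple T => f (tnth s i)).
Proof. by move=> mf; apply: (measurableT_comp mf); exact: measurable_tnth. Qed.

(** The squares add up because the first factor only shifts the constant in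
    front of the sum over the other ones. *)
Lemma iid_sum_sqr n (c : R) (a : 'I_n -> R) :
  \int[iid_law P n]_s ((c + \sum_(i < n) a i * b (tnth s i)) ^+ 2)%:E =
  (c ^+ 2 + \sum_(i < n) a i ^+ 2)%:E.
Proof.
elim: n c a => [|n IH] c a.
  have -> : (fun s : 0.-tuple T => ((c + \sum_(i < 0) a i * b (tnth s i)) ^+ 2)%:E)
      = cst (c ^+ 2)%:E.
    by apply/funext => s /=; rewrite big_ord0 addr0.
  by rewrite ge0_integral_iid0// big_ord0 addr0.
have mS m (e : R) (g : 'I_m -> R) : measurable_fun setT
    (fun s : m.-tuple T => ((e + \sum_(i < m) g i * b (tnth s i)) ^+ 2)%:E).
  apply/measurable_EFinP; apply: measurable_funX; apply: measurable_funD => //.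
  by apply: measurable_sum => i; apply: measurable_funM => //; exact: measurable_tnth_comp.
rewrite ge0_integral_iidS//; last by move=> s; rewrite lee_fin sqr_ge0.
under eq_integral => x _.
  under eq_integral => t _.
    rewrite big_ord_recl tuple_consE addrA.
    under eq_bigr do rewrite tuple_consE.
    over.
  rewrite /= IH EFinD. over.
rewrite /= ge0_integralD//.
- rewrite var_b integral_cst_prob -EFinD big_ord_recl.
  by rewrite addrA.
- by move=> x _; rewrite lee_fin sqr_ge0.
- apply/measurable_EFinP; apply: measurable_funX; apply: measurable_funD => //.
  exact: measurable_funM.
- by move=> x _; rewrite lee_fin sumr_ge0// => i _; rewrite sqr_ge0.
Qed.

End iid_orthogonality.

(** * Densities and the Gaussian law *)

Section density.
Local Open Scope ereal_scope.
Context d (T : measurableType d) (R : realType).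
Variables (mu nu : {measure set T -> \bar R}) (g : T -> R).
Hypotheses (mg : measurable_fun setT g) (g0 : forall x, (0 <= g x)%R).
Hypothesis nuE : forall A, measurable A -> nu A = \int[mu]_(x in A) (g x)%:E.

Import HBNNSimple.

Let density_indic (A : set T) : measurable A ->
  \int[nu]_x (\1_A x)%:E = \int[mu]_x ((\1_A x)%:E * (g x)%:E).
Proof.
move=> mA; rewrite integral_indic// setIT nuE// [LHS]integral_mkcond.
by apply: eq_integral => x _; rewrite epatch_indic muleC.
Qed.

Let mg' : measurable_fun setT (EFin \o g).
Proof. exact/measurable_EFinP. Qed.

Let density_nnsfun (f : {nnsfun T >-> R}) :
  \int[nu]_x (f x)%:E = \int[mu]_x ((f x)%:E * (g x)%:E).
Proof.
under [LHS]eq_integral do rewrite fimfunE -fsumEFin//.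
rewrite [LHS]ge0_integral_fsum//; last 2 first.
  - by move=> r; exact/measurable_EFinP/measurableT_comp.
  - by move=> n x _; rewrite EFinM nnfun_muleindic_ge0.
under [RHS]eq_integral.
  move=> x xD; rewrite fimfunE -fsumEFin// ge0_mule_fsuml; last first.
    by move=> r; rewrite EFinM nnfun_muleindic_ge0.
  over.
rewrite [RHS]ge0_integral_fsum//; last 2 first.
  - move=> r; apply: emeasurable_funM => //.
    by apply/measurable_EFinP; do 2 apply/measurableT_comp => //.
  - by move=> n x _; rewrite mule_ge0 ?lee_fin// -lee_fin EFinM nnfun_muleindic_ge0.
apply: eq_fsbigr => r /[!inE] rf.
have r0 : (0 <= r)%R by case: rf => x _ <-.
under eq_integral do rewrite EFinM.
under [RHS]eq_integral do rewrite EFinM -muleA.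
rewrite !ge0_integralZl// ?density_indic//.
- by apply: emeasurable_funM => //; exact/measurable_EFinP/measurable_indic.
- by move=> x _; rewrite mule_ge0 ?lee_fin.
- exact/measurable_EFinP/measurable_indic.
Qed.

Lemma ge0_integral_density (f : T -> \bar R) :
  measurable_fun setT f -> (forall x, 0 <= f x) ->
  \int[nu]_x f x = \int[mu]_x (f x * (g x)%:E).
Proof.
move=> mf f0; pose h := nnsfun_approx measurableT mf.
have fE x : f x = limn (EFin \o h ^~ x).
  by apply/esym/cvg_lim => //; exact: cvg_nnsfun_approx.
have -> : \int[nu]_x f x = limn (fun n => \int[nu]_x (h n x)%:E).
  rewrite -monotone_convergence//=.
  - by apply: eq_integral => x _; rewrite fE.
  - by move=> n; exact/measurable_EFinP/measurable_funTS.
  - by move=> n ? _; rewrite lee_fin.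
  - by move=> ? _ ? ? mn; rewrite lee_fin; exact/lefP/nd_nnsfun_approx.
have -> : \int[mu]_x (f x * (g x)%:E) =
    limn (fun n => \int[mu]_x ((h n x)%:E * (g x)%:E)).
  rewrite -monotone_convergence//=.
  - apply: eq_integral => x _; apply/esym/cvg_lim => //; apply: cvgeZr => //.
    exact: cvg_nnsfun_approx.
  - move=> n; apply: emeasurable_funM => //.
    exact/measurable_EFinP/measurable_funTS.
  - by move=> n x _; rewrite mule_ge0 ?lee_fin.
  - move=> x _ a b ab; rewrite lee_wpmul2r ?lee_fin//.
    exact/lefP/nd_nnsfun_approx.
by congr (limn _); apply/funext => n; exact: density_nnsfun.
Qed.

End density.

Section affine_lebesgue.
Local Open Scope ereal_scope.
Context (R : realType).
Notation mu := (@lebesgue_measure R).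

(** The image of Lebesgue measure under the affine map, multiplied by a, agrees
    with Lebesgue measure on intervals, hence everywhere. *)
Lemma ge0_integral_affine (a t : R) (f : R -> \bar R) : (0 < a)%R ->
  measurable_fun setT f -> (forall x, 0 <= f x) ->
  \int[mu]_x f x = a%:E * \int[mu]_x f (a * x + t)%R.
Proof.
move=> a0 mf f0.
pose T := fun x : measurableTypeR R => (a * x + t)%R : measurableTypeR R.
have mT : measurable_fun setT T.
  by apply: measurable_funD => //; exact: measurable_funM.
pose k : {nonneg R} := NngNum (ltW a0).
have E := ge0_integral_pushforward mT mu measurableT mf (fun x _ => f0 x).
rewrite preimage_setT in E.
rewrite [X in a%:E * X](_ : _ = \int[mu]_x (f \o T) x)// -E.
rewrite -[a]/(k%:num)%R -(ge0_integral_mscale _ measurableT k)//.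
apply: eq_measure_integral => A mA _.
apply: (@lebesgue_measure_unique _ (mscale k (pushforward mu T))) => // _ [[p q]] _ <-.
  rewrite [RHS](_ : _ = a%:E * mu (T @^-1` `]p, q]))//.
  have -> : T @^-1` `]p, q] = `]((p - t) / a)%R, ((q - t) / a)%R]%classic.
    apply/seteqP; split => x /=; rewrite !in_itv/= /T.
      by rewrite ltr_pdivrMr// ler_pdivlMr// ltrBlDr lerBrDr mulrC.
    by rewrite ltr_pdivrMr// ler_pdivlMr// ltrBlDr lerBrDr (mulrC x).
  rewrite !lebesgue_measure_itv/= !lte_fin ltr_pM2r ?invr_gt0// ltrD2r.
  case: ifPn => _; last by rewrite mule0.
  rewrite -EFinB -EFinM; congr EFin.
  by rewrite -mulrBl opprD addrACA subrr addr0 mulrCA divff ?mulr1 ?gt_eqF.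
Qed.

End affine_lebesgue.

Section std_normal.
Local Open Scope ereal_scope.
Context (R : realType).
Notation mu := (@lebesgue_measure R).
Notation N := (std_normal R).

Definition gauss_pdf (x : R) : R := normal_pdf 0 1 x.

Lemma gauss_pdfE x : gauss_pdf x = (normal_peak 1 * expR (- x ^+ 2 / 2))%R.
Proof.
by rewrite /gauss_pdf normal_pdfE ?oner_neq0//= /normal_fun subr0 expr1n.
Qed.

Lemma gauss_pdf_ge0 x : (0 <= gauss_pdf x)%R.
Proof. exact: normal_pdf_ge0. Qed.

Lemma measurable_gauss_pdf : measurable_fun setT gauss_pdf.
Proof. exact: measurable_normal_pdf. Qed.

Lemma ge0_integral_std_normal (f : R -> \bar R) :
  measurable_fun setT f -> (forall x, 0 <= f x) ->
  \int[N]_x f x = \int[mu]_x (f x * (gauss_pdf x)%:E).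
Proof.
move=> mf f0; rewrite ge0_integral_distribution//.
apply: (@ge0_integral_density _ (measurableTypeR R) R mu (normal_prob 0 1) gauss_pdf).
- exact: measurable_gauss_pdf.
- exact: gauss_pdf_ge0.
- by [].
- exact: mf.
- by move=> x; exact: f0.
Qed.

Lemma normal_peakV (s : R) : (0 < s)%R -> normal_peak s = (normal_peak 1 / s)%R.
Proof.
move=> s0; rewrite /normal_peak expr1n mul1r -mulrnAr sqrtrM ?sqr_ge0//.
by rewrite sqrtr_sqr gtr0_norm// invfM mulrC.
Qed.

End std_normal.

Section gauss_convolution.
Local Open Scope ereal_scope.
Context (R : realType).
Notation mu := (@lebesgue_measure R).
Notation N := (std_normal R).
Notation phi := (@gauss_pdf R).

Lemma measurable_affine (a t : R) : measurable_fun setT (fun x : R => a * x + t)%R.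
Proof. by apply: measurable_funD => //; exact: measurable_funM. Qed.

Lemma measurable_gauss_pdf_affine (a t : R) :
  measurable_fun setT (fun x => phi (a * x + t)%R).
Proof. exact: (measurableT_comp (@measurable_gauss_pdf R) (measurable_affine a t)). Qed.

Lemma ge0_integral_std_normal_affine (a t : R) (f : R -> \bar R) : (0 < a)%R ->
  measurable_fun setT f -> (forall x, 0 <= f x) ->
  \int[N]_x f (a * x + t)%R = \int[mu]_u (f u * (phi ((u - t) / a) / a)%:E).
Proof.
move=> a0 mf f0.
have mphi : measurable_fun setT (fun u : R => phi ((u - t) / a)%R).
  rewrite (_ : (fun _ => _) = fun u => phi (a^-1 * u + - (t / a))%R).
    exact: measurable_gauss_pdf_affine.
  by apply/funext => u; congr phi; rewrite mulrBl mulrC.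
rewrite ge0_integral_std_normal//; last first.
  exact: (measurableT_comp mf (measurable_affine a t)).
rewrite [RHS](ge0_integral_affine t a0)//; last 2 first.
- apply: emeasurable_funM => //; apply/measurable_EFinP; exact: measurable_funM.
- by move=> x; rewrite mule_ge0// lee_fin divr_ge0 ?gauss_pdf_ge0// ltW.
rewrite -ge0_integralZl//; last 3 first.
- apply: emeasurable_funM => /=.
    exact: (measurableT_comp mf (measurable_affine a t)).
  apply/measurable_EFinP; apply: measurable_funM => //=.
  exact: (measurableT_comp mphi (measurable_affine a t)).
- by move=> x _; rewrite mule_ge0// lee_fin divr_ge0 ?gauss_pdf_ge0// ltW.
- by rewrite lee_fin ltW.
apply: eq_integral => x _.
rewrite muleCA -EFinM; congr (_ * EFin _).
by rewrite addrK mulrAC divff ?gt_eqF// mul1r mulrCA divff ?gt_eqF// mulr1.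
Qed.

Lemma gauss_pdf_split (a b c u y : R) : (0 < a)%R -> (0 < c)%R ->
  (c ^+ 2 = a ^+ 2 + b ^+ 2)%R ->
  (phi ((u - b * y) / a) / a * phi y =
   phi (u / c) / c * normal_pdf (b * u / c ^+ 2) (a / c) y)%R.
Proof.
move=> a0 c0 cab.
have aN0 : (a != 0)%R by rewrite gt_eqF.
have cN0 : (c != 0)%R by rewrite gt_eqF.
have ac0 : (0 < a / c)%R by rewrite divr_gt0.
rewrite !gauss_pdfE normal_pdfE ?gt_eqF//= /normal_fun (normal_peakV ac0).
set K := normal_peak 1.
have -> : (K * expR (- ((u - b * y) / a) ^+ 2 / 2) / a * (K * expR (- y ^+ 2 / 2))
    = K ^+ 2 / a * (expR (- ((u - b * y) / a) ^+ 2 / 2) * expR (- y ^+ 2 / 2)))%R.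
  by rewrite expr2; ring.
have -> : (K * expR (- (u / c) ^+ 2 / 2) / c * (K / (a / c) *
      expR (- (y - b * u / c ^+ 2) ^+ 2 / ((a / c) ^+ 2 *+ 2)))
    = K ^+ 2 / a * (expR (- (u / c) ^+ 2 / 2) *
        expR (- (y - b * u / c ^+ 2) ^+ 2 / ((a / c) ^+ 2 *+ 2))))%R.
  by field; rewrite aN0 cN0.
congr (_ * _)%R; rewrite -!expRD; congr expR.
apply/eqP; rewrite -subr_eq0; apply/eqP.
transitivity ((c ^+ 2 - (a ^+ 2 + b ^+ 2)) *
  (y ^+ 2 / a ^+ 2 - u ^+ 2 / (a ^+ 2 * c ^+ 2)) / 2)%R.
  by field; rewrite aN0 cN0.
by rewrite cab subrr !mul0r.
Qed.

(** The joint density splits, by completing the square, into the density of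
    the combination times a conditional density of the second variable, which
    integrates to one. *)
Lemma std_normal_convolution (a b c : R) (f : R -> \bar R) :
  (0 < a)%R -> (0 < c)%R -> (c ^+ 2 = a ^+ 2 + b ^+ 2)%R ->
  measurable_fun setT f -> (forall x, 0 <= f x) ->
  \int[N]_y \int[N]_x f (a * x + b * y)%R = \int[N]_z f (c * z)%R.
Proof.
move=> a0 c0 cab mf f0.
have mcomp (g : R * R -> R) : measurable_fun setT g -> measurable_fun setT (phi \o g).
  exact: (measurableT_comp (@measurable_gauss_pdf R)).
have mk : measurable_fun setT (fun z : measurableTypeR R * measurableTypeR R =>
    f z.2 * (phi ((z.2 - b * z.1) / a) / a * phi z.1)%:E).
  suff : measurable_fun setT (fun z : R * R =>
    f z.2 * (phi ((z.2 - b * z.1) / a) / a * phi z.1)%:E) by [].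
  apply: emeasurable_funM; first exact: (measurableT_comp mf).
  apply/measurable_EFinP; apply: measurable_funM; last exact: mcomp.
  apply: measurable_funM => //; apply: (mcomp (fun z => (z.2 - b * z.1) / a)%R).
  apply: measurable_funM => //; apply: measurable_funB => //.
  exact: measurable_funM.
have k0 (z : measurableTypeR R * measurableTypeR R) : 0 <= f z.2 * (phi ((z.2 - b * z.1) / a) / a * phi z.1)%:E.
  by rewrite mule_ge0// lee_fin mulr_ge0 ?divr_ge0 ?gauss_pdf_ge0// ltW.
rewrite ge0_integral_std_normal; last 2 first.
- apply: (@measurable_fun_fubini_tonelli_F _ _ _ _ _ _
    (fun z : R * R => f (a * z.2 + b * z.1)%R)) => [|z]; last exact: f0.
  apply: (measurableT_comp mf); apply: measurable_funD; exact: measurable_funM.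
- by move=> y; exact: integral_ge0.
transitivity (\int[mu]_y \int[mu]_u
    (f u * (phi ((u - b * y) / a) / a * phi y)%:E)).
  apply: eq_integral => y _; rewrite ge0_integral_std_normal_affine//.
  rewrite -ge0_integralZr//.
  - by apply: eq_integral => u _; rewrite -muleA -EFinM.
  - apply: emeasurable_funM => //; apply/measurable_EFinP.
    apply: measurable_funM => //; apply: (measurableT_comp (@measurable_gauss_pdf R)).
    by apply: measurable_funM => //; exact: measurable_funB.
  - by move=> u _; rewrite mule_ge0// lee_fin divr_ge0 ?gauss_pdf_ge0// ltW.
  - by rewrite lee_fin gauss_pdf_ge0.
transitivity (\int[mu]_u \int[mu]_y
    (f u * (phi ((u - b * y) / a) / a * phi y)%:E)).
  exact: (fubini_tonelli _ mk k0).
have -> : \int[N]_z f (c * z)%R = \int[mu]_u (f u * (phi (u / c) / c)%:E).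
  under eq_integral do rewrite -[(c * _)%R]addr0.
  rewrite (ge0_integral_std_normal_affine 0 c0 mf f0).
  by apply: eq_integral => x _; rewrite subr0.
apply: eq_integral => u _.
under eq_integral do rewrite (gauss_pdf_split _ _ a0 c0 cab) EFinM muleA.
have ? : 0 <= f u * (phi (u / c) / c)%:E.
  by rewrite mule_ge0// lee_fin divr_ge0 ?gauss_pdf_ge0// ltW.
rewrite ge0_integralZl ?integral_normal_pdf ?mule1//.
- by apply/measurable_EFinP; exact: measurable_normal_pdf.
- by move=> x _; rewrite lee_fin normal_pdf_ge0.
Qed.

End gauss_convolution.

Section gauss_moments.
Local Open Scope ereal_scope.
Context (R : realType).
Notation mu := (@lebesgue_measure R).
Notation N := (std_normal R).
Notation phi := (@gauss_pdf R).

Lemma gauss_pdfN x : phi (- x) = phi x.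
Proof. by rewrite !gauss_pdfE sqrrN. Qed.

Lemma continuous_gauss_pdf : continuous phi.
Proof. by apply: continuous_normal_pdf; rewrite oner_neq0. Qed.

Lemma ge0_integral_std_normalN (f : R -> \bar R) :
  measurable_fun setT f -> (forall x, 0 <= f x) ->
  \int[N]_x f (- x)%R = \int[N]_x f x.
Proof.
move=> mf f0; rewrite !ge0_integral_std_normal//; last exact: (measurableT_comp mf).
under eq_integral => x _ do rewrite -(gauss_pdfN x).
pose T := -%R : measurableTypeR R -> measurableTypeR R.
have mT : measurable_fun setT T.
  suff : measurable_fun setT (-%R : R -> R) by [].
  exact: oppr_measurable.
have E := @ge0_integral_pushforward _ _ (measurableTypeR R) (measurableTypeR R) _ T mT mu setT
  (fun x => f x * (phi x)%:E) measurableT.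
apply: (@etrans _ _ (\int[mu]_(x in T @^-1` setT)
    ((fun x : measurableTypeR R => f x * (phi x)%:E) \o T) x)).
  by rewrite preimage_setT.
rewrite -E; last 2 first.
- by apply: emeasurable_funM => //; apply/measurable_EFinP; exact: measurable_gauss_pdf.
- by move=> x _; rewrite mule_ge0// lee_fin gauss_pdf_ge0.
by apply: eq_measure_integral => A mA _; exact: lebesgue_measureN.
Qed.

Lemma is_derive_gauss_pdf (x : R) :
  is_derive x (1%R : R) (fun y : R => - phi y)%R (x * phi x)%R.
Proof.
have dsq : is_derive x (1%R : R) (fun y : R => - y ^+ 2 / 2)%R (- x)%R.
  apply: is_derive_eq => /=.
  by rewrite /GRing.scale /=; field.
have de := @is_derive1_comp R expR (fun y : R => - y ^+ 2 / 2)%R x _ _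
  (is_derive_expR (- x ^+ 2 / 2)%R) dsq.
have -> : (fun y : R => - phi y)%R =
    (fun y : R => - normal_peak 1 *: (expR \o (fun y : R => - y ^+ 2 / 2) : R -> R) y)%R.
  by apply/funext => y; rewrite gauss_pdfE /GRing.scale /= -mulNr.
apply: is_derive_eq.
by rewrite gauss_pdfE /GRing.scale /=; ring.
Qed.

Lemma cvg_gauss_pdfN : (- phi x)%R @[x --> +oo%R] --> (0%R : R).
Proof.
have -> : (fun x : R => - phi x)%R =
    (fun x : R => - (normal_peak 1 * (gauss_fun \o (fun x : R => (Num.sqrt 2)^-1 * x)) x))%R.
  apply/funext => x; rewrite gauss_pdfE /gauss_fun /= exprMn exprVn sqr_sqrtr//.
  by rewrite mulNr (mulrC (x ^+ 2)%R).
rewrite -oppr0; apply: cvgN; rewrite -(mulr0 (normal_peak 1)).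
apply: cvgMr; apply: (cvg_comp _ _ _ cvg_gauss_fun).
by apply: gt0_cvgMry => //; rewrite invr_gt0 sqrtr_gt0.
Qed.

Lemma integral_gauss_tail (t : R) : (0 <= t)%R ->
  \int[mu]_(x in `[t, +oo[) (x * phi x)%:E = (phi t)%:E.
Proof.
move=> t0.
rewrite (@ge0_continuous_FTC2y _ _ (fun y : R => - phi y)%R t 0%R).
- by rewrite -EFinB sub0r opprK.
- by move=> x tx; rewrite mulr_ge0 ?gauss_pdf_ge0// (le_trans t0).
- apply: continuous_subspaceT => x; apply: cvgM; first exact: cvg_id.
  exact: continuous_gauss_pdf.
- exact: cvg_gauss_pdfN.
- by move=> x _; have [] := is_derive_gauss_pdf x.
- apply: cvg_at_right_filter; apply: cvgN; exact: continuous_gauss_pdf.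
- by move=> x _; rewrite derive1E; apply: derive_val; exact: is_derive_gauss_pdf.
Qed.

Let cond (z : R * R) : bool := (0 <= z.1)%R && (z.1 <= z.2)%R.

(** Integration by parts in the form of Tonelli's theorem: one factor x is the
    length of the interval from 0 to x, and the remaining x times the density
    integrates over the tail to the density itself. *)
Lemma integral_sqr_gauss_half :
  \int[mu]_(x in `[0%R, +oo[) (x ^+ 2 * phi x)%:E =
  \int[mu]_(x in `[0%R, +oo[) (phi x)%:E.
Proof.
pose G (z : measurableTypeR R * measurableTypeR R) := (if cond z then z.2 * phi z.2 else 0)%:E.
have mG : measurable_fun setT G.
  suff : measurable_fun setT (fun z : R * R =>
    (if cond z then z.2 * phi z.2 else 0)%:E) by [].
  apply/measurable_EFinP; apply: measurable_fun_ifT => //.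
  - by apply: measurable_and; exact: measurable_fun_ler.
  - by apply: measurable_funM => //; apply: (measurableT_comp (@measurable_gauss_pdf R)).
have G0 z : 0 <= G z.
  rewrite /G /cond lee_fin; case: ifPn => // /andP[z0 z1].
  by rewrite mulr_ge0 ?gauss_pdf_ge0// (le_trans z0).
transitivity (\int[mu]_x \int[mu]_t G (t, x)).
  rewrite integral_mkcond; apply: eq_integral => x _; rewrite patchE.
  case: ifPn => [|]; rewrite ?notin_setE ?inE/= in_itv/= andbT => x0.
    transitivity (\int[mu]_t ((x * phi x)%:E * (\1_(`[0%R, x]%classic) t)%:E)).
      rewrite ge0_integralZl//; last 2 first.
      - by apply/measurable_EFinP; exact: measurable_indic.
      - by rewrite lee_fin mulr_ge0 ?gauss_pdf_ge0.
      rewrite integral_indic// setIT/= lebesgue_measure_itv/= lte_fin.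
      case: ltgtP x0 => // [x0 _|<- _].
        by rewrite -EFinB subr0 -EFinM; congr EFin; rewrite expr2 mulrAC.
      by rewrite mule0 expr0n mul0r.
    apply: eq_integral => t _; rewrite /G /cond/= indicE mem_setE in_itv/=.
    by case: ifPn => _; rewrite ?mule1 ?mule0.
  rewrite integral0_eq// => t _; rewrite /G /cond/=.
  by case: ifPn => // /andP[t0 tx]; exfalso; exact/x0/(le_trans t0).
rewrite -(fubini_tonelli _ mG G0) [RHS]integral_mkcond.
apply: eq_integral => t _; rewrite patchE.
case: ifPn => [|]; rewrite ?notin_setE ?inE/= in_itv/= andbT => t0.
  rewrite -integral_gauss_tail// [RHS]integral_mkcond.
  apply: eq_integral => x _; rewrite patchE /G /cond/= t0/= mem_setE in_itv/= andbT.
  by case: ifPn.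
rewrite integral0_eq// => x _; rewrite /G /cond/=.
by case: ifPn => // /andP[/t0].
Qed.

Lemma integral_std_normal_sqr : \int[N]_x (x ^+ 2)%:E = 1.
Proof.
rewrite ge0_integral_std_normal; last 2 first.
- by apply/measurable_EFinP; exact: measurable_funX.
- by move=> x; rewrite lee_fin sqr_ge0.
under eq_integral do rewrite -EFinM.
rewrite ge0_symfun_integralT; last 3 first.
- by move=> x; rewrite mulr_ge0 ?sqr_ge0 ?gauss_pdf_ge0.
- move=> x; apply: cvgM; last exact: continuous_gauss_pdf.
  exact: exprn_continuous.
- by move=> x /=; rewrite sqrrN gauss_pdfN.
rewrite -set_itvcy integral_sqr_gauss_half set_itvcy -ge0_symfun_integralT.
- exact: integral_normal_pdf.
- exact: gauss_pdf_ge0.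
- exact: continuous_gauss_pdf.
- by move=> x /=; rewrite gauss_pdfN.
Qed.

Lemma std_normal_var (c a : R) :
  \int[N]_x ((c + a * x) ^+ 2)%:E = (c ^+ 2 + a ^+ 2)%:E.
Proof.
have m2 (e : R) : measurable_fun setT (fun x : R => ((c + e * x) ^+ 2)%:E).
  apply/measurable_EFinP; apply: measurable_funX; apply: measurable_funD.
    exact: measurable_cst.
  exact: measurable_funM.
have p2 (e x : R) : 0 <= ((c + e * x) ^+ 2)%:E by rewrite lee_fin sqr_ge0.
have sym : \int[N]_x ((c + - a * x) ^+ 2)%:E = \int[N]_x ((c + a * x) ^+ 2)%:E.
  rewrite -(ge0_integral_std_normalN (m2 a) (p2 a)).
  by apply: eq_integral => x _; rewrite mulrN mulNr.
have : \int[N]_x ((c + a * x) ^+ 2)%:E + \int[N]_x ((c + - a * x) ^+ 2)%:E =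
    (2 * c ^+ 2)%:E + (2 * a ^+ 2)%:E.
  rewrite -ge0_integralD//.
  transitivity (\int[N]_x ((2 * c ^+ 2)%:E + (2 * a ^+ 2)%:E * (x ^+ 2)%:E)).
    by apply: eq_integral => x _; rewrite -!EFinM -!EFinD; congr EFin; ring.
  rewrite ge0_integralD//; last 3 first.
  - by move=> x _; rewrite lee_fin mulr_ge0 ?sqr_ge0.
  - by move=> x _; rewrite -EFinM lee_fin mulr_ge0 ?sqr_ge0// mulr_ge0 ?sqr_ge0.
  - by apply: emeasurable_funM => //; apply/measurable_EFinP; exact: measurable_funX.
  rewrite integral_cst_prob ge0_integralZl//.
  - by rewrite integral_std_normal_sqr mule1.
  - by apply/measurable_EFinP; exact: measurable_funX.
  - by move=> x _; rewrite lee_fin sqr_ge0.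
  - by rewrite lee_fin mulr_ge0 ?sqr_ge0.
rewrite sym; set I := \int[N]_x _.
have I0 : 0 <= I by exact: integral_ge0.
case: I I0 => [r| |]// _; rewrite -!EFinD => -[E]; congr EFin; lra.
Qed.

(** The cube is absorbed by half of the exponent, which leaves a multiple of
    the normal density of variance 2. *)
Lemma std_normal_abs3 : exists2 M : R, (0 <= M)%R &
  \int[N]_x (`|x| ^+ 3)%:E <= M%:E.
Proof.
pose s : R := Num.sqrt 2.
have s0 : (0 < s)%R by rewrite sqrtr_gt0.
exists (34 * s)%R; first by rewrite mulr_ge0// ltW.
have mx3 : measurable_fun setT (fun x : R => `|x| ^+ 3)%R.
  by apply: measurable_funX; exact: normr_measurable.
rewrite ge0_integral_std_normal; last 2 first.
- exact/measurable_EFinP.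
- by move=> x; rewrite lee_fin exprn_ge0.
apply: (@le_trans _ _ (\int[mu]_x ((34 * s)%:E * (normal_pdf 0 s x)%:E))).
  apply: ge0_le_integral => //.
  - by move=> x _; rewrite -EFinM lee_fin mulr_ge0 ?gauss_pdf_ge0 ?exprn_ge0.
  - apply: emeasurable_funM => //; apply/measurable_EFinP => //.
    exact: measurable_gauss_pdf.
  - apply: emeasurable_funM => //; apply/measurable_EFinP.
    exact: measurable_normal_pdf.
  - move=> x _; rewrite -!EFinM lee_fin.
    rewrite normal_pdfE ?gt_eqF//= /normal_fun normal_peakV// gauss_pdfE subr0.
    rewrite sqr_sqrtr//.
    have -> : (34 * s * (normal_peak 1 / s * expR (- x ^+ 2 / (2 *+ 2))) =
      normal_peak 1 * (34 * expR (- x ^+ 2 / (2 *+ 2))))%R.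
      by field; rewrite gt_eqF.
    rewrite mulrCA ler_pM2l ?normal_peak_gt0 ?oner_neq0//.
    have -> : (- x ^+ 2 / 2 = - (x ^+ 2 / 4) - x ^+ 2 / 4 :> R)%R by field.
    have -> : (- x ^+ 2 / (2 *+ 2) = - (x ^+ 2 / 4) :> R)%R.
      by rewrite -mulr_natr; field.
    rewrite expRD mulrCA [leRHS]mulrC ler_pM2l ?expR_gt0// expRN ler_pdivrMr ?expR_gt0//.
    (* |x|^3 exp(-x^2/2) <= 34 exp(-x^2/4), as exp y >= 1 + y^2/2 with y = x^2/4 *)
    have := @expR_ge1Dxn R (x ^+ 2 / 4) 1 (divr_ge0 (sqr_ge0 _) (ler0n _ _)).
    rewrite (_ : (2)`!%:R = 2%R)// => H.
    apply: (@le_trans _ _ (34 * (1 + (x ^+ 2 / 4) ^+ 2 / 2)))%R; last by rewrite ler_pM2l.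
    rewrite -(real_normK (num_real x)).
    have : (0 <= `|x|)%R by [].
    move: `|x|%R => y y0.
    have : (0 <= (y ^+ 2 - y) ^+ 2)%R by rewrite sqr_ge0.
    have : (0 <= (y - 1) ^+ 2)%R by rewrite sqr_ge0.
    rewrite !expr2 exprS expr2 => H1 H2; nra.
rewrite ge0_integralZl//.
- by rewrite integral_normal_pdf mule1.
- by apply/measurable_EFinP; exact: measurable_normal_pdf.
- by move=> x _; rewrite lee_fin normal_pdf_ge0.
- by rewrite lee_fin mulr_ge0// ltW.
Qed.

End gauss_moments.

(** * Random steps in a finite-dimensional space *)

Section vectors.
Context (R : realType) (m : nat).

Definition axpy (c : R) (w v : m.-tuple R) : m.-tuple R :=
  [tuple tnth w l + c * tnth v l | l < m].

Definition sqnorm (w : m.-tuple R) : R := \sum_(l < m) tnth w l ^+ 2.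

Definition norm1 (w : m.-tuple R) : R := \sum_(l < m) `|tnth w l|.

Lemma measurable_axpy d (T : measurableType d) (c : R) (f g : T -> m.-tuple R) :
  measurable_fun setT f -> measurable_fun setT g ->
  measurable_fun setT (fun z => axpy c (f z) (g z)).
Proof.
move=> mf mg; apply/measurable_fun_tnthP => l /=.
rewrite (_ : _ \o _ = fun z => tnth (f z) l + c * tnth (g z) l); last first.
  by apply/funext => z /=; rewrite tnth_mktuple.
apply: measurable_funD; first exact: (measurableT_comp (@measurable_tnth _ _ _ l)).
apply: measurable_funM => //.
exact: (measurableT_comp (@measurable_tnth _ _ _ l)).
Qed.

Lemma measurable_axpyr (c : R) (w : m.-tuple R) : measurable_fun setT (axpy c w).
Proof. exact: measurable_axpy. Qed.

Lemma measurable_sqnorm : measurable_fun setT sqnorm.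
Proof.
apply: measurable_sum => l; apply: measurable_funX; exact: measurable_tnth.
Qed.

Lemma measurable_norm1 : measurable_fun setT norm1.
Proof.
apply: measurable_sum => l; apply: (measurableT_comp (@normr_measurable R setT)).
exact: measurable_tnth.
Qed.

Lemma sqnorm_ge0 w : 0 <= sqnorm w.
Proof. by apply: sumr_ge0 => l _; rewrite sqr_ge0. Qed.

Lemma norm1_ge0 w : 0 <= norm1 w. Proof. exact: sumr_ge0. Qed.

Lemma axpyAC c1 c2 w v1 v2 :
  axpy c2 (axpy c1 w v1) v2 = axpy c1 (axpy c2 w v2) v1.
Proof. by apply: eq_from_tnth => l; rewrite !tnth_mktuple addrAC. Qed.

End vectors.

Lemma axpy_cons (R : realType) m (c x y : R) (w v : m.-tuple R) :
  axpy c (tuple_cons (x, w)) (tuple_cons (y, v)) =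
  tuple_cons (x + c * y, axpy c w v).
Proof.
apply: eq_from_tnth => l; rewrite tnth_mktuple.
case: (unliftP ord0 l) => [j ->|->]; first by rewrite !tuple_consE tnth_mktuple.
by rewrite !tuple_consE.
Qed.

Lemma tuple_consP d (T : measurableType d) m (w : m.+1.-tuple T) :
  exists x (v : m.-tuple T), w = tuple_cons (x, v).
Proof. by exists (thead w), [tuple of behead w]; exact: tuple_eta. Qed.

(** Random walks are handled through the averaging operators of their steps.
    These are positive, fix the constants and commute with each other, so that a
    comparison of two kinds of steps propagates to any number of steps. *)
Section step.
Local Open Scope ereal_scope.
Context (R : realType) (m : nat).
Notation vec := (m.-tuple R).

Definition step d (T : measurableType d) (mu : probability T R) (V : T -> vec)
  (c : R) (f : vec -> \bar R) (w : vec) : \bar R := \int[mu]_t f (axpy c w (V t)).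

Section one_step.
Context d (T : measurableType d) (mu : probability T R) (V : T -> vec) (c : R).
Hypothesis mV : measurable_fun setT V.
Notation S := (step mu V c).

Lemma measurable_step_in (f : vec -> \bar R) w : measurable_fun setT f ->
  measurable_fun setT (fun t => f (axpy c w (V t))).
Proof. by move=> mf; apply: (measurableT_comp mf); exact: measurable_axpy. Qed.

Lemma step_ge0 f w : (forall v, 0 <= f v) -> 0 <= S f w.
Proof. by move=> f0; exact: integral_ge0. Qed.

Lemma measurable_step f : measurable_fun setT f -> (forall v, 0 <= f v) ->
  measurable_fun setT (S f).
Proof.
move=> mf f0; apply: (@measurable_fun_fubini_tonelli_F _ _ _ _ _ _
  (fun z : vec * T => f (axpy c z.1 (V z.2)))) => [|z]; last exact: f0.
apply: (measurableT_comp mf); apply: measurable_axpy => //.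
exact: (measurableT_comp mV).
Qed.

Lemma step_le f g w : measurable_fun setT f -> measurable_fun setT g ->
  (forall v, 0 <= f v) -> (forall v, f v <= g v) -> S f w <= S g w.
Proof.
by move=> mf mg f0 fg; apply: ge0_le_integral => // *; exact: measurable_step_in.
Qed.

Lemma stepD_cst f (e : R) w : measurable_fun setT f -> (forall v, 0 <= f v) ->
  (0 <= e)%R -> S (fun v => f v + e%:E) w = S f w + e%:E.
Proof.
move=> mf f0 e0; rewrite /step ge0_integralD// ?integral_cst_prob//.
exact: measurable_step_in.
Qed.

Lemma iter_step n f : measurable_fun setT f -> (forall v, 0 <= f v) ->
  measurable_fun setT (iter n S f) /\ forall v, 0 <= iter n S f v.
Proof.
move=> mf f0; elim: n => [|n [mIH IH0]]/=; first by [].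
by split; [exact: measurable_step|move=> v; exact: step_ge0].
Qed.

Lemma iter_step_le n f g w : measurable_fun setT f -> measurable_fun setT g ->
  (forall v, 0 <= f v) -> (forall v, f v <= g v) -> iter n S f w <= iter n S g w.
Proof.
move=> mf mg f0 fg; elim: n w => [|n IH] w //=.
have g0 v : 0 <= g v by exact: le_trans (f0 v) (fg v).
have [? ?] := iter_step n mf f0; have [? ?] := iter_step n mg g0.
exact: step_le.
Qed.

Lemma iter_stepD_cst n f (e : R) w : measurable_fun setT f ->
  (forall v, 0 <= f v) -> (0 <= e)%R ->
  iter n S (fun v => f v + e%:E) w = iter n S f w + e%:E.
Proof.
move=> mf f0 e0; elim: n w => [|n IH] w //=.
have [? ?] := iter_step n mf f0.
by rewrite -stepD_cst//; congr (S _ w); apply/funext => v; exact: IH.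
Qed.

(** Peeling off the first observation turns the mean over the sample into one
    application of the operator to the mean over the rest. *)
Lemma integral_iid_walk n F w : measurable_fun setT F -> (forall v, 0 <= F v) ->
  \int[iid_law mu n]_s F [tuple (tnth w l +
     c * \sum_(i < n) tnth (V (tnth s i)) l)%R | l < m] = iter n S F w.
Proof.
move=> mF F0; elim: n w => [|n IH] w.
  rewrite (_ : (fun s => _) = cst (F w)).
    by rewrite ge0_integral_iid0.
  apply/funext => s /=; congr F; apply: eq_from_tnth => l.
  by rewrite tnth_mktuple big_ord0 mulr0 addr0.
rewrite ge0_integral_iidS//; last first.
  apply: (measurableT_comp mF); apply/measurable_fun_tnthP => l /=.
  rewrite (_ : _ \o _ = fun s => tnth w l +
      c * \sum_(i < n.+1) tnth (V (tnth s i)) l)%R; last first.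
    by apply/funext => s /=; rewrite tnth_mktuple.
  apply: measurable_funD => //; apply: measurable_funM => //.
  apply: measurable_sum => i; apply: (measurableT_comp (@measurable_tnth _ _ _ l)).
  by apply: (measurableT_comp mV); exact: measurable_tnth.
rewrite /= /step; apply: eq_integral => x _; rewrite -IH.
apply: eq_integral => t _; congr F; apply: eq_from_tnth => l.
rewrite !tnth_mktuple big_ord_recl tuple_consE mulrDr addrA.
by congr (_ + _ * _)%R; apply: eq_bigr => i _; rewrite tuple_consE.
Qed.

End one_step.

Section two_steps.
Context d1 (T1 : measurableType d1) (mu1 : probability T1 R) (V1 : T1 -> vec) (c1 : R).
Context d2 (T2 : measurableType d2) (mu2 : probability T2 R) (V2 : T2 -> vec) (c2 : R).
Hypotheses (mV1 : measurable_fun setT V1) (mV2 : measurable_fun setT V2).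
Notation S1 := (step mu1 V1 c1).
Notation S2 := (step mu2 V2 c2).

Lemma stepC f w : measurable_fun setT f -> (forall v, 0 <= f v) ->
  S1 (S2 f) w = S2 (S1 f) w.
Proof.
move=> mf f0; rewrite /step.
pose F (z : T1 * T2) := f (axpy c2 (axpy c1 w (V1 z.1)) (V2 z.2)).
transitivity (\int[mu2]_y \int[mu1]_x F (x, y)).
  rewrite -(@fubini_tonelli _ _ _ _ _ mu1 mu2 F)// => [|z]; last exact: f0.
  apply: (measurableT_comp mf); apply: measurable_axpy.
    by apply: measurable_axpy => //; exact: (measurableT_comp mV1).
  exact: (measurableT_comp mV2).
by apply: eq_integral => y _; apply: eq_integral => x _; rewrite /F axpyAC.
Qed.

Lemma iter_stepC n f w : measurable_fun setT f -> (forall v, 0 <= f v) ->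
  S1 (iter n S2 f) w = iter n S2 (S1 f) w.
Proof.
move=> mf f0; elim: n w => [|n IH] w //=.
have [? ?] := iter_step mu2 c2 mV2 n mf f0.
by rewrite stepC//; congr (S2 _ w); apply/funext => v; exact: IH.
Qed.

(** Replace the steps of the first kind by steps of the second kind one at a
    time; by commutation the replaced step can always be taken to be the one
    that acts on f directly, where the hypothesis compares them. *)
Lemma iter_step_compare n f (e : R) w : measurable_fun setT f ->
  (forall v, 0 <= f v) -> (0 <= e)%R ->
  (forall v, S1 f v <= S2 f v + e%:E) ->
  iter n S1 f w <= iter n S2 f w + (n%:R * e)%:E.
Proof.
move=> mf f0 e0 le12; elim: n w => [|n IH] w /=; first by rewrite mul0r adde0.
have [? ?] := iter_step mu1 c1 mV1 n mf f0; have [? ?] := iter_step mu2 c2 mV2 n mf f0.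
have ne0 : (0 <= n%:R * e)%R by rewrite mulr_ge0.
apply: (@le_trans _ _ (S1 (fun v => iter n S2 f v + (n%:R * e)%:E) w)).
  by apply: step_le => //; exact: emeasurable_funD.
rewrite stepD_cst// iter_stepC//.
have mS2 := measurable_step mu2 c2 mV2 mf f0.
have S20 v : 0 <= S2 f v by exact: step_ge0.
have mS1 := measurable_step mu1 c1 mV1 mf f0.
apply: (@le_trans _ _ (iter n S2 (fun v => S2 f v + e%:E) w + (n%:R * e)%:E)).
  rewrite leeD2r//; apply: iter_step_le => //; first exact: emeasurable_funD.
  by move=> v; exact: step_ge0.
rewrite iter_stepD_cst// -iterSr/= -addeA -EFinD.
by rewrite -[n.+1]add1n natrD mulrDl mul1r.
Qed.

End two_steps.

End step.

(** * Gaussian steps *)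

Section gauss_steps.
Local Open Scope ereal_scope.
Context (R : realType).
Notation N := (std_normal R).

(** Coordinatewise, this is the convolution of one-dimensional Gaussian laws. *)
Lemma gauss_step_comp m (a b c : R) (F : m.-tuple R -> \bar R) w :
  (0 < b)%R -> (0 < c)%R -> (c ^+ 2 = a ^+ 2 + b ^+ 2)%R ->
  measurable_fun setT F -> (forall v, 0 <= F v) ->
  step (iid_law N m) id a (step (iid_law N m) id b F) w =
  step (iid_law N m) id c F w.
Proof.
move=> b0 c0 cab.
have mFx k e (u : k.-tuple R) (H : k.-tuple R -> \bar R) : measurable_fun setT H ->
    measurable_fun setT (fun t => H (axpy e u t)).
  by move=> mH; exact: (measurableT_comp mH (measurable_axpyr e u)).
elim: m F w => [|m IH] F w mF F0.
  have mS := measurable_step (iid_law N 0) b (@measurable_id _ _ setT) mF F0.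
  rewrite {1}/step ge0_integral_iid0; last exact: (mFx _ a w _ mS).
  rewrite /step !ge0_integral_iid0; last 2 first.
  - exact: mFx.
  - exact: mFx.
  by congr F; apply: eq_from_tnth => -[].
have mS := measurable_step (iid_law N m.+1) b (@measurable_id _ _ setT) mF F0.
have mFc u : measurable_fun setT (fun t : m.-tuple R => F (tuple_cons (u, t))).
  by apply: (measurableT_comp mF); exact: measurable_tuple_cons_comp.
have [w0 [w' ->]] := tuple_consP w.
rewrite /step ge0_integral_iidS; last 2 first.
- exact: (mFx _ _ _ _ mS).
- by move=> s; exact: integral_ge0.
rewrite [RHS]ge0_integral_iidS//; last exact: mFx.
pose g u := \int[iid_law N m]_z F (tuple_cons (u, axpy c w' z)).
have mg : measurable_fun setT g.
  apply: (@measurable_fun_fubini_tonelli_F _ _ _ _ _ _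
    (fun p : R * m.-tuple R => F (tuple_cons (p.1, axpy c w' p.2)))) => [|z];
    last exact: F0.
  apply: (measurableT_comp mF); apply: measurable_tuple_cons_comp => //.
  exact: measurable_axpy.
have g0 u : 0 <= g u by exact: integral_ge0.
transitivity (\int[N]_x \int[N]_y g (w0 + (b * y + a * x))%R); last first.
  rewrite (std_normal_convolution (f := fun u => g (w0 + u)%R) b0 c0)//.
  - by apply: eq_integral => z _; rewrite /g; apply: eq_integral => t _; rewrite axpy_cons.
  - by rewrite addrC.
  - by apply: (measurableT_comp mg); exact: measurable_funD.
apply: eq_integral => x _.
pose G (p : m.-tuple R * R) := \int[iid_law N m]_y'
  F (tuple_cons (w0 + (b * p.2 + a * x), axpy b (axpy a w' p.1) y'))%R.
transitivity (\int[iid_law N m]_x' \int[N]_y G (x', y)).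
  apply: eq_integral => x' _; rewrite ge0_integral_iidS//; last first.
    exact: mFx.
  apply: eq_integral => y _; apply: eq_integral => y' _.
  by rewrite !axpy_cons; congr (F (tuple_cons (_, _))); rewrite -addrA (addrC (a * x)%R).
rewrite fubini_tonelli; last 2 first.
- apply: (@measurable_fun_fubini_tonelli_F _ _ _ _ _ _
    (fun p : (m.-tuple R * R) * m.-tuple R =>
    F (tuple_cons (w0 + (b * p.1.2 + a * x), axpy b (axpy a w' p.1.1) p.2))%R))
    => [|z]; last exact: F0.
  apply: (measurableT_comp mF); apply: measurable_tuple_cons_comp => //.
    apply: measurable_funD => //; apply: measurable_funD => //.
    by apply: measurable_funM => //; exact: (measurableT_comp measurable_snd).
  apply: measurable_axpy => //; apply: measurable_axpy => //.
  exact: (measurableT_comp measurable_fst).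
- by move=> p; exact: integral_ge0.
apply: eq_integral => y _.
exact: (IH (fun t => F (tuple_cons (w0 + (b * y + a * x), t))%R) w' (mFc _)).
Qed.

Lemma iter_gauss_step m n (c : R) (F : m.-tuple R -> \bar R) w : (0 < c)%R ->
  measurable_fun setT F -> (forall v, 0 <= F v) ->
  iter n.+1 (step (iid_law N m) id c) F w =
  step (iid_law N m) id (Num.sqrt n.+1%:R * c) F w.
Proof.
move=> c0 mF F0; elim: n w => [|n IH] w; first by rewrite /= sqrtr1 mul1r.
rewrite iterS (_ : iter n.+1 _ F = step (iid_law N m) id (Num.sqrt n.+1%:R * c) F);
  last exact/funext.
apply: gauss_step_comp => //.
- by rewrite mulr_gt0// sqrtr_gt0 ltr0n.
- by rewrite mulr_gt0// sqrtr_gt0 ltr0n.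
- rewrite !exprMn !sqr_sqrtr ?ler0n// -[n.+2]addn1 natrD.
  by rewrite mulrDl mul1r addrC.
Qed.

End gauss_steps.

(** * A smooth threshold with cubic Taylor remainder *)

Section smooth_threshold.
Context (R : realType).

Definition pos3 (u : R) : R := Num.max u 0 ^+ 3.
Definition pos1 (u : R) : R := Num.max u 0.

(** The cube of the positive part is twice differentiable, with a second
    derivative that has Lipschitz constant 6, which suffices for a remainder of
    third order. *)
Lemma pos3_taylor u s :
  `|pos3 (u + s) - pos3 u - 3 * pos1 u ^+ 2 * s - 3 * pos1 u * s ^+ 2| <= `|s| ^+ 3.
Proof.
rewrite /pos3 /pos1 -normrX.
case: (leP u 0) => u0; case: (leP (u + s) 0) => us0.
- by rewrite !(expr0n, mulr0, mul0r, subr0) normr0.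
- rewrite !(expr0n, mulr0, mul0r, subr0) /= ger0_norm; last by rewrite exprn_ge0// ltW.
  rewrite ger0_norm; last by rewrite exprn_ge0//; lra.
  by apply: lerXn2r; rewrite ?nnegrE; lra.
- rewrite expr0n/= [X in `|X|](_ : _ = s ^+ 3 - (u + s) ^+ 3); last by ring.
  have h1 : 0 <= - (u + s) by lra.
  have h2 : - (u + s) <= - s by lra.
  have h3 : (- (u + s)) ^+ 3 <= (- s) ^+ 3 by apply: lerXn2r; rewrite ?nnegrE; lra.
  have h4 : 0 <= (- (u + s)) ^+ 3 by rewrite exprn_ge0.
  rewrite (_ : s ^+ 3 - _ = (- (u + s)) ^+ 3 - (- s) ^+ 3); last by ring.
  rewrite -(normrN (s ^+ 3)) (_ : - s ^+ 3 = (- s) ^+ 3); last by ring.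
  move: h3 h4; move: ((- s) ^+ 3) ((- (u + s)) ^+ 3) => y x yx x0.
  rewrite (ger0_norm (le_trans x0 yx)).
  by rewrite ler_norml; apply/andP; split; lra.
- by rewrite [X in `|X|](_ : _ = s ^+ 3); last ring.
Qed.

Variables (x0 dl : R).
Hypothesis dl0 : 0 < dl.

(** The third difference of a cubic is constant, so this cubic spline climbs
    from 0 at x0 to 1 at x0 + 3 dl and stays there. *)
Definition ramp (a : R) : R := (pos3 (a - x0) - 3 * pos3 (a - x0 - dl) +
  3 * pos3 (a - x0 - 2 * dl) - pos3 (a - x0 - 3 * dl)) / (6 * dl ^+ 3).

(** The derivative of the ramp. *)
Definition ramp1 (a : R) : R := (3 * pos1 (a - x0) ^+ 2 - 3 * (3 * pos1 (a - x0 - dl) ^+ 2) +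
  3 * (3 * pos1 (a - x0 - 2 * dl) ^+ 2) - 3 * pos1 (a - x0 - 3 * dl) ^+ 2) / (6 * dl ^+ 3).

(** Half of the second derivative of the ramp. *)
Definition ramp2 (a : R) : R := (3 * pos1 (a - x0) - 3 * (3 * pos1 (a - x0 - dl)) +
  3 * (3 * pos1 (a - x0 - 2 * dl)) - 3 * pos1 (a - x0 - 3 * dl)) / (6 * dl ^+ 3).

Let dl3 : 0 < 6 * dl ^+ 3. Proof. by rewrite mulr_gt0 ?exprn_gt0. Qed.

Lemma ramp_taylor a s :
  `|ramp (a + s) - ramp a - ramp1 a * s - ramp2 a * s ^+ 2| <=
  8 / (6 * dl ^+ 3) * `|s| ^+ 3.
Proof.
rewrite /ramp /ramp1 /ramp2.
have E t : a + s - t = a - t + s by ring.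
have E2 t t' : a - t + s - t' = a - t - t' + s by ring.
rewrite !E !E2.
have H0 := pos3_taylor (a - x0) s.
have H1 := pos3_taylor (a - x0 - dl) s.
have H2 := pos3_taylor (a - x0 - 2 * dl) s.
have H3 := pos3_taylor (a - x0 - 3 * dl) s.
move: H0 H1 H2 H3.
move: (pos3 (a - x0)) (pos3 (a - x0 + s)) (pos1 (a - x0)) => p0 q0 r0.
move: (pos3 (a - x0 - dl)) (pos3 (a - x0 - dl + s)) (pos1 (a - x0 - dl)) => p1 q1 r1.
move: (pos3 (a - x0 - 2 * dl)) (pos3 (a - x0 - 2 * dl + s)) (pos1 (a - x0 - 2 * dl)) => p2 q2 r2.
move: (pos3 (a - x0 - 3 * dl)) (pos3 (a - x0 - 3 * dl + s)) (pos1 (a - x0 - 3 * dl)) => p3 q3 r3.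
move: (`|s| ^+ 3) => S.
set e0 := q0 - _ - _ - _; set e1 := q1 - _ - _ - _.
set e2 := q2 - _ - _ - _; set e3 := q3 - _ - _ - _.
move=> H0 H1 H2 H3.
rewrite [X in `|X|](_ : _ = (e0 - 3 * e1 + 3 * e2 - e3) / (6 * dl ^+ 3)); last first.
  by rewrite /e0 /e1 /e2 /e3; field; rewrite gt_eqF.
rewrite normrM (gtr0_norm (x := _^-1)) ?invr_gt0// mulrAC ler_pM2r ?invr_gt0//.
move: H0 H1 H2 H3; rewrite !ler_norml => /andP[? ?] /andP[? ?] /andP[? ?] /andP[? ?].
by apply/andP; split; lra.
Qed.

Lemma ramp_le0 a : a <= x0 -> ramp a = 0.
Proof.
move=> ax; have P t : t <= 0 -> pos3 t = 0.
  by move=> t0; rewrite /pos3 max_r// expr0n.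
rewrite /ramp !P; first by rewrite !mulr0 !subr0 addr0 mul0r.
all: by move: dl0 => ?; lra.
Qed.

Lemma ramp_ge1 a : x0 + 3 * dl <= a ->
  [/\ ramp a = 1, ramp1 a = 0 & ramp2 a = 0].
Proof.
move=> ax; have P t : 0 <= t -> (pos3 t = t ^+ 3) * (pos1 t = t).
  by move=> t0; rewrite /pos3 /pos1 max_l.
rewrite /ramp /ramp1 /ramp2 !P; first by split; field; rewrite gt_eqF.
all: by move: dl0 => ?; lra.
Qed.

Lemma ramp_scale a : ramp a = let u := (a - x0) / dl in
  (pos3 u - 3 * pos3 (u - 1) + 3 * pos3 (u - 2) - pos3 (u - 3)) / 6.
Proof.
have E b : pos3 b = dl ^+ 3 * pos3 (b / dl).
  by rewrite /pos3 -exprMn; congr (_ ^+ _); rewrite maxr_pMr ?ltW// mulr0 mulrCA divff ?mulr1// gt_eqF.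
rewrite /ramp (E (a - x0)) (E (_ - dl)) (E (_ - 2 * dl)) (E (_ - 3 * dl)) /=.
have -> : (a - x0 - dl) / dl = (a - x0) / dl - 1 by field; rewrite gt_eqF.
have -> : (a - x0 - 2 * dl) / dl = (a - x0) / dl - 2 by field; rewrite gt_eqF.
have -> : (a - x0 - 3 * dl) / dl = (a - x0) / dl - 3 by field; rewrite gt_eqF.
by field; rewrite gt_eqF.
Qed.

Lemma ramp_bounds a : 0 <= ramp a <= 1.
Proof.
have [ax|ax] := leP a x0; first by rewrite ramp_le0// lexx ler01.
rewrite ramp_scale /=; set u := (a - x0) / dl.
have u0 : 0 < u by rewrite divr_gt0// subr_gt0.
rewrite /pos3 (max_l (ltW u0)).
case: (leP (u - 1) 0) => u1; case: (leP (u - 2) 0) => u2;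
  case: (leP (u - 3) 0) => u3; rewrite ?expr0n /=; try lra.
- rewrite !mulr0 !subr0 addr0.
  have h : 0 <= u ^+ 3 <= 1.
    by rewrite exprn_ge0 ?(ltW u0)// exprn_ile1//; lra.
  lra.
- rewrite !mulr0 !subr0 addr0.
  have -> : u ^+ 3 - 3 * (u - 1) ^+ 3 =
      1 + 3 * (u - 1) + 3 * (u - 1) ^+ 2 - 2 * (u - 1) ^+ 3 by ring.
  have v1 : u - 1 <= 1 by lra.
  move: (u - 1) u1 v1 => v v0 v1.
  have h1 : 0 <= v ^+ 2 by rewrite sqr_ge0.
  have h2 : v ^+ 3 <= v ^+ 2 by rewrite exprS ler_piMl.
  have h3 : 0 <= (1 - v) ^+ 2 * (1 + 2 * v) by rewrite mulr_ge0 ?sqr_ge0//; lra.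
  have h4 : (1 - v) ^+ 2 * (1 + 2 * v) = 1 - 3 * v ^+ 2 + 2 * v ^+ 3 by ring.
  by apply/andP; split; lra.
- rewrite subr0.
  have -> : (u ^+ 3 - 3 * (u - 1) ^+ 3 + 3 * (u - 2) ^+ 3) / 6 = 1 - (3 - u) ^+ 3 / 6.
    by field.
  have h : 0 <= (3 - u) ^+ 3 <= 1 by rewrite exprn_ge0 ?exprn_ile1//; lra.
  lra.
Qed.

Lemma ramp12_bound a : `|ramp1 a| <= 36 / dl /\ `|ramp2 a| <= 12 / dl ^+ 2.
Proof.
have [ax|ax] := leP (x0 + 3 * dl) a.
  have [_ -> ->] := ramp_ge1 ax.
  by rewrite normr0 !divr_ge0 ?exprn_ge0// ltW.
have B t : t <= 3 * dl -> 0 <= pos1 t <= 3 * dl.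
  by move=> t3; rewrite /pos1 le_max lexx orbT ge_max t3 mulr_ge0// ltW.
have Sq t : 0 <= t <= 3 * dl -> 0 <= t ^+ 2 <= 9 * dl ^+ 2.
  move=> /andP[t0 t3]; rewrite sqr_ge0/=.
  by rewrite (_ : 9 * dl ^+ 2 = (3 * dl) ^+ 2); [apply: lerXn2r; rewrite ?nnegrE//; exact: le_trans t3|ring].
have b0 : 0 <= pos1 (a - x0) <= 3 * dl by apply: B; lra.
have b1 : 0 <= pos1 (a - x0 - dl) <= 3 * dl by apply: B; move: dl0 => ?; lra.
have b2 : 0 <= pos1 (a - x0 - 2 * dl) <= 3 * dl by apply: B; move: dl0 => ?; lra.
have b3 : 0 <= pos1 (a - x0 - 3 * dl) <= 3 * dl by apply: B; move: dl0 => ?; lra.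
split.
  rewrite (_ : 36 / dl = (216 * dl ^+ 2) / (6 * dl ^+ 3)); last by field; rewrite gt_eqF.
  rewrite /ramp1 normrM (gtr0_norm (x := _^-1)) ?invr_gt0// ler_pM2r ?invr_gt0//.
  move: (Sq _ b0) (Sq _ b1) (Sq _ b2) (Sq _ b3) => /andP[? ?] /andP[? ?] /andP[? ?] /andP[? ?].
  by rewrite ler_norml; apply/andP; split; lra.
rewrite (_ : 12 / dl ^+ 2 = (72 * dl) / (6 * dl ^+ 3)); last by field; rewrite gt_eqF.
rewrite /ramp2 normrM (gtr0_norm (x := _^-1)) ?invr_gt0// ler_pM2r ?invr_gt0//.
move: b0 b1 b2 b3 => /andP[? ?] /andP[? ?] /andP[? ?] /andP[? ?].
by rewrite ler_norml; apply/andP; split; lra.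
Qed.

End smooth_threshold.

(** Second-order expansion of the ramp of the squared norm |w + v|^2, in scalar
    terms: a is |w|^2, b the scalar product of w and v, e is |v|^2, and n bounds
    |v|. The remainder is cubic in n uniformly in w: far out the ramp is
    constant, at bounded distance the scalar product is at most a multiple of n,
    and for n > 1 crude bounds suffice. *)
Lemma ramp_radial_taylor (R : realType) (x0 dl : R) : 0 < dl ->
  exists2 K : R, 0 <= K & forall a b e n : R, 0 <= a -> 0 <= e -> 0 <= n ->
    e <= n ^+ 2 -> b ^+ 2 <= a * e -> 0 <= a + 2 * b + e ->
    a <= 2 * (a + 2 * b + e) + 2 * e ->
    `|ramp x0 dl (a + 2 * b + e) - (ramp x0 dl a + ramp1 x0 dl a * (2 * b)
       + ramp1 x0 dl a * e + 4 * ramp2 x0 dl a * b ^+ 2)| <= K * n ^+ 3.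
Proof.
move=> dl0.
pose M : R := `|x0 + 3 * dl|.
pose A : R := 2 * M + 2.
pose C1 : R := 36 / dl; pose C2 : R := 12 / dl ^+ 2; pose C3 : R := 8 / (6 * dl ^+ 3).
have M0 : 0 <= M by rewrite /M.
have A1 : 1 <= A by rewrite /A; lra.
have C10 : 0 <= C1 by rewrite divr_ge0// ltW.
have C20 : 0 <= C2 by rewrite divr_ge0 ?exprn_ge0// ltW.
have C30 : 0 <= C3 by rewrite divr_ge0 ?mulr_ge0 ?exprn_ge0// ltW.
pose K1 : R := C3 * (2 * A + 1) ^+ 3 + C2 * (4 * A + 1).
pose K2 : R := 1 + C1 * (2 * A) + C1 + 4 * C2 * A ^+ 2.
have K10 : 0 <= K1.
  rewrite addr_ge0// mulr_ge0// ?exprn_ge0//; lra.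
have K20 : 1 <= K2.
  have h1 : 0 <= C1 * (2 * A) by rewrite mulr_ge0//; lra.
  have h2 : 0 <= 4 * C2 * A ^+ 2 by rewrite mulr_ge0 ?sqr_ge0// mulr_ge0.
  by rewrite /K2; lra.
exists (K1 + K2); first lra.
move=> a b e n a0 e0 n0 en bae ab0 aM.
have n30 : 0 <= n ^+ 3 by rewrite exprn_ge0.
have Kn : K1 * n ^+ 3 + K2 * n ^+ 3 = (K1 + K2) * n ^+ 3 by ring.
have K1n : 0 <= K1 * n ^+ 3 by rewrite mulr_ge0.
have K2n : 0 <= K2 * n ^+ 3 by rewrite mulr_ge0//; lra.
have /andP[r0 r1] := ramp_bounds x0 dl0 (a + 2 * b + e).
have /andP[s0 s1] := ramp_bounds x0 dl0 a.
have n3 : 1 <= n -> 1 <= n ^+ 3 by move=> ?; rewrite exprn_ege1.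
have [aA|aA] := ltP A a.
  have : x0 + 3 * dl <= a.
    by apply: (le_trans (ler_norm _)); rewrite -/M; move: aA; rewrite /A; lra.
  case/(ramp_ge1 dl0) => -> -> ->; rewrite !mul0r mulr0 mul0r !addr0.
  have [n1|n1] := leP n 1.
    have e1 : e <= 1 by apply: (le_trans en); rewrite exprn_ile1.
    have : x0 + 3 * dl <= a + 2 * b + e.
      by apply: (le_trans (ler_norm _)); rewrite -/M; move: aA; rewrite /A; lra.
    by case/(ramp_ge1 dl0) => -> _ _; rewrite subrr normr0 -Kn addr_ge0.
  have := n3 (ltW n1); rewrite ler_norml => ?.
  have : n ^+ 3 <= K2 * n ^+ 3 by rewrite ler_peMl.
  by move=> ?; apply/andP; split; lra.
have bA : `|b| <= A * n.
  have An0 : 0 <= A * n by rewrite mulr_ge0//; lra.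
  rewrite -(@ler_pXn2r _ 2)// ?nnegrE// real_normK ?num_real//.
  apply: (le_trans bae); apply: (@le_trans _ _ (A * n ^+ 2)).
    by apply: ler_pM.
  rewrite exprMn ler_wpM2r ?sqr_ge0// expr2 ler_peMr//; lra.
have [t1 t2] := ramp12_bound x0 dl0 a.
have [n1|n1] := leP n 1.
  have n2 : n ^+ 2 <= n by rewrite expr2 ler_piMr.
  have sB : `|2 * b + e| <= (2 * A + 1) * n.
    apply: (le_trans (ler_normD _ _)); rewrite normrM (ger0_norm e0) ger0_norm//.
    rewrite (_ : (2 * A + 1) * n = 2 * (A * n) + n); last ring.
    by rewrite lerD ?ler_pM2l//; exact: le_trans n2.
  have T := ramp_taylor x0 dl0 a (2 * b + e).
  rewrite addrA in T.
  set r' := ramp1 x0 dl a in t1 T *; set r'' := ramp2 x0 dl a in t2 T *.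
  rewrite [X in `|X|](_ : _ = (ramp x0 dl (a + 2 * b + e) - ramp x0 dl a
    - r' * (2 * b + e) - r'' * (2 * b + e) ^+ 2) + r'' * (4 * b * e + e ^+ 2)); last ring.
  apply: (le_trans (ler_normD _ _)).
  have P1 : C3 * `|2 * b + e| ^+ 3 <= C3 * (2 * A + 1) ^+ 3 * n ^+ 3.
    rewrite -mulrA -exprMn ler_wpM2l// lerXn2r// nnegrE mulr_ge0//; lra.
  have P2 : `|r'' * (4 * b * e + e ^+ 2)| <= C2 * (4 * A + 1) * n ^+ 3.
    rewrite normrM (_ : C2 * _ * _ = C2 * ((4 * A + 1) * n ^+ 3)); last ring.
    rewrite ler_pM//.
    apply: (le_trans (ler_normD _ _)); rewrite !normrM (ger0_norm e0) ger0_norm//.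
    rewrite (_ : (4 * A + 1) * n ^+ 3 = 4 * ((A * n) * n ^+ 2) + n ^+ 3); last ring.
    rewrite lerD//; first by rewrite -(mulrA 4) ler_pM2l// ler_pM.
    apply: (@le_trans _ _ (n ^+ 2 * n ^+ 2)); first by rewrite ler_pM.
    rewrite -exprD (_ : (2 + 2 = 3 + 1)%N)// exprD expr1 ler_piMr//.
  apply: (le_trans (lerD (le_trans T P1) P2)).
  rewrite -Kn (_ : K1 * n ^+ 3 = C3 * (2 * A + 1) ^+ 3 * n ^+ 3
    + C2 * (4 * A + 1) * n ^+ 3); last by rewrite /K1; ring.
  by rewrite lerDl.
have n3' := n3 (ltW n1).
have n13 : n <= n ^+ 3 by rewrite ler_eXnr// ltW.
have n23 : n ^+ 2 <= n ^+ 3 by rewrite ler_eXn2l// ltW.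
set r' := ramp1 x0 dl a in t1 *; set r'' := ramp2 x0 dl a in t2 *.
have Q1 : `|r' * (2 * b)| <= C1 * (2 * A) * n ^+ 3.
  rewrite normrM (_ : C1 * (2 * A) * n ^+ 3 = C1 * (2 * (A * n ^+ 3))); last ring.
  rewrite ler_pM// normrM ger0_norm// ler_pM2l//.
  by apply: (le_trans bA); rewrite ler_wpM2l//; lra.
have Q2 : `|r' * e| <= C1 * n ^+ 3.
  by rewrite normrM ler_pM// ger0_norm//; exact: (le_trans en).
have Q3 : `|4 * r'' * b ^+ 2| <= 4 * C2 * A ^+ 2 * n ^+ 3.
  rewrite (_ : 4 * r'' * b ^+ 2 = r'' * (4 * b ^+ 2)); last ring.
  rewrite normrM (_ : 4 * C2 * A ^+ 2 * n ^+ 3 = C2 * (4 * (A ^+ 2 * n ^+ 3))); last ring.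
  have -> : `|4 * b ^+ 2| = 4 * `|b| ^+ 2.
    by rewrite real_normK ?num_real// ger0_norm// mulr_ge0// sqr_ge0.
  rewrite ler_pM// ?mulr_ge0 ?sqr_ge0// ler_pM2l//.
  apply: (@le_trans _ _ ((A * n) ^+ 2)); first by rewrite lerXn2r ?nnegrE// (le_trans _ bA).
  by rewrite exprMn ler_wpM2l// sqr_ge0.
have E : K2 * n ^+ 3 = n ^+ 3 + C1 * (2 * A) * n ^+ 3 + C1 * n ^+ 3 + 4 * C2 * A ^+ 2 * n ^+ 3.
  by rewrite /K2; ring.
rewrite -Kn E.
move: Q1 Q2 Q3 K1n; rewrite !ler_norml => /andP[? ?] /andP[? ?] /andP[? ?] ?.
by apply/andP; split; lra.
Qed.

(** * Real means *)

Section mean.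
Context d (T : measurableType d) (R : realType) (mu : probability T R).

Definition has_mean (f : T -> R) (r : R) : Prop :=
  mu.-integrable setT (EFin \o f) /\ (\int[mu]_t (f t)%:E = r%:E)%E.

Lemma has_mean_cst r : has_mean (cst r) r.
Proof.
split; last exact: (integral_cst_prob mu r%:E).
exact: finite_measure_integrable_cst.
Qed.

Lemma has_meanD f g r s : has_mean f r -> has_mean g s ->
  has_mean (fun t => f t + g t) (r + s).
Proof.
move=> [fi fr] [gi gs]; split.
  by rewrite (_ : _ \o _ = (EFin \o f) \+ (EFin \o g))%E//; exact: integrableD.
under eq_integral do rewrite EFinD.
by rewrite integralD// fr gs.
Qed.

Lemma has_meanZ k f r : has_mean f r -> has_mean (fun t => k * f t) (k * r).
Proof.
move=> [fi fr]; split.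
  rewrite (_ : _ \o _ = fun t => k%:E * (EFin \o f) t)%E//; exact: integrableZl.
under eq_integral do rewrite EFinM.
by rewrite integralZl// fr.
Qed.

Lemma has_mean_ext f g r s : (forall t, f t = g t) -> r = s ->
  has_mean f r -> has_mean g s.
Proof. by move=> /funext -> ->. Qed.

Lemma has_mean_sum (I : finType) (f : I -> T -> R) (r : I -> R) :
  (forall i, has_mean (f i) (r i)) ->
  has_mean (fun t => \sum_i f i t) (\sum_i r i).
Proof.
move=> fr; elim: (index_enum I) => [|i s IH].
  by apply: has_mean_ext (has_mean_cst 0) => [t|]; rewrite big_nil.
by apply: has_mean_ext (has_meanD (fr i) IH) => [t|]; rewrite big_cons.
Qed.

Lemma has_mean_ge0 (f : T -> R) r : measurable_fun setT f -> (forall t, 0 <= f t) ->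
  (\int[mu]_t (f t)%:E = r%:E)%E -> has_mean f r.
Proof.
move=> mf f0 fr; split=> //; apply/integrableP; split; first exact/measurable_EFinP.
under eq_integral do rewrite /= ger0_norm//.
by rewrite fr ltry.
Qed.

Lemma has_mean_le f g r s : has_mean f r -> has_mean g s ->
  (forall t, f t <= g t) -> r <= s.
Proof.
move=> [fi fr] [gi gs] fg; rewrite -lee_fin -fr -gs.
by apply: le_integral => // t _; rewrite lee_fin.
Qed.

Lemma has_mean_abs_le f g h r s e : has_mean f r -> has_mean g s -> has_mean h e ->
  (forall t, `|f t - g t| <= h t) -> `|r - s| <= e.
Proof.
move=> fr gs he fgh.
have gNs := has_meanZ (-1) gs.
rewrite ler_norml; apply/andP; split.
  rewrite -(mulN1r e) -(mulN1r s).
  apply: (has_mean_le (has_meanZ (-1) he) (has_meanD fr gNs)) => t.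
  by have := fgh t; rewrite ler_norml => /andP[? _]; rewrite !mulN1r.
rewrite -(mulN1r s); apply: (has_mean_le (has_meanD fr gNs) he) => t.
by have := fgh t; rewrite ler_norml => /andP[_ ?]; rewrite mulN1r.
Qed.

Lemma has_mean_bounded (f : T -> R) (B : R) : measurable_fun setT f ->
  (forall t, `|f t| <= B) -> exists2 r, has_mean f r & `|r| <= B.
Proof.
move=> mf fB.
have fi : mu.-integrable setT (EFin \o f).
  apply: (@le_integrable _ _ _ mu setT measurableT _ (cst B%:E)).
  - exact/measurable_EFinP.
  - move=> t _; rewrite /= lee_fin; apply: (le_trans (fB t)).
    exact: ler_norm.
  - exact: finite_measure_integrable_cst.
have finf := integrable_fin_num measurableT fi.
exists (fine (\int[mu]_t (f t)%:E)%E); first by split=> //; rewrite fineK.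
set r := fine _; have fr : has_mean f r by split=> //; rewrite fineK.
have f0 : has_mean (cst 0) 0 by exact: has_mean_cst.
have := has_mean_abs_le fr f0 (has_mean_cst B).
by rewrite subr0; apply => t /=; rewrite subr0.
Qed.

End mean.

(** * Lindeberg's exchange argument *)

Section isotropic.
Context (R : realType) (m : nat).
Notation vec := (m.-tuple R).
Context d (T : measurableType d) (mu : probability T R) (V : T -> vec).
Hypothesis mV : measurable_fun setT V.

(** Centred with identity covariance. By polarization, this single family of
    identities between nonnegative integrals contains all first and second
    moments, with no integrability side condition. *)
Definition isotropic : Prop := forall (c : R) (a : 'I_m -> R),
  (\int[mu]_t ((c + \sum_l a l * tnth (V t) l) ^+ 2)%:E =
   (c ^+ 2 + \sum_l a l ^+ 2)%:E)%E.

Hypothesis isoV : isotropic.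

Lemma measurable_linear (a : 'I_m -> R) :
  measurable_fun setT (fun t => \sum_l a l * tnth (V t) l).
Proof.
apply: measurable_sum => l; apply: measurable_funM => //.
exact: (measurableT_comp (@measurable_tnth _ _ _ l)).
Qed.

Lemma isotropic_sqr c a :
  has_mean mu (fun t => (c + \sum_l a l * tnth (V t) l) ^+ 2) (c ^+ 2 + \sum_l a l ^+ 2).
Proof.
apply: has_mean_ge0 (isoV c a) => [|t]; last exact: sqr_ge0.
by apply: measurable_funX; apply: measurable_funD => //; exact: measurable_linear.
Qed.

(** The cross term of the square with c = 1, by polarization. *)
Lemma isotropic_linear a : has_mean mu (fun t => \sum_l a l * tnth (V t) l) 0.
Proof.
apply: has_mean_ext (has_meanD (has_meanZ 2^-1 (isotropic_sqr 1 a))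
  (has_meanD (has_mean_cst mu (- 2^-1)) (has_meanZ (- 2^-1) (isotropic_sqr 0 a)))) => [t|].
  by rewrite add0r /cst; field.
by rewrite expr0n/=; field.
Qed.

Lemma isotropic_quadratic (al be ga ka : R) (a : 'I_m -> R) :
  has_mean mu (fun t => al + be * (\sum_l a l * tnth (V t) l) +
      ga * sqnorm (V t) + ka * (\sum_l a l * tnth (V t) l) ^+ 2)
    (al + ga * m%:R + ka * \sum_l a l ^+ 2).
Proof.
have hs : has_mean mu (fun t => sqnorm (V t)) m%:R.
  apply: has_mean_ext (has_mean_sum (fun k : 'I_m =>
    isotropic_sqr 0 (fun l => (l == k)%:R))) => [t|].
    apply: eq_bigr => k _; rewrite add0r (bigD1 k)//= eqxx mul1r big1 ?addr0//.
    by move=> l /negbTE ->; rewrite mul0r.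
  rewrite (eq_bigr (fun=> 1)) ?sumr_const ?card_ord// => k _.
  rewrite expr0n add0r (bigD1 k)//= eqxx expr1n big1 ?addr0//.
  by move=> l /negbTE ->; rewrite expr0n.
apply: has_mean_ext (has_meanD (has_meanD (has_meanD (has_mean_cst mu al)
  (has_meanZ be (isotropic_linear a))) (has_meanZ ga hs))
  (has_meanZ ka (isotropic_sqr 0 a))) => [t|].
  by rewrite add0r.
by rewrite mulr0 addr0 expr0n/= add0r.
Qed.

End isotropic.

Section radial.
Context (R : realType) (m : nat).
Notation vec := (m.-tuple R).

Definition dotp (w v : vec) : R := \sum_l tnth w l * tnth v l.

Lemma sqnorm_axpy c (w v : vec) :
  sqnorm (axpy c w v) = sqnorm w + 2 * (c * dotp w v) + c ^+ 2 * sqnorm v.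
Proof.
rewrite /sqnorm /dotp !mulr_sumr -!big_split/=; apply: eq_bigr => l _.
by rewrite tnth_mktuple; ring.
Qed.

Lemma dotp_sqr_le (w v : vec) : dotp w v ^+ 2 <= sqnorm w * sqnorm v.
Proof.
have [v0|v0] := eqVneq (sqnorm v) 0.
  have E l : tnth v l = 0.
    have := psumr_eq0P (fun (l : 'I_m) _ => sqr_ge0 (tnth v l)) v0.
    by move=> /(_ l isT)/eqP; rewrite sqrf_eq0 => /eqP.
  by rewrite /dotp big1 ?v0 ?mulr0 ?expr0n// => l _; rewrite E mulr0.
have vp : 0 < sqnorm v by rewrite lt0r v0 sqnorm_ge0.
have := sqnorm_ge0 (axpy (- (dotp w v / sqnorm v)) w v).
rewrite sqnorm_axpy.
rewrite [X in 0 <= X](_ : _ = (sqnorm w * sqnorm v - dotp w v ^+ 2) / sqnorm v); last by field.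
by rewrite pmulr_lge0 ?invr_gt0// subr_ge0.
Qed.

Lemma sqnorm_le_norm1 (v : vec) : sqnorm v <= norm1 v ^+ 2.
Proof.
rewrite expr2 {1}/norm1 mulr_suml; apply: ler_sum => l _.
rewrite -real_normK ?num_real// expr2 ler_wpM2l//.
by rewrite /norm1 (bigD1 l)//= lerDl sumr_ge0.
Qed.

Lemma sqnorm_le2 c (w v : vec) :
  sqnorm w <= 2 * sqnorm (axpy c w v) + 2 * (c ^+ 2 * sqnorm v).
Proof.
have := sqnorm_ge0 (axpy (2 * c) w v); rewrite !sqnorm_axpy exprMn.
have := sqnorm_ge0 w; have := sqnorm_ge0 v; have := sqr_ge0 c; lra.
Qed.

End radial.

Section lindeberg.
Local Open Scope ereal_scope.
Context (R : realType) (m : nat).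
Notation vec := (m.-tuple R).
Variables (x0 dl : R).
Hypothesis dl0 : (0 < dl)%R.

Definition radial_ramp (w : vec) : R := ramp x0 dl (sqnorm w).

Lemma radial_ramp_bounds w : (0 <= radial_ramp w <= 1)%R. Proof. exact: ramp_bounds. Qed.

Lemma measurable_ramp : measurable_fun setT (ramp x0 dl).
Proof.
have mp t : measurable_fun setT (fun a : R => pos3 (a - x0 - t)).
  apply: measurable_funX; apply: measurable_maxr => //.
  by apply: measurable_funB => //; exact: measurable_funB.
have mp0 : measurable_fun setT (fun a : R => pos3 (a - x0)).
  by apply: measurable_funX; apply: measurable_maxr => //; exact: measurable_funB.
rewrite /ramp; apply: measurable_funM => //; apply: measurable_funB => //.
apply: measurable_funD; last exact: measurable_funM.
by apply: measurable_funB => //; exact: measurable_funM.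
Qed.

Lemma measurable_radial_ramp : measurable_fun setT radial_ramp.
Proof. exact: (measurableT_comp measurable_ramp (@measurable_sqnorm R m)). Qed.

(** Two isotropic steps have the same mean effect on the second-order Taylor
    polynomial, so they differ by third moments only. *)
Lemma lindeberg_one_step : exists2 K : R, (0 <= K)%R &
  forall d1 (T1 : measurableType d1) (mu1 : probability T1 R) (V1 : T1 -> vec)
         d2 (T2 : measurableType d2) (mu2 : probability T2 R) (V2 : T2 -> vec)
         (M1 M2 : R),
    measurable_fun setT V1 -> isotropic mu1 V1 ->
    has_mean mu1 (fun t => norm1 (V1 t) ^+ 3)%R M1 ->
    measurable_fun setT V2 -> isotropic mu2 V2 ->
    has_mean mu2 (fun t => norm1 (V2 t) ^+ 3)%R M2 ->
  forall (c : R) (w : vec), (0 <= c)%R ->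
    step mu1 V1 c (EFin \o radial_ramp) w <=
    step mu2 V2 c (EFin \o radial_ramp) w + (c ^+ 3 * (K * (M1 + M2)))%:E.
Proof.
have [K K0 HK] := ramp_radial_taylor x0 dl0.
exists K => // d1 T1 mu1 V1 d2 T2 mu2 V2 M1 M2 mV1 iso1 M1E mV2 iso2 M2E c w c0.
pose a := sqnorm w; pose r' := ramp1 x0 dl a; pose r'' := ramp2 x0 dl a.
pose q d (T : measurableType d) (V : T -> vec) t : R := (ramp x0 dl a +
  (r' * 2 * c) * (\sum_l tnth w l * tnth (V t) l) + (r' * c ^+ 2) * sqnorm (V t) +
  (4 * r'' * c ^+ 2) * (\sum_l tnth w l * tnth (V t) l) ^+ 2)%R.
pose Q : R := (ramp x0 dl a + (r' * c ^+ 2) * m%:R + (4 * r'' * c ^+ 2) * \sum_l tnth w l ^+ 2)%R.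
have main d (T : measurableType d) (mu : probability T R) (V : T -> vec) M :
    measurable_fun setT V -> isotropic mu V ->
    has_mean mu (fun t => norm1 (V t) ^+ 3)%R M ->
    exists2 r : R, step mu V c (EFin \o radial_ramp) w = r%:E &
      (`|r - Q| <= K * c ^+ 3 * M)%R.
  move=> mV iso ME.
  have mb : measurable_fun setT (fun t => radial_ramp (axpy c w (V t))).
    by apply: (measurableT_comp measurable_radial_ramp); exact: measurable_axpy.
  have [|r fr _] := @has_mean_bounded _ _ _ mu _ 1%R mb.
    move=> t; have /andP[b0 b1] := radial_ramp_bounds (axpy c w (V t)).
    by rewrite ger0_norm.
  exists r; first by case: fr.
  have qQ := isotropic_quadratic mV iso (ramp x0 dl a) (r' * 2 * c) (r' * c ^+ 2)
    (4 * r'' * c ^+ 2) (tnth w).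
  apply: (has_mean_abs_le fr qQ (has_meanZ (K * c ^+ 3)%R ME)) => t.
  have c20 : (0 <= c ^+ 2)%R by rewrite sqr_ge0.
  have H1 : (c ^+ 2 * sqnorm (V t) <= (c * norm1 (V t)) ^+ 2)%R.
    by rewrite exprMn ler_wpM2l// sqnorm_le_norm1.
  have H2 : ((c * dotp w (V t)) ^+ 2 <= a * (c ^+ 2 * sqnorm (V t)))%R.
    by rewrite exprMn [leRHS]mulrCA ler_wpM2l// dotp_sqr_le.
  have := HK a (c * dotp w (V t))%R (c ^+ 2 * sqnorm (V t))%R (c * norm1 (V t))%R
    (sqnorm_ge0 w) (mulr_ge0 c20 (sqnorm_ge0 _)) (mulr_ge0 c0 (norm1_ge0 _)) H1 H2.
  rewrite -sqnorm_axpy => /(_ (sqnorm_ge0 _) (sqnorm_le2 c w (V t))).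
  rewrite [X in (`|X| <= _)%R -> _](_ : _ = radial_ramp (axpy c w (V t)) - q _ _ V t)%R;
    last by rewrite /radial_ramp /q /dotp -/a -/r' -/r''; ring.
  by rewrite [in X in (_ <= X)%R -> _]exprMn mulrA.
have [r1 -> h1] := main _ _ _ _ _ mV1 iso1 M1E.
have [r2 -> h2] := main _ _ _ _ _ mV2 iso2 M2E.
rewrite -EFinD lee_fin mulrDr mulrDr.
move: h1 h2; rewrite !ler_norml => /andP[_ h1] /andP[h2 _]; lra.
Qed.

End lindeberg.
Arguments radial_ramp {R m} x0 dl w.
Arguments radial_ramp_bounds {R m} x0 {dl} dl0 w.
Arguments measurable_radial_ramp {R m} x0 dl.
Arguments lindeberg_one_step {R} m x0 {dl} dl0.

Section gauss_vector.
Local Open Scope ereal_scope.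
Context (R : realType) (m : nat).
Notation N := (std_normal R).
Notation G := (iid_law N m).

Lemma isotropic_gauss : isotropic G id.
Proof.
by move=> c a; apply: (@iid_sum_sqr _ _ _ N id) => //; exact: std_normal_var.
Qed.

Lemma sum_expr3_le (I : Type) (s : seq I) (x : I -> R) : (forall i, (0 <= x i)%R) ->
  ((\sum_(i <- s) x i) ^+ 3 <= 4 ^+ size s * \sum_(i <- s) x i ^+ 3)%R.
Proof.
move=> x0; elim: s => [|i s IH]; first by rewrite !big_nil expr0n mulr0.
rewrite !big_cons /=.
set S := (\sum_(j <- s) x j)%R in IH *; set S3 := (\sum_(j <- s) x j ^+ 3)%R in IH *.
have S0 : (0 <= S)%R by exact: sumr_ge0.
have h : ((x i + S) ^+ 3 <= 4 * (x i ^+ 3 + S ^+ 3))%R.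
  rewrite -subr_ge0 [X in (0 <= X)%R](_ : _ = 3 * ((x i + S) * (x i - S) ^+ 2))%R; last by ring.
  by rewrite mulr_ge0// mulr_ge0 ?sqr_ge0// addr_ge0.
apply: (le_trans h); rewrite (exprS _ (size s)) -mulrA ler_pM2l// mulrDr lerD//.
by rewrite ler_peMl ?exprn_ge0// exprn_ege1// ler1n.
Qed.

(** Third moments of the coordinates control that of their sum. *)
Lemma gauss_norm1_cube : exists M : R, has_mean G (fun v => norm1 v ^+ 3)%R M.
Proof.
have [M M0 MN] := @std_normal_abs3 R.
have m3 : measurable_fun setT (fun x : R => (`|x| ^+ 3)%:E).
  by apply/measurable_EFinP; apply: measurable_funX; exact: normr_measurable.
have mn3 : measurable_fun setT (fun v : m.-tuple R => (norm1 v ^+ 3)%R).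
  by apply: measurable_funX; exact: measurable_norm1.
have fin : \int[G]_v (norm1 v ^+ 3)%:E <= (4 ^+ m * (m%:R * M))%:E.
  have msum : measurable_fun setT (fun v : m.-tuple R => (\sum_(l < m) `|tnth v l| ^+ 3)%R).
    apply: measurable_sum => l; apply: measurable_funX.
    exact: (measurableT_comp (@normr_measurable R setT) (@measurable_tnth _ _ _ l)).
  apply: (@le_trans _ _ (\int[G]_v ((4 ^+ m)%:E * (\sum_(l < m) `|tnth v l| ^+ 3)%:E))).
    apply: ge0_le_integral => //.
    - by move=> v _; rewrite lee_fin exprn_ge0 ?norm1_ge0.
    - exact/measurable_EFinP.
    - by apply: emeasurable_funM => //; exact/measurable_EFinP.
    - move=> v _; rewrite -EFinM lee_fin.
      have := @sum_expr3_le _ (index_enum 'I_m) (fun l => `|tnth v l|%R) (fun _ => normr_ge0 _).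
      by rewrite [size _](_ : _ = m)// /index_enum -enumT size_enum_ord.
  rewrite ge0_integralZl//; last 2 first.
  - exact/measurable_EFinP.
  - by move=> v _; rewrite lee_fin; apply: sumr_ge0 => l _; rewrite exprn_ge0.
  rewrite [leRHS]EFinM lee_pmul2l ?lte_fin ?exprn_gt0//.
  under eq_integral do rewrite -sumEFin.
  rewrite ge0_integral_sum//; last first.
    by move=> l; exact: (measurableT_comp m3 (@measurable_tnth _ _ _ l)).
  apply: (@le_trans _ _ (\sum_(l < m) M%:E)).
    apply: lee_sum => l _.
    by rewrite (ge0_integral_iid_marginal N l m3).
  by rewrite sumEFin sumr_const card_ord mulr_natl.
have I0 : 0 <= \int[G]_v (norm1 v ^+ 3)%:E.
  by apply: integral_ge0 => v _; rewrite lee_fin exprn_ge0// norm1_ge0.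
have finf : \int[G]_v (norm1 v ^+ 3)%:E \is a fin_num.
  by rewrite ge0_fin_numE//; exact: le_lt_trans fin (ltry _).
exists (fine (\int[G]_v (norm1 v ^+ 3)%:E)).
apply: has_mean_ge0 => //; last by rewrite fineK.
by move=> v; rewrite exprn_ge0// norm1_ge0.
Qed.

End gauss_vector.

Section chi2.
Local Open Scope ereal_scope.
Context (R : realType).
Notation N := (std_normal R).

Lemma std_normal_sqr_atom (c : R) : N [set x | (x ^+ 2)%R = c] = 0.
Proof.
have mA : measurable [set x : R | (x ^+ 2)%R = c].
  rewrite (_ : [set _ | _] = (fun x : R => x ^+ 2)%R @^-1` [set c])//.
  rewrite -[X in measurable X]setTI.
  by apply: (measurable_funX 2 (@measurable_id _ _ setT)).
have /null_content_dominatesP := @normal_prob_dominates R 0%R 1%R.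
apply=> //; apply: countable_lebesgue_measure0; apply: finite_set_countable.
apply: (@sub_finite_set _ _ [set Num.sqrt c; - Num.sqrt c]%R) => //.
  move=> x /= <-; rewrite sqrtr_sqr.
  by case: (leP 0%R x) => [x0|/ltW x0]; [left; rewrite ger0_norm|right; rewrite ler0_norm// opprK].
Qed.

Lemma measurable_sqnorm_set m (B : set R) : measurable B ->
  measurable [set v : m.-tuple R | B (sqnorm v)].
Proof.
move=> mB; rewrite (_ : [set _ | _] = @sqnorm R m @^-1` B)//.
by rewrite -[X in measurable X]setTI; exact: measurable_sqnorm.
Qed.

Lemma sqnorm_cons m y (t : m.-tuple R) :
  sqnorm (tuple_cons (y, t)) = (y ^+ 2 + sqnorm t)%R.
Proof.
by rewrite /sqnorm big_ord_recl; congr (_ + _)%R; apply: eq_bigr => l _; rewrite tuple_consE.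
Qed.

(** Given the other coordinates, the first one has to hit one of at most two
    points. *)
Lemma chi2_atom m (x : R) : iid_law N m.+1 [set v | sqnorm v = x] = 0.
Proof.
have mA : measurable [set v : m.+1.-tuple R | sqnorm v = x].
  exact: (@measurable_sqnorm_set _ [set x]).
rewrite -(setIT [set _ | _]) -integral_indic//.
have mI : measurable_fun setT (fun v => (\1_[set v : m.+1.-tuple R | sqnorm v = x] v)%:E : \bar R).
  by apply/measurable_EFinP; exact: measurable_indic.
rewrite ge0_integral_iidS//.
rewrite (@fubini_tonelli _ _ _ _ _ N (iid_law N m)
  (fun z => (\1_[set v : m.+1.-tuple R | sqnorm v = x] (tuple_cons (z.1, z.2)))%:E))//;
  last first.
  by apply: (measurableT_comp mI); exact: measurable_tuple_cons_comp.
apply: integral0_eq => t _.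
rewrite (eq_integral (fun y => (\1_[set y : R | (y ^+ 2)%R = (x - sqnorm t)%R] y)%:E)); last first.
  move=> y _; rewrite /= !indicE; congr ((nat_of_bool _)%:R%:E); apply/idP/idP; rewrite !inE/= sqnorm_cons => ?; lra.
rewrite integral_indic// ?setIT; first exact: std_normal_sqr_atom.
rewrite (_ : [set _ | _] = (fun y : R => y ^+ 2)%R @^-1` [set (x - sqnorm t)%R])//.
rewrite -[X in measurable X]setTI.
by apply: (measurable_funX 2 (@measurable_id _ _ setT)).
Qed.

(** The closed neighbourhoods of x decrease to the point x, which carries no
    mass. *)
Lemma chi2_small m (x e : R) : (0 < e)%R -> exists2 dl : R, (0 < dl)%R &
  iid_law N m.+1 [set v | `|sqnorm v - x| <= dl]%R <= e%:E.
Proof.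
move=> e0; pose F n := [set v : m.+1.-tuple R | `|sqnorm v - x| <= n.+1%:R^-1]%R.
have mF n : measurable (F n).
  apply: (@measurable_sqnorm_set _ [set y : R | `|y - x| <= n.+1%:R^-1]%R).
  rewrite (_ : [set _ | _] = closed_ball x (n.+1%:R^-1 : R)).
    exact: measurable_closed_ball.
  by rewrite closed_ballE//; apply/seteqP; split => y /=; rewrite /closed_ball_/= distrC.
have FI : \bigcap_n F n = [set v | sqnorm v = x].
  apply/seteqP; split => v /=; last by move=> vx n _; rewrite /F /= vx subrr normr0.
  move=> H; apply/eqP; rewrite -subr_eq0 -normr_le0; apply/ler_addgt0Pl => r r0.
  rewrite addr0; have [n _ nr] := near_infty_natSinv_lt (PosNum r0).
  by apply: (le_trans (H n I)); apply/ltW/nr => /=.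
have := @nonincreasing_cvg_mu _ _ _ (iid_law N m.+1) F.
rewrite FI => /(_ _ mF _ _) H.
have {}H : iid_law N m.+1 (F n) @[n --> \oo] --> 0.
  rewrite -(chi2_atom m x); apply: H => //.
  - by apply: (le_lt_trans (probability_le1 _ (mF 0%N))); rewrite ltry.
  - exact: (@measurable_sqnorm_set _ [set x]).
  - move=> i j ij; apply/subsetPset => v /=; rewrite /F /= => /le_trans; apply.
    by rewrite lef_pV2 ?posrE ?ltr0n// ler_nat ltnS.
have /fine_cvgP[_ /cvgrPdist_le] := H.
move=> /(_ _ e0)[n _ /(_ n (leqnn n))].
rewrite sub0r normrN ger0_norm ?fine_ge0// => nE.
exists (n.+1%:R^-1)%R; first by rewrite invr_gt0 ltr0n.
rewrite -[leLHS]fineK ?lee_fin//.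
by rewrite ge0_fin_numE// (le_lt_trans (probability_le1 _ (mF n))) ?ltry.
Qed.

End chi2.

Lemma le_measureU d (T : measurableType d) (R : realType)
    (mu : {measure set T -> \bar R}) (A B C : set T) :
  measurable A -> measurable B -> measurable C -> A `<=` B `|` C ->
  (mu A <= mu B + mu C)%E.
Proof.
move=> mA mB mC ABC; apply: (@le_trans _ _ (mu (B `|` C))); last exact: measureU2.
by apply: le_measure; rewrite ?inE//; exact: measurableU.
Qed.

Section clt.
Local Open Scope ereal_scope.
Context (R : realType) (m : nat).
Notation vec := (m.-tuple R).
Notation N := (std_normal R).

Definition walk d (T : measurableType d) (V : T -> vec) n (s : n.-tuple T) : vec :=
  [tuple (Num.sqrt n%:R)^-1 * \sum_(i < n) tnth (V (tnth s i)) l | l < m]%R.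

Lemma measurable_walk d (T : measurableType d) (V : T -> vec) n :
  measurable_fun setT V -> measurable_fun setT (@walk _ T V n).
Proof.
move=> mV; apply/measurable_fun_tnthP => l.
rewrite (_ : _ \o _ = fun s =>
  (Num.sqrt n%:R)^-1 * \sum_(i < n) tnth (V (tnth s i)) l)%R; last first.
  by apply/funext => s /=; rewrite tnth_mktuple.
apply: measurable_funM => //; apply: measurable_sum => i.
apply: (measurableT_comp (@measurable_tnth _ _ _ l)).
by apply: (measurableT_comp mV); exact: measurable_tnth.
Qed.

Lemma integral_walk d (T : measurableType d) (mu : probability T R) (V : T -> vec)
    n (F : vec -> \bar R) :
  measurable_fun setT V -> measurable_fun setT F -> (forall v, 0 <= F v) ->
  \int[iid_law mu n]_s F (walk V s) =
  iter n (step mu V (Num.sqrt n%:R)^-1) F [tuple 0%R | l < m].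
Proof.
move=> mV mF F0; rewrite -integral_iid_walk//; apply: eq_integral => s _.
by congr F; apply: eq_from_tnth => l; rewrite !tnth_mktuple add0r.
Qed.

(** A Gaussian walk normalized by the square root of its length has the law of
    a single Gaussian step. *)
Lemma integral_gauss_iter n (F : vec -> \bar R) :
  measurable_fun setT F -> (forall v, 0 <= F v) ->
  iter n.+1 (step (iid_law N m) id (Num.sqrt n.+1%:R)^-1) F [tuple 0%R | l < m] =
  \int[iid_law N m]_v F v.
Proof.
move=> mF F0; rewrite iter_gauss_step ?invr_gt0 ?sqrtr_gt0 ?ltr0n//.
rewrite /step; apply: eq_integral => v _; congr F; apply: eq_from_tnth => l.
by rewrite !tnth_mktuple add0r divff ?mul1r// gt_eqF// sqrtr_gt0 ltr0n.
Qed.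

(** Each of the n exchanges costs the cube of the step length, that is
    n^(-3/2), hence the rate n^(-1/2). The constant involves the law of the
    steps only through the common bound B. *)
Lemma clt_radial_ramp (B x0 dl : R) : (0 <= B)%R -> (0 < dl)%R -> exists2 K : R, (0 <= K)%R &
  forall n d (T : measurableType d) (mu : probability T R) (V : T -> vec),
    measurable_fun setT V -> isotropic mu V ->
    (forall t l, `|tnth (V t) l| <= B)%R ->
  \int[iid_law mu n.+1]_s (radial_ramp x0 dl (walk V s))%:E <=
    \int[iid_law N m]_v (radial_ramp x0 dl v)%:E + (K / Num.sqrt n.+1%:R)%:E /\
  \int[iid_law N m]_v (radial_ramp x0 dl v)%:E <=
    \int[iid_law mu n.+1]_s (radial_ramp x0 dl (walk V s))%:E + (K / Num.sqrt n.+1%:R)%:E.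
Proof.
move=> B0 dl0; have [K K0 HK] := lindeberg_one_step m x0 dl0.
have [MG MGE] := gauss_norm1_cube R m.
have MG0 : (0 <= MG)%R.
  by apply: (has_mean_le (has_mean_cst _ 0) MGE) => v; rewrite exprn_ge0 ?norm1_ge0.
pose B3 : R := ((m%:R * B) ^+ 3)%R.
have B30 : (0 <= B3)%R by rewrite exprn_ge0// mulr_ge0.
exists (K * (B3 + MG))%R; first by rewrite mulr_ge0// addr_ge0.
move=> n d T mu V mV iso VB.
have mn3 : measurable_fun setT (fun t => norm1 (V t) ^+ 3)%R.
  by apply: measurable_funX; exact: (measurableT_comp (@measurable_norm1 R m)).
have n3B t : (`|norm1 (V t) ^+ 3| <= B3)%R.
  rewrite ger0_norm ?exprn_ge0 ?norm1_ge0//.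
  apply: lerXn2r; rewrite ?nnegrE ?norm1_ge0 ?mulr_ge0//.
  apply: (@le_trans _ _ (\sum_(l < m) B)%R); first exact: ler_sum.
  by rewrite sumr_const card_ord mulr_natl.
have [MV MVE MVB] := has_mean_bounded mu mn3 n3B.
have isoG := @isotropic_gauss R m.
pose c : R := (Num.sqrt n.+1%:R)^-1%R.
have c0 : (0 <= c)%R by rewrite invr_ge0 sqrtr_ge0.
pose F := EFin \o (@radial_ramp R m x0 dl).
have mF : measurable_fun setT F by apply/measurable_EFinP; exact: measurable_radial_ramp.
have F0 v : 0 <= F v by rewrite lee_fin; have /andP[] := radial_ramp_bounds x0 dl0 v.
have h1 w := HK _ _ _ _ _ _ _ _ _ _ mV iso MVE (@measurable_id _ vec setT) isoG MGE c w c0.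
have h2 w := HK _ _ _ _ _ _ _ _ _ _ (@measurable_id _ vec setT) isoG MGE mV iso MVE c w c0.
have MV0 : (0 <= MV)%R.
  by apply: (has_mean_le (has_mean_cst _ 0) MVE) => v; rewrite exprn_ge0 ?norm1_ge0.
have e0 : (0 <= c ^+ 3 * (K * (MV + MG)))%R.
  by rewrite mulr_ge0 ?exprn_ge0// mulr_ge0// addr_ge0.
have eE : (n.+1%:R * (c ^+ 3 * (K * (MV + MG))) <= K * (B3 + MG) / Num.sqrt n.+1%:R)%R.
  rewrite (_ : n.+1%:R * _ = (n.+1%:R * c ^+ 2) * (K * (MV + MG) * c))%R; last by ring.
  rewrite exprVn sqr_sqrtr// divff ?pnatr_eq0// mul1r ler_wpM2r// ler_wpM2l// lerD2r.
  exact: le_trans (ler_norm _) MVB.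
have E1 := integral_walk mu n.+1 mV mF F0.
have E2 := integral_gauss_iter n mF F0.
have E1' : \int[iid_law mu n.+1]_s (radial_ramp x0 dl (walk V s))%:E =
  iter n.+1 (step mu V c) F [tuple 0%R | l < m] by exact: E1.
have E2' : \int[iid_law N m]_v (radial_ramp x0 dl v)%:E =
  iter n.+1 (step (iid_law N m) id c) F [tuple 0%R | l < m] by exact: esym E2.
rewrite E1' E2'; split.
  apply: (le_trans (iter_step_compare mV (@measurable_id _ vec setT) n.+1 _ mF F0 e0 h1)).
  by rewrite leeD2l// lee_fin.
apply: (le_trans (iter_step_compare (@measurable_id _ vec setT) mV n.+1 _ mF F0 _ h2)).
  by rewrite (addrC MG).
by rewrite leeD2l// lee_fin (addrC MG).
Qed.

End clt.

(** The rank n0 depends on the bound B but not on the probability space, which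
    may change with n: this is what makes the level of the test uniform. Smooth
    thresholds just below and above x squeeze the indicator, and the Gaussian
    vector puts little mass in between. *)
Theorem clt_sqnorm (R : realType) (m : nat) (B x e : R) :
  0 <= B -> 0 < e -> exists n0 : nat, forall n d (T : measurableType d)
    (mu : probability T R) (V : T -> m.+1.-tuple R), (n0 <= n)%N ->
    measurable_fun setT V -> isotropic mu V -> (forall t l, `|tnth (V t) l| <= B) ->
  `|fine (iid_law mu n [set s | x < sqnorm (walk V s)]) - (1 - chi2_cdf m.+1 x)| <= e.
Proof.
move=> B0 e0; have e20 : 0 < e / 2 by rewrite divr_gt0.
have [dl dl0 hdl] := chi2_small m x e20.
have d30 : 0 < dl / 3 by rewrite divr_gt0.
have [K1 K10 hK1] := clt_radial_ramp m.+1 (x - dl) B0 d30.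
have [K2 K20 hK2] := clt_radial_ramp m.+1 x B0 d30.
pose K := Num.max K1 K2.
have [n0 hn0] : exists n0 : nat, forall n, (n0 <= n)%N -> K / Num.sqrt n.+1%:R <= e / 2.
  exists (Num.truncn ((K / (e / 2)) ^+ 2)) => n nn0.
  have K0 : 0 <= K by rewrite le_max K10.
  rewrite ler_pdivrMr ?sqrtr_gt0 ?ltr0n// -ler_pdivrMl// mulrC.
  rewrite -(ger0_norm (divr_ge0 K0 (ltW e20))) -sqrtr_sqr ler_sqrt//.
  apply/ltW/(lt_le_trans (truncnS_gt _)).
  by rewrite ler_nat ltnS.
exists n0.+1 => -[//|n] d T mu V; rewrite ltnS => nn0 mV iso VB.
have hKe K' : K' <= K -> K' / Num.sqrt n.+1%:R <= e / 2.
  move=> KK'; apply: le_trans (hn0 n nn0).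
  by rewrite ler_wpM2r// invr_ge0 sqrtr_ge0.
pose G := iid_law (std_normal R) m.+1; pose Q := iid_law mu n.+1.
pose A := [set s : n.+1.-tuple T | x < sqnorm (walk V s)].
have mgt k (y : R) : measurable [set v : k.-tuple R | y < sqnorm v].
  rewrite (_ : [set _ | _] = @sqnorm R k @^-1` `]y, +oo[).
    exact: measurable_sqnorm_set.
  by apply/seteqP; split => v /=; rewrite in_itv/= andbT.
have mle k (y : R) : measurable [set v : k.-tuple R | sqnorm v <= y].
  rewrite (_ : [set _ | _] = @sqnorm R k @^-1` `]-oo, y]).
    exact: measurable_sqnorm_set.
  by apply/seteqP; split => v /=; rewrite in_itv.
have mA : measurable A.
  by rewrite -[A]setTI; exact: (measurable_walk mV measurableT (mgt _ x)).
have Cx : (chi2_cdf m.+1 x)%:E = G [set v | sqnorm v <= x].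
  rewrite /chi2_cdf fineK// ge0_fin_numE//.
  by rewrite (le_lt_trans (probability_le1 _ (mle _ x)))// ltry.
have Gx : G [set v | x < sqnorm v] = (1 - chi2_cdf m.+1 x)%:E.
  rewrite EFinB Cx -probability_setC; last exact: mle.
  congr (G _).
  by apply/seteqP; split => v /=; rewrite ltNge => /negP.
have mb d' (T' : measurableType d') (W : T' -> m.+1.-tuple R) y : measurable_fun setT W ->
    measurable_fun setT (fun t => (radial_ramp y (dl / 3) (W t))%:E).
  by move=> mW; apply/measurable_EFinP; exact: (measurableT_comp (measurable_radial_ramp y (dl / 3)) mW).
have mW := @measurable_walk R m.+1 _ _ V n.+1 mV.
have b0 y (v : m.+1.-tuple R) : (0%E <= (radial_ramp y (dl / 3) v)%:E)%E.
  by rewrite lee_fin; have /andP[] := radial_ramp_bounds y d30 v.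
have b1 y (v : m.+1.-tuple R) : radial_ramp y (dl / 3) v <= 1.
  by have /andP[] := radial_ramp_bounds y d30 v.
(* the ramp lies between the indicators of the half-lines at its two ends *)
have up d' (T' : measurableType d') (P : probability T' R) (W : T' -> m.+1.-tuple R) y :
    measurable_fun setT W ->
    (P [set t | y + dl < sqnorm (W t)]%R <= \int[P]_t (radial_ramp y (dl / 3) (W t))%:E)%E.
  move=> mW'; have mS : measurable [set t | y + dl < sqnorm (W t)].
    by rewrite -[X in measurable X]setTI; exact: (mW' measurableT _ (mgt _ _)).
  rewrite -[X in P X]setIT -integral_indic//; apply: ge0_le_integral => //.
  - by apply/measurable_EFinP; exact: measurable_indic.
  - exact: mb.
  - move=> t _; rewrite indicE lee_fin; case: (boolP (_ \in _)) => [|_].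
      rewrite inE/= => yt; rewrite /radial_ramp; have [|-> _ _] := @ramp_ge1 R y _ d30 (sqnorm (W t)).
        by rewrite mulrC divfK//; exact: ltW.
      by [].
    by rewrite -lee_fin; exact: b0.
have lo d' (T' : measurableType d') (P : probability T' R) (W : T' -> m.+1.-tuple R) y :
    measurable_fun setT W ->
    (\int[P]_t (radial_ramp y (dl / 3) (W t))%:E <= P [set t | y < sqnorm (W t)]%R)%E.
  move=> mW'; have mS : measurable [set t | y < sqnorm (W t)].
    by rewrite -[X in measurable X]setTI; exact: (mW' measurableT _ (mgt _ _)).
  rewrite -[X in P X]setIT -integral_indic//; apply: ge0_le_integral => //.
  - exact: mb.
  - by apply/measurable_EFinP; exact: measurable_indic.
  - move=> t _; rewrite indicE lee_fin; case: (boolP (_ \in _)) => [_|]; first exact: b1.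
    by rewrite notin_setE/= => /negP; rewrite -leNgt => ?; rewrite /radial_ramp ramp_le0.
have Lw y := lo _ _ Q (fun s : n.+1.-tuple T => walk V s) y mW.
have Uw y := up _ _ Q (fun s : n.+1.-tuple T => walk V s) y mW.
have [hu _] := hK1 n _ _ _ _ mV iso VB; have [_ hl] := hK2 n _ _ _ _ mV iso VB.
have msm (B' : set R) : measurable B' -> measurable [set v : m.+1.-tuple R | B' (sqnorm v)].
  exact: measurable_sqnorm_set.
have near_m : measurable [set v : m.+1.-tuple R | `|sqnorm v - x| <= dl].
  apply: (msm [set y : R | `|y - x| <= dl]).
  rewrite (_ : [set _ | _] = closed_ball x dl); first exact: measurable_closed_ball.
  by rewrite closed_ballE//; apply/seteqP; split => y /=; rewrite /closed_ball_/= distrC.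
have fA : Q A \is a fin_num.
  by rewrite ge0_fin_numE// (le_lt_trans (probability_le1 _ mA))// ltry.
have QA : (fine (Q A))%:E = Q A by rewrite fineK.
rewrite ler_norml; apply/andP; split.
  rewrite lerBrDr addrC -lee_fin EFinB.
  have : (G [set v | x + dl < sqnorm v]%R <= Q A + (e / 2)%:E)%E.
    apply: (le_trans (@up _ _ G id x (@measurable_id _ _ setT))).
    apply: (le_trans hl); apply: leeD; first exact: Lw.
    by rewrite lee_fin hKe// le_max lexx orbT.
  move=> h1.
  have : (G [set v | x < sqnorm v]%R <=
      G [set v | x + dl < sqnorm v]%R + G [set v | `|sqnorm v - x| <= dl]%R)%E.
    apply: (le_measureU _ (mgt _ _) (mgt _ _) near_m) => v /= xv; have [?|?] := ltP (x + dl) (sqnorm v); [by left|right => /=].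
      by rewrite ger0_norm; lra.
  rewrite Gx => h2.
  rewrite leeBlDr// QA; apply: (le_trans h2); apply: (le_trans (leeD h1 hdl)).
  by rewrite -addeA -EFinD -splitr.
rewrite lerBlDr addrC -lee_fin QA EFinD -Gx.
have h1 : (Q A <= G [set v | x - dl < sqnorm v]%R + (e / 2)%:E)%E.
  have := Uw (x - dl); rewrite subrK => /le_trans; apply.
  apply: (le_trans hu); apply: leeD; first exact: (lo _ _ G id (x - dl) (@measurable_id _ _ setT)).
  by rewrite lee_fin hKe// le_max lexx.
have h2 : (G [set v | x - dl < sqnorm v]%R <=
    G [set v | x < sqnorm v]%R + G [set v | `|sqnorm v - x| <= dl]%R)%E.
  apply: (le_measureU _ (mgt _ _) (mgt _ _) near_m) => v /= xv; have [?|?] := ltP x (sqnorm v); [by left|right => /=].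
    by rewrite ler0_norm; lra.
apply: (le_trans h1); apply: (le_trans (leeD (le_trans h2 (leeD (lexx _) hdl)) (lexx _))).
by rewrite -addeA -EFinD -splitr.
Qed.

(** * Conditional distributions and the probability integral transform *)

Section rectangles.
Context d1 (T1 : measurableType d1) d2 (T2 : measurableType d2).

(** Rectangles are closed under intersection and generate the product
    sigma-algebra. *)
Lemma rectangle_induction (Pr : set (T1 * T2) -> Prop) :
  (forall A B, measurable A -> measurable B -> Pr (A `*` B)) ->
  (forall S, measurable S -> Pr S -> Pr (~` S)) ->
  (forall F : (set (T1 * T2))^nat, (forall n, measurable (F n)) ->
    trivIset [set: nat] F -> (forall n, Pr (F n)) -> Pr (\bigcup_k F k)) ->
  forall S, measurable S -> Pr S.
Proof.
move=> rect compl union S mS.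
apply: (@dynkin_induction _ (T1 * T2)%type
  [set A `*` B | A in @measurable _ T1 & B in @measurable _ T2] Pr) => //.
- by rewrite measurable_prod_measurableType.
- move=> _ _ [A mA [B mB <-]] [A' mA' [B' mB' <-]].
  exists (A `&` A'); first exact: measurableI.
  by exists (B `&` B'); [exact: measurableI|rewrite setXI].
- by rewrite -setXTT; exact: rect.
- by move=> _ [A mA [B mB <-]]; exact: rect.
- by rewrite -measurable_prod_measurableType.
Qed.

End rectangles.

Section kernel_section.
Local Open Scope ereal_scope.
Context d1 (T1 : measurableType d1) d2 (T2 : measurableType d2)
  dG (G : measurableType dG) (R : realType).
Variables (g : T1 -> G) (K : R.-pker G ~> T2).
Hypothesis mg : measurable_fun setT g.

Lemma kernel_setC z (A : set T2) : measurable A -> K z (~` A) = 1 - K z A.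
Proof.
move=> mA; have KA1 : K z A <= 1.
  by rewrite -(prob_kernel (s := K) z); apply: le_measure; rewrite ?inE.
have KAf : K z A \is a fin_num by rewrite ge0_fin_numE// (le_lt_trans KA1)// ltry.
rewrite -(prob_kernel (s := K) z) -(setvU A) measureU//.
- by rewrite addeK.
- exact: measurableC.
- by rewrite setICl.
Qed.

Lemma kernel_le1 z (A : set T2) : measurable A -> K z A <= 1.
Proof.
by move=> mA; rewrite -(prob_kernel (s := K) z); apply: le_measure; rewrite ?inE.
Qed.

Lemma xsectionC (Q : set (T1 * T2)) a : xsection (~` Q) a = ~` xsection Q a.
Proof. by apply/seteqP; split => y; rewrite /= !xsectionE. Qed.

Lemma measurable_kernel_xsection (Q : set (T1 * T2)) : measurable Q ->
  measurable_fun setT (fun a => K (g a) (xsection Q a)).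
Proof.
move: Q; apply: rectangle_induction.
- move=> A B mA mB.
  rewrite (_ : (fun _ => _) = fun a => (\1_A a)%:E * K (g a) B).
    apply: emeasurable_funM.
      by apply/measurable_EFinP; exact: measurable_indic.
    exact: (measurableT_comp (measurable_kernel K B mB)).
  apply/funext => a; rewrite indicE; have [aA|aA] := boolP (a \in A).
    by rewrite in_xsectionX// mul1e.
  by rewrite notin_xsectionX// measure0 mul0e.
- move=> S mS IH.
  rewrite (_ : (fun _ => _) = fun a => 1 - K (g a) (xsection S a)).
    exact: emeasurable_funB.
  apply/funext => a; rewrite xsectionC kernel_setC//; exact: measurable_xsection.
- move=> F mF tF IH.
  rewrite (_ : (fun _ => _) = fun a => \sum_(0 <= k <oo) K (g a) (xsection (F k) a)).
    apply: ge0_emeasurable_sum => // k a _ _; exact: measure_ge0.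
  apply/funext => a; rewrite xsection_bigcup measure_bigcup//.
  + by apply: eq_eseriesl => k; rewrite in_setT.
  + by move=> k _; exact: measurable_xsection.
  + exact: trivIset_xsection.
Qed.

Context d (T : measurableType d) (P : probability T R).
Variables (A : T -> T1) (Y : T -> T2).
Hypotheses (mA : measurable_fun setT A) (mY : measurable_fun setT Y).

(** The hypothesis says that K at g (A w) is the conditional law of Y given A on
    rectangles; a monotone class argument extends it to events that involve A
    and Y jointly. *)
Lemma disintegration :
  (forall S B, measurable S -> measurable B ->
    P (A @^-1` S `&` Y @^-1` B) = \int[P]_(w in A @^-1` S) K (g (A w)) B) ->
  forall Q, measurable Q ->
    P [set w | Q (A w, Y w)] = \int[P]_w K (g (A w)) (xsection Q (A w)).
Proof.
move=> H.
have mAY : measurable_fun setT (fun w => (A w, Y w)) by exact: measurable_fun_pair.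
have mpre Q : measurable Q -> measurable [set w | Q (A w, Y w)].
  by move=> mQ; rewrite -[X in measurable X]setTI; exact: (mAY measurableT _ mQ).
have mK Q : measurable Q -> measurable_fun setT (fun w => K (g (A w)) (xsection Q (A w))).
  by move=> mQ; apply: (measurableT_comp (measurable_kernel_xsection mQ)).
apply: rectangle_induction.
- move=> S B mS mB; rewrite [LHS](_ : _ = P (A @^-1` S `&` Y @^-1` B))// H//.
  rewrite integral_mkcond; apply: eq_integral => w _; rewrite patchE.
  have [wS|wS] := boolP (A w \in S).
    by rewrite in_xsectionX// (_ : w \in _)//; move: wS; rewrite !inE.
  rewrite notin_xsectionX// measure0 ifF//; apply/negP; rewrite inE /= => ?.
  by move/negP : wS; rewrite inE.
- move=> S mS IH; rewrite [LHS](_ : _ = P (~` [set w | S (A w, Y w)]))//.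
  rewrite probability_setC; last exact: mpre.
  rewrite IH; set I := \int[P]_w _.
  have <- : \int[P]_w K (g (A w)) (xsection (~` S) (A w)) + I = 1.
    rewrite -ge0_integralD//; last 2 first.
    + by apply: mK; exact: measurableC.
    + exact: mK.
    rewrite -[RHS](integral_cst_prob P 1); apply: eq_integral => w _.
    rewrite xsectionC -measureU//; last 3 first.
    + by apply: measurableC; exact: measurable_xsection.
    + exact: measurable_xsection.
    + by rewrite setICl.
    by rewrite setvU; exact: prob_kernel.
  rewrite addeK// /I -IH ge0_fin_numE//.
  by rewrite (le_lt_trans (probability_le1 _ (mpre _ mS)))// ltry.
- move=> F mF tF IH.
  rewrite [LHS](_ : _ = P (\bigcup_k [set w | F k (A w, Y w)])); last first.
    by congr (P _); apply/seteqP; split => w /=.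
  rewrite measure_bigcup//; last 2 first.
  + by move=> k _; exact: mpre.
  + apply/trivIsetP => i j _ _ ij; move/trivIsetP: tF => /(_ i j I I ij) FE.
    apply/seteqP; split => // w [h1 h2].
    by suff : set0 (A w, Y w) by []; rewrite -FE.
  transitivity (\int[P]_w \sum_(0 <= k <oo) K (g (A w)) (xsection (F k) (A w))).
    rewrite integral_nneseries//; last first.
      by move=> k; exact: mK.
    transitivity (\sum_(0 <= k <oo) P [set w | F k (A w, Y w)]).
      by apply: eq_eseriesl => k; rewrite in_setT.
    by apply: eq_eseriesr => k _; rewrite IH.
  apply: eq_integral => w _; rewrite xsection_bigcup measure_bigcup//.
  + by apply: eq_eseriesl => k; rewrite in_setT.
  + by move=> k _; exact: measurable_xsection.
  + exact: trivIset_xsection.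
Qed.

End kernel_section.

Section cond_indep_kernel.
Local Open Scope ereal_scope.
Context d (T : measurableType d) dE (E : measurableType dE)
  dE' (E' : measurableType dE') dG (G : measurableType dG) (R : realType).
Variables (P : probability T R) (X : T -> E) (Y : T -> E') (Z : T -> G).
Hypotheses (mX : measurable_fun setT X) (mY : measurable_fun setT Y)
  (mZ : measurable_fun setT Z).

Let mpreX A : measurable A -> measurable (X @^-1` A).
Proof. by move=> mA; rewrite -[X in measurable X]setTI; exact: mX. Qed.
Let mpreY A : measurable A -> measurable (Y @^-1` A).
Proof. by move=> mA; rewrite -[X in measurable X]setTI; exact: mY. Qed.
Let mpreZ A : measurable A -> measurable (Z @^-1` A).
Proof. by move=> mA; rewrite -[X in measurable X]setTI; exact: mZ. Qed.

(** Both sides integrate f with respect to the law of Z restricted to the event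
    that X lies in A, which has density K(., A) with respect to the law of Z. *)
Lemma cond_dist_integral (K : R.-pker G ~> E) A C (f : G -> \bar R) :
  cond_dist P X Z K -> measurable A -> measurable C ->
  measurable_fun setT f -> (forall z, 0 <= f z) ->
  \int[P]_(w in Z @^-1` C) (K (Z w) A * f (Z w)) =
  \int[P]_(w in X @^-1` A `&` Z @^-1` C) f (Z w).
Proof.
move=> hK mA mC mf f0.
pose Zr : {mfun T >-> G} := mfun_Sub (mem_set mZ).
pose nu := distribution P Zr.
pose F z := f z * (\1_C z)%:E.
have mF : measurable_fun setT F.
  by apply: emeasurable_funM => //; apply/measurable_EFinP; exact: measurable_indic.
have F0 z : 0 <= F z by rewrite mule_ge0// lee_fin.
pose g z := fine (K z A).
have gE z : (g z)%:E = K z A.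
  by rewrite fineK// ge0_fin_numE// (le_lt_trans (kernel_le1 K z mA))// ltry.
have mg : measurable_fun setT g.
  by apply: measurableT_comp => //; exact: measurable_kernel.
have g0 z : (0 <= g z)%R by rewrite fine_ge0.
have mXA := mpreX mA.
have FD (h : T -> \bar R) : \int[P]_(w in Z @^-1` C) h w =
    \int[P]_w (h w * (\1_C (Z w))%:E).
  rewrite integral_mkcond; apply: eq_integral => w _; rewrite patchE indicE.
  rewrite (_ : (w \in Z @^-1` C) = (Z w \in C)); last by apply/idP/idP; rewrite !inE.
  by case: ifPn => _; rewrite ?mule1 ?mule0.
have PF := ge0_integral_pushforward mZ (mrestr P mXA) measurableT mF (fun z _ => F0 z).
rewrite (@ge0_integral_density _ G R nu _ g mg g0 _ F mF F0) in PF; last first.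
  move=> D mD; rewrite [LHS](_ : _ = P (Z @^-1` D `&` X @^-1` A))// setIC.
  have mgD : measurable_fun D (fun y => (g y)%:E).
    by apply: measurable_funTS; exact/measurable_EFinP.
  have g0D : {in D, forall y, 0 <= (g y)%:E} by move=> y _; rewrite lee_fin.
  rewrite [RHS]ge0_integral_pushforward//.
  rewrite hK//; apply: eq_integral => w _.
  by rewrite -gE.
rewrite ge0_integral_distribution in PF; last 2 first.
- by apply: emeasurable_funM => //; exact/measurable_EFinP.
- by move=> z; rewrite mule_ge0// lee_fin.
rewrite FD; transitivity (\int[P]_x (F (Z x) * (g (Z x))%:E)).
  by apply: eq_integral => w _; rewrite gE /F -muleA muleC -muleA muleC -muleA [X in _ * X]muleC.
rewrite [LHS]PF preimage_setT (@ge0_integral_density _ T R P _ (\1_(X @^-1` A))); last 5 first.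
- exact: measurable_indic.
- by [].
- by move=> D mD; rewrite /mrestr [RHS]integral_indic// setIC.
- exact: (measurableT_comp mF).
- by move=> w; exact: F0.
rewrite [RHS]integral_mkcond; apply: eq_integral => w _; rewrite patchE /= /F !indicE.
rewrite (_ : (w \in X @^-1` A `&` Z @^-1` C) = (X w \in A) && (Z w \in C)); last first.
  by rewrite in_setI; congr andb; apply/idP/idP; rewrite !inE.
rewrite (_ : (w \in X @^-1` A) = (X w \in A)); last by apply/idP/idP; rewrite !inE.
by case: (X w \in A); case: (Z w \in C); rewrite ?(mule1, mule0).
Qed.

(** Versions of a conditional distribution agree almost surely on each single
    event, which is all that an integral of f (Z) K (Z, B) sees. *)
Lemma cond_dist_unique (K K' : R.-pker G ~> E') B C (f : G -> \bar R) :
  cond_dist P Y Z K -> cond_dist P Y Z K' -> measurable B -> measurable C ->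
  measurable_fun setT f -> (forall z, 0 <= f z) ->
  \int[P]_(w in Z @^-1` C) (f (Z w) * K (Z w) B) =
  \int[P]_(w in Z @^-1` C) (f (Z w) * K' (Z w) B).
Proof.
move=> hK hK' mB mC mf f0.
pose Zr : {mfun T >-> G} := mfun_Sub (mem_set mZ).
pose nu := distribution P Zr.
have mk (k : R.-pker G ~> E') : measurable_fun setT (fun z => k z B).
  exact: measurable_kernel.
have hE (k : R.-pker G ~> E') D : cond_dist P Y Z k -> measurable D ->
    \int[nu]_(z in D) k z B = P (Y @^-1` B `&` Z @^-1` D).
  move=> hk mD; rewrite [LHS]ge0_integral_pushforward//; last exact: measurable_funTS.
  by rewrite hk.
have ki : nu.-integrable setT (fun z => K z B).
  apply/integrableP; split => //.
  under eq_integral do rewrite gee0_abs//.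
  rewrite hE// (le_lt_trans (probability_le1 _ _)) ?ltry//.
  by apply: measurableI; [exact: mpreY|exact: mpreZ].
have ae : ae_eq nu setT (fun z => K z B) (fun z => K' z B).
  by apply: integral_ae_eq => // D _ mD; rewrite !hE.
have push (k : R.-pker G ~> E') : \int[P]_(w in Z @^-1` C) (f (Z w) * k (Z w) B) =
    \int[nu]_(z in C) (f z * k z B).
  rewrite [RHS]ge0_integral_pushforward//.
  - apply: measurable_funTS; exact: emeasurable_funM.
  - by move=> z _; rewrite mule_ge0.
rewrite !push; apply: ge0_ae_eq_integral => //.
- by apply: measurable_funTS; exact: emeasurable_funM.
- by apply: measurable_funTS; exact: emeasurable_funM.
- by move=> z _; rewrite mule_ge0.
- by move=> z _; rewrite mule_ge0.
- by apply: (ae_eq_subset (subsetT C)); exact: ae_eqe_mul2l.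
Qed.

(** Given Z, the component X carries no information on Y: a version of the
    conditional law of Y given Z is one of the law of Y given (X, Z). The
    versions that witness the conditional independence are traded for K by the
    two preceding lemmas. *)
Lemma cond_indep_kernel (K : R.-pker G ~> E') S B :
  cond_indep P X Y Z -> cond_dist P Y Z K -> measurable S -> measurable B ->
  P ((fun w => (X w, Z w)) @^-1` S `&` Y @^-1` B) =
  \int[P]_(w in (fun w => (X w, Z w)) @^-1` S) K (Z w) B.
Proof.
move=> [KX [KY [hX hY hXY]]] hK + mB.
have mK : measurable_fun setT (fun w => K (Z w) B).
  exact: (measurableT_comp (measurable_kernel K B mB)).
have mXZ : measurable_fun setT (fun w => (X w, Z w)) by exact: measurable_fun_pair.
have mpre Q : measurable Q -> measurable ((fun w => (X w, Z w)) @^-1` Q).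
  by move=> mQ; rewrite -[X in measurable X]setTI; exact: (mXZ measurableT _ mQ).
have PYf : P (Y @^-1` B) \is a fin_num.
  by rewrite ge0_fin_numE// (le_lt_trans (probability_le1 _ (mpreY mB)))// ltry.
have PY : P (Y @^-1` B) = \int[P]_w K (Z w) B.
  by have := hK B setT mB measurableT; rewrite preimage_setT setIT.
move: S; apply: rectangle_induction.
- move=> A C mA mC.
  rewrite (_ : _ @^-1` (A `*` C) = X @^-1` A `&` Z @^-1` C); last first.
    by apply/seteqP; split => w.
  rewrite setIAC hXY// (@cond_dist_unique KY K B C (fun z => KX z A))//; last first.
    exact: measurable_kernel.
  by rewrite (@cond_dist_integral KX A C (fun z => K z B))//; exact: measurable_kernel.
- move=> S mS IH; rewrite preimage_setC.
  have : P ((fun w => (X w, Z w)) @^-1` S `&` Y @^-1` B) +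
         P (~` ((fun w => (X w, Z w)) @^-1` S) `&` Y @^-1` B) = P (Y @^-1` B).
    rewrite -measureU//; last 3 first.
    + by apply: measurableI; [exact: mpre|exact: mpreY].
    + by apply: measurableI; [apply: measurableC; exact: mpre|exact: mpreY].
    + by rewrite setIACA setICr set0I.
    by rewrite -setIUl setUv setTI.
  have : \int[P]_(w in (fun w => (X w, Z w)) @^-1` S) K (Z w) B +
      \int[P]_(w in ~` ((fun w => (X w, Z w)) @^-1` S)) K (Z w) B = P (Y @^-1` B).
    rewrite -ge0_integral_setU//.
    + by rewrite setUv PY.
    + exact: mpre.
    + by apply: measurableC; exact: mpre.
    + by apply: measurable_funTS.
    + by apply/disj_setPCl.
  rewrite -IH; set p := P _; set i := \int[P]_(w in _) _; set q := P (_ `&` _).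
  move=> <- h.
  have pf : p \is a fin_num.
    rewrite ge0_fin_numE; last exact: measure_ge0.
    apply: (@le_lt_trans _ _ (P (Y @^-1` B))).
      apply: le_measure; rewrite ?inE//; last exact: mpreY.
      by apply: measurableI; [exact: mpre|exact: mpreY].
    by rewrite -ge0_fin_numE.
  by rewrite -(addeK q pf) (addeC q) h (addeC p) addeK.
- move=> F mF tF IH; rewrite preimage_bigcup setI_bigcupl.
  have tF' : trivIset setT (fun k => (fun w => (X w, Z w)) @^-1` F k).
    by apply/trivIsetP => i j _ _ ij; move/trivIsetP: tF => /(_ i j I I ij) FE;
      rewrite -preimage_setI FE preimage_set0.
  rewrite measure_bigcup//; last 2 first.
  + by move=> k _; apply: measurableI; [exact: mpre|exact: mpreY].
  + apply/trivIsetP => i j _ _ ij; move/trivIsetP: tF' => /(_ i j I I ij) FE.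
    by rewrite setIACA FE set0I.
  rewrite ge0_integral_bigcup//.
  + transitivity (\sum_(0 <= k <oo)
        P ((fun w => (X w, Z w)) @^-1` F k `&` Y @^-1` B)).
      by apply: eq_eseriesl => k; rewrite in_setT.
    by apply: eq_eseriesr => k _; rewrite IH.
  + by move=> k; exact: mpre.
  + exact: measurable_funTS.
Qed.

End cond_indep_kernel.

Section probability_integral_transform.
Local Open Scope ereal_scope.
Context (R : realType).

Lemma measure_gt_unique (m1 m2 : {measure set R -> \bar R}) :
  m1 setT < +oo -> (forall u : R, m1 `]u, +oo[%classic = m2 `]u, +oo[%classic) ->
  forall A, measurable A -> m1 A = m2 A.
Proof.
move=> m1f m12.
apply: (@measure_unique _ R R (@RGenOInfty.G R) (fun k => `](- k%:R)%R, +oo[%classic)).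
- exact: (@RGenOInfty.measurableE R).
- move=> _ _ [x ->] [y ->]; exists (Num.max x y).
  by apply/seteqP; split => z /=; rewrite !in_itv/= !andbT gt_max => /andP.
- by move=> k; exists (- k%:R)%R.
- apply/seteqP; split => // x _; exists (Num.truncn `|x|%R).+1 => //=.
  rewrite in_itv/= andbT ltrNl (le_lt_trans (ler_norm _))// normrN.
  exact: truncnS_gt.
- by move=> _ [u ->].
- by move=> k; apply: le_lt_trans m1f; apply: le_measure; rewrite ?inE.
Qed.

Lemma unif01_gt (u : R) : unif01 R `]u, +oo[%classic =
  if (u <= 0)%R then 1 else if (u <= 1)%R then (1 - u)%:E else 0.
Proof.
rewrite /unif01 /distribution /pushforward/= /uniform_prob.
rewrite (_ : @to_real R @^-1` _ = `]u, +oo[%classic)//.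
rewrite integral_uniform_pdf.
rewrite (eq_integral (fun=> 1)); last first.
  move=> x; rewrite inE => -[_]/=; rewrite in_itv/= => x01.
  by rewrite /uniform_pdf x01 subr0 invr1.
rewrite (_ : `]u, +oo[%classic `&` _ =
   [set` Interval (if (u < 0)%R then BLeft 0%R else BRight u) (BRight 1%R)]); last first.
  apply/seteqP; split => x /=; rewrite !in_itv/= !andbT.
    by case: ifPn => u0; move=> [ux /andP[x0 x1]]; rewrite /= ?x0 ?ux x1.
  case: ifPn => u0 /= /andP[a b].
    by rewrite b a (lt_le_trans u0).
  by rewrite b a ltW// (le_lt_trans _ a)// leNgt.
rewrite integral_cst//= mul1e.
case: ifPn => u0; rewrite lebesgue_measure_itv/= ?lte_fin.
  by rewrite ltr01 (ltW u0) -EFinB subr0.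
have [u0'|u0'] := leP u 0%R.
  have -> : u = 0%R by apply/eqP; rewrite eq_le u0' leNgt.
  by rewrite ltr01 -EFinB subr0.
by case: ltgtP => // <-; rewrite subrr.
Qed.

Variable m : {measure set R -> \bar R}.
Hypothesis m01 : m `[0%R, 1%R]%classic = 1.
Hypothesis mT : m setT = 1.
Let F (t : R) : R := fine (m `]-oo, t]%classic).
Hypothesis cF : continuous F.

Lemma total_le1 (A : set R) : measurable A -> m A <= 1.
Proof.
move=> mA; apply: (@le_trans _ _ (m setT)); last by rewrite mT.
by apply: le_measure; rewrite ?inE.
Qed.

Lemma cdfE t : m `]-oo, t]%classic = (F t)%:E.
Proof.
by rewrite fineK// ge0_fin_numE// (le_lt_trans (total_le1 _))// ltry.
Qed.

Lemma cdf_le_homo : {homo F : s t / (s <= t)%R}.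
Proof.
move=> s t st; rewrite -lee_fin -!cdfE; apply: le_measure; rewrite ?inE//.
by move=> x /=; rewrite !in_itv/= => /le_trans; apply.
Qed.

Lemma cdf_bounds t : (0 <= F t <= 1)%R.
Proof.
by rewrite -!lee_fin -cdfE measure_ge0 /= total_le1.
Qed.

Let mC : m (~` `[0%R, 1%R]%classic) = 0.
Proof.
have : m setT = m `[0%R, 1%R]%classic + m (~` `[0%R, 1%R]%classic).
  rewrite -measureU ?setUv//; first exact: measurableC.
  by rewrite setICr.
rewrite mT m01; set x := m _.
by case: x => [r||]//; rewrite -EFinD => -[h]; congr EFin; lra.
Qed.

Lemma cdf_lt0 t : (t < 0)%R -> F t = 0%R.
Proof.
move=> t0; suff : m `]-oo, t]%classic = 0 by rewrite /F => ->.
apply/eqP; rewrite eq_le measure_ge0 andbT -mC; apply: le_measure; rewrite ?inE//.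
  exact: measurableC.
by move=> x /=; rewrite !in_itv/= => xt /andP[x0 _]; move: (le_lt_trans x0 (le_lt_trans xt t0)); rewrite ltxx.
Qed.

Lemma cdf0 : F 0%R = 0%R.
Proof.
apply/eqP; rewrite eq_le; have /andP[-> _] := cdf_bounds 0%R; rewrite andbT.
have cv : F x @[x --> 0%R^'-] --> F 0%R by apply: cvg_at_left_filter; exact: cF.
have c0 : F x @[x --> 0%R^'-] --> 0%R.
  by apply: cvg_near_cst; near=> x; rewrite cdf_lt0.
by rewrite (cvg_unique (@norm_hausdorff _ R^o) cv c0).
Unshelve. all: by end_near. Qed.

Lemma cdf1 : F 1%R = 1%R.
Proof.
apply: EFin_inj; rewrite -cdfE; apply/eqP; rewrite eq_le; apply/andP; split.
  by rewrite -mT; apply: le_measure; rewrite ?inE.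
rewrite -m01; apply: le_measure; rewrite ?inE//.
by move=> x /=; rewrite !in_itv/= => /andP[].
Qed.

Lemma cdf_surj u : (0 <= u <= 1)%R -> exists2 t, (0 <= t <= 1)%R & F t = u.
Proof.
move=> u01; have [||t t01 <-] := @IVT R F 0%R 1%R u ler01.
- exact: continuous_subspaceT.
- by rewrite cdf0 cdf1 min_l ?max_r.
- by exists t => //; move: t01; rewrite in_itv.
Qed.

Lemma measurable_cdf : measurable_fun setT F.
Proof. by apply: nondecreasing_measurable => //; exact: cdf_le_homo. Qed.

Let mFle (u : R) : measurable [set t | (F t <= u)%R].
Proof.
rewrite (_ : [set _ | _] = F @^-1` `]-oo, u]%classic); last by apply/seteqP; split => x /=; rewrite in_itv.
by rewrite -[X in measurable X]setTI; exact: measurable_cdf.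
Qed.

(** The set where F is at most u contains the half-line that ends at a solution
    of F t = u, and is contained in the half-lines that end at solutions of
    F t = v with v > u; F may be flat, so it need not be equal to any of them. *)
Lemma cdf_le_measure (u : R) : (0 <= u <= 1)%R -> m [set t | (F t <= u)%R] = u%:E.
Proof.
move=> /andP[u0 u1]; apply/eqP; rewrite eq_le; apply/andP; split.
  have [->|un1] := eqVneq u 1%R.
    by rewrite -mT; apply: le_measure; rewrite ?inE.
  have u1' : (u < 1)%R by rewrite lt_neqAle un1.
  apply/lee_addgt0Pr => e e0; pose v := Num.min (u + e)%R 1%R.
  have uv : (u < v)%R by rewrite lt_min ltrDl e0.
  have [|t _ Ft] := @cdf_surj v.
    by rewrite (le_trans u0 (ltW uv)) ge_min lexx orbT.
  apply: (@le_trans _ _ (m `]-oo, t]%classic)).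
    apply: le_measure; rewrite ?inE// => x /= Fx; rewrite in_itv/= leNgt.
    apply/negP => /ltW/cdf_le_homo; rewrite Ft => vF.
    by move: (lt_le_trans uv (le_trans vF Fx)); rewrite ltxx.
  by rewrite cdfE Ft lee_fin ge_min lexx.
have [t _ Ft] := @cdf_surj u (introT andP (conj u0 u1)).
rewrite -Ft -cdfE; apply: le_measure; rewrite ?inE//.
by move=> x /=; rewrite in_itv/= => /cdf_le_homo.
Qed.

Lemma probability_integral_transform (D : set R) : measurable D ->
  m (F @^-1` D) = unif01 R D.
Proof.
move=> mD; apply/esym; move: D mD.
have E u : m (F @^-1` `]u, +oo[%classic) = unif01 R `]u, +oo[%classic.
  have -> : F @^-1` `]u, +oo[%classic = ~` [set t | (F t <= u)%R].
    by apply/seteqP; split => x /=; rewrite in_itv/= andbT ltNge => /negP.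
  have Cm : m [set t | (F t <= u)%R] + m (~` [set t | (F t <= u)%R]) = 1.
    rewrite -measureU ?setUv//; first exact: measurableC.
    by rewrite setICr.
  rewrite unif01_gt; have [u0|u0] := leP u 0%R.
    have -> : ~` [set t | (F t <= u)%R] = setT `\` [set t | (F t <= u)%R] by rewrite setTD.
    have z : m [set t | (F t <= u)%R] = 0.
      have := @cdf_le_measure 0%R; rewrite lexx ler01 => /(_ isT) z0.
      have : m [set t | (F t <= u)%R] <= m [set t | (F t <= 0)%R].
        by apply: le_measure; rewrite ?inE// => x /= /le_trans; apply.
      by rewrite z0 => z1; apply/eqP; rewrite eq_le z1 measure_ge0.
    by rewrite setTD; move: Cm; rewrite z add0e.
  have [u1|u1] := leP u 1%R.
    have := @cdf_le_measure u; rewrite u1 (ltW u0) => /(_ isT) z.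
    move: Cm; rewrite z; case: (m _) => [r||]//; rewrite -EFinD => -[] <-.
    by rewrite addrC addKr.
  have -> : ~` [set t | (F t <= u)%R] = set0; last by rewrite measure0.
  apply/seteqP; split => // x /=; apply.
  by have /andP[_ /le_trans] := cdf_bounds x; apply; exact: ltW.
apply: (@measure_gt_unique (unif01 R) (pushforward m F)).
- exact: measurable_cdf.
- apply: (le_lt_trans (probability_le1 (unif01 R) measurableT)); exact: ltry.
- by move=> ? u; rewrite [RHS]E.
Qed.

End probability_integral_transform.

Section conditional_rank.
Local Open Scope ereal_scope.
Context d (T : measurableType d) dE (E : measurableType dE)
  dG (G : measurableType dG) (R : realType).
Variables (P : probability T R) (X : T -> E) (Y : T -> R) (Z : T -> G).
Hypotheses (mX : measurable_fun setT X) (mY : measurable_fun setT Y)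
  (mZ : measurable_fun setT Z).
Variables (K : R.-pker G ~> R) (good : set G).
Hypotheses (mgood : measurable good) (Pgood : P (Z @^-1` (~` good)) = 0).
Hypotheses (K01 : forall z, good z -> K z `[0%R, 1%R]%classic = 1)
  (Kcont : forall z, good z -> continuous (fun t => fine (K z `]-oo, t]%classic))).

(** The rank of y among the values drawn from the kernel at z, uncurried so that
    its measurability in the pair can be stated. *)
Definition kernel_cdf (p : R * G) : R := fine (K p.2 `]-oo, p.1]%classic).

Lemma measurable_kernel_cdf : measurable_fun setT kernel_cdf.
Proof.
apply: measurableT_comp => //.
pose Q : set ((R * G) * R) := [set p | (p.2 <= p.1.1)%R].
have mQ : measurable Q.
  rewrite (_ : Q = (fun p => (p.1.1 - p.2)%R) @^-1` `[0%R, +oo[%classic); last first.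
    by apply/seteqP; split => p; rewrite /Q /= in_itv/= andbT subr_ge0.
  rewrite -[X in measurable X]setTI.
  have mm : measurable_fun setT (fun p : (R * G) * R => (p.1.1 - p.2)%R).
    by apply: measurable_funB => //; exact: (measurableT_comp measurable_fst).
  exact: mm.
have := measurable_kernel_xsection (g := snd) K measurable_snd mQ.
congr measurable_fun; apply/funext => a; congr (K _ _).
by apply/seteqP; split => y; rewrite xsectionE /= in_itv.
Qed.

(** For almost every value (x, z) of (X, Z), the response is still drawn from
    the continuous law K z, and the rank of a draw from a continuous law is
    uniform whatever the law; as the answer does not depend on (x, z), the rank
    is independent of (X, Z). *)
Lemma conditional_rank_uniform S D : cond_indep P X Y Z -> cond_dist P Y Z K ->
  measurable S -> measurable D ->
  P ((fun w => (X w, Z w)) @^-1` S `&` (fun w => kernel_cdf (Y w, Z w)) @^-1` D) =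
  P ((fun w => (X w, Z w)) @^-1` S) * unif01 R D.
Proof.
move=> ci hK mS mD.
have mXZ : measurable_fun setT (fun w => (X w, Z w)) by exact: measurable_fun_pair.
pose Q : set ((E * G) * R) := [set p | S p.1 /\ D (kernel_cdf (p.2, p.1.2))].
have mQ : measurable Q.
  rewrite (_ : Q = fst @^-1` S `&` (fun p => kernel_cdf (p.2, p.1.2)) @^-1` D)//.
  apply: measurableI.
    by rewrite -[X in measurable X]setTI; exact: measurable_fst.
  rewrite -[X in measurable X]setTI.
  have mm : measurable_fun setT (fun p : (E * G) * R => kernel_cdf (p.2, p.1.2)).
    apply: (measurableT_comp measurable_kernel_cdf); apply: measurable_fun_pair => //.
    exact: (measurableT_comp measurable_snd).
  exact: mm.
have H S' B : measurable S' -> measurable B ->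
    P ((fun w => (X w, Z w)) @^-1` S' `&` Y @^-1` B) =
    \int[P]_(w in (fun w => (X w, Z w)) @^-1` S') K (Z w) B.
  by move=> mS' mB; exact: cond_indep_kernel.
have D1 := disintegration (g := snd) measurable_snd mXZ mY H mQ.
rewrite [LHS](_ : _ = P [set w | Q ((X w, Z w), Y w)])// D1.
have mSX : measurable ((fun w => (X w, Z w)) @^-1` S).
  by rewrite -[X in measurable X]setTI; exact: (mXZ measurableT _ mS).
transitivity (\int[P]_w ((\1_((fun w => (X w, Z w)) @^-1` S) w)%:E * unif01 R D)).
  apply: ge0_ae_eq_integral => //.
  - by apply: (measurableT_comp (measurable_kernel_xsection (g := snd) K measurable_snd mQ)).
  - by apply: emeasurable_funM => //; apply/measurable_EFinP; exact: measurable_indic.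
  - by move=> w _; rewrite mule_ge0// lee_fin.
  - exists (Z @^-1` (~` good)); split => //.
      by rewrite -[X in measurable X]setTI; apply: mZ => //; exact: measurableC.
    move=> w /= nw gz; apply: nw => _; rewrite indicE.
    have [|] := boolP (w \in _ @^-1` S).
      rewrite inE /= => Sw; rewrite mul1e.
      rewrite -(@probability_integral_transform R (K (Z w)))//; last 3 first.
      + exact: K01.
      + exact: prob_kernel.
      + exact: Kcont.
      by congr (K _ _); apply/seteqP; split => y; rewrite xsectionE /Q/= => // -[].
    rewrite notin_setE /= => nS; rewrite mul0e -(measure0 (K (Z w))).
    by congr (K _ _); apply/seteqP; split => y //; rewrite xsectionE /Q/= => -[/nS].
under eq_integral do rewrite muleC.
rewrite ge0_integralZl//; last by apply/measurable_EFinP; exact: measurable_indic.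
by rewrite integral_indic// setIT muleC.
Qed.

Lemma ge0_integral_conditional_rank (f : (E * G) * R -> \bar R) :
  cond_indep P X Y Z -> cond_dist P Y Z K ->
  measurable_fun setT f -> (forall p, 0 <= f p) ->
  \int[P]_w f ((X w, Z w), kernel_cdf (Y w, Z w)) =
  \int[P]_w \int[unif01 R]_u f ((X w, Z w), u).
Proof.
move=> ci hK mf f0.
have mXZ : measurable_fun setT (fun w => (X w, Z w)) by exact: measurable_fun_pair.
have mU : measurable_fun setT (fun w => kernel_cdf (Y w, Z w)).
  by apply: (measurableT_comp measurable_kernel_cdf); exact: measurable_fun_pair.
have mXZU : measurable_fun setT (fun w => ((X w, Z w), kernel_cdf (Y w, Z w))).
  exact: measurable_fun_pair.
pose XZ : {mfun T >-> (E * G)%type} := mfun_Sub (mem_set mXZ).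
pose XZU : {mfun T >-> ((E * G) * R)%type} := mfun_Sub (mem_set mXZU).
have eqm A : measurable A ->
    product_prob (distribution P XZ) (unif01 R) A = distribution P XZU A.
  move: A; apply: product_measure_unique => S D mS mD.
  rewrite [LHS](_ : _ = P ((fun w => (X w, Z w)) @^-1` S `&`
    (fun w => kernel_cdf (Y w, Z w)) @^-1` D))//.
  exact: conditional_rank_uniform.
transitivity (\int[distribution P XZU]_p f p).
  by rewrite ge0_integral_distribution.
transitivity (\int[product_prob (distribution P XZ) (unif01 R)]_p f p).
  by apply: eq_measure_integral => A mA _; exact/esym/eqm.
rewrite ge0_integral_product_prob//.
rewrite ge0_integral_distribution//.
  exact: measurable_fun_fubini_tonelli_F.
by move=> x; apply: integral_ge0.
Qed.

End conditional_rank.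

(** * Square roots of positive semidefinite matrices *)

Lemma poly_interpolation (F : fieldType) (rs : seq F) (h : F -> F) :
  exists p : {poly F}, {in rs, forall r, p.[r] = h r}.
Proof.
elim: rs => [|r rs [p hp]]; first by exists 0.
have [rrs|rrs] := boolP (r \in rs).
  by exists p => s; rewrite inE => /predU1P[->|]; exact: hp.
pose w := \prod_(s <- rs) ('X - s%:P).
have w0 s : s \in rs -> w.[s] = 0.
  by move=> srs; apply/rootP; rewrite root_prod_XsubC.
have wr : w.[r] != 0 by apply: contra rrs; rewrite -root_prod_XsubC => /eqP/rootP.
exists (p + ((h r - p.[r]) / w.[r]) *: w) => s; rewrite inE hornerD hornerZ.
case/predU1P => [->|srs]; first by rewrite divfK// subrKC.
by rewrite (w0 s srs) mulr0 addr0 hp.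
Qed.

Lemma trmx_horner_mx (F : comNzRingType) n (A : 'M[F]_n.+1) p :
  (horner_mx A p)^T = horner_mx A^T p.
Proof.
elim/poly_ind: p => [|p c IH]; first by rewrite !rmorph0 trmx0.
rewrite !(rmorphD, rmorphM)/= !horner_mx_X !horner_mx_C linearD/= tr_scalar_mx.
congr (_ + _); rewrite -[LHS]/((horner_mx A p *m A)^T) trmx_mul IH.
exact: comm_mx_horner.
Qed.

Section psd_square_root.
Variables (R : realType) (n : nat) (A : 'M[R]_n.+1).
Hypotheses (symA : A^T = A)
  (posA : forall v : 'cV[R]_n.+1, 0 <= (v^T *m A *m v) ord0 ord0).

Let f := real_complex R.
Let fA := map_mx f A.

Lemma psd_eigenvalue_ge0 r : eigenvalue A r -> 0 <= r.
Proof.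
move=> /eigenvalueP[v vA v0]; have := posA v^T; rewrite trmxK vA -scalemxAl mxE.
rewrite pmulr_lge0// mxE; under eq_bigr do rewrite mxE -expr2.
rewrite lt_neqAle sumr_ge0// ?andbT; last by move=> i _; exact: sqr_ge0.
apply: contra v0; rewrite eq_sym psumr_eq0; last by move=> i _; exact: sqr_ge0.
move=> /allP v0; apply/eqP/rowP => i; rewrite mxE; apply/eqP.
by rewrite -sqrf_eq0; exact: v0 (mem_index_enum i).
Qed.

(** The spectral theorem over the complex numbers: A is unitarily similar to a
    diagonal matrix with real entries, which are eigenvalues of A, so that a
    real polynomial annihilates A as soon as it vanishes at these. *)
Lemma psd_horner_mx_eq0 : exists2 rs : seq R, (forall r, r \in rs -> 0 <= r) &
  forall p : {poly R}, (forall r, r \in rs -> p.[r] = 0) -> horner_mx A p = 0.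
Proof.
have hA : fA \is hermsymmx.
  apply: realsym_hermsym.
    apply/is_hermitianmxP; rewrite expr0 scale1r map_mx_id//.
    by rewrite /fA map_trmx symA.
  by apply/mxOverP => i j; rewrite mxE; apply/complex_realP; exists (A i j).
have /orthomx_spectralP fAE := hermitian_normalmx hA.
have /mxOverP rD := hermitian_spectral_diag_real hA.
set P := spectralmx fA in fAE; set D := spectral_diag fA in fAE rD.
have Pu : P \is a GRing.unit by exact: spectral_unit.
have DE i : D 0 i = f (complex.Re (D 0 i)) by rewrite /f RRe_real.
exists [seq complex.Re (D 0 i) | i : 'I_n.+1] => [r /mapP[i _ ->]|p p0].
  apply: psd_eigenvalue_ge0; suff : eigenvalue fA (D 0 i) by rewrite DE eigenvalue_map.
  apply/eigenvalueP; exists (row i P); last first.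
    apply: contraTneq (Pu) => Pi0; rewrite -row_free_unit.
    by apply/negP => /row_freeP[B] /(congr1 (row i)); rewrite row_mul Pi0 mul0mx
      => /rowP/(_ i); rewrite !mxE eqxx => /eqP; rewrite eq_sym oner_eq0.
  rewrite -row_mul -/fA fAE !mulmxA mulmxV// mul1mx row_mul row_diag_mx -scalemxAl.
  by rewrite -rowE.
apply/eqP; rewrite -(map_mx_eq0 f); apply/eqP.
rewrite map_horner_mx -/fA fAE horner_mx_uconjC// horner_mx_diag.
rewrite (_ : map_mx _ D = 0) ?linear0 ?mulmx0 ?mul0mx//.
apply/rowP => i; rewrite !mxE DE horner_map/= p0 ?rmorph0//.
by apply/mapP; exists i => //; rewrite mem_enum.
Qed.

(** A polynomial C in A that takes the fourth roots of the eigenvalues as its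
    values is symmetric, so its square is visibly positive, and is a square root
    of A. *)
Lemma psd_sqrtmx_exists : exists B : 'M[R]_n.+1, psd B /\ B *m B = A.
Proof.
have [rs rs0 hrs] := psd_horner_mx_eq0.
have [p hp] := poly_interpolation rs (fun r => Num.sqrt (Num.sqrt r)).
pose C := horner_mx A p; have CT : C^T = C by rewrite trmx_horner_mx symA.
exists (C *m C); split; last first.
  rewrite -[LHS]/((C * C) * (C * C)) -[RHS](horner_mx_X A) /C -!rmorphM /=.
  apply/eqP; rewrite -subr_eq0 -rmorphB; apply/eqP/hrs => r rrs.
  rewrite hornerD hornerN hornerX !hornerM hp// -!expr2 (sqr_sqrtr (sqrtr_ge0 _)).
  by rewrite sqr_sqrtr ?rs0// subrr.
split=> [|v]; first by rewrite trmx_mul CT.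
rewrite mulmxA -mulmxA -{1}CT -trmx_mul mxE sumr_ge0// => i _.
by rewrite mxE -expr2 sqr_ge0.
Qed.

End psd_square_root.

(** The definition of the square root by choice is meaningful on positive
    semidefinite matrices; the empty matrix is handled apart because matrix
    polynomials require a nontrivial ring. *)
Lemma sqrtmxP (R : realType) q (A : 'M[R]_q) : psd A ->
  psd (sqrtmx A) /\ sqrtmx A *m sqrtmx A = A.
Proof.
case: q A => [|n] A [symA posA]; rewrite /sqrtmx.
  apply: (@xgetPex _ 0 [set B : 'M[R]_0 | psd B /\ B *m B = A]).
  by exists A; split=> //; apply/matrixP; case.
apply: (@xgetPex _ 0 [set B : 'M[R]_n.+1 | psd B /\ B *m B = A]).
exact: psd_sqrtmx_exists.
Qed.

(** * Orthonormalized scores *)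

Section uniform_mean.
Context (R : realType).

Lemma ge0_integral_unif01 (f : R -> \bar R) :
  measurable_fun setT f -> (forall u, 0 <= f u)%E ->
  (\int[unif01 R]_u f u = \int[lebesgue_measure]_(u in `[0%R, 1%R]) f u)%E.
Proof.
move=> mf f0; rewrite /unif01 ge0_integral_distribution//.
have mf' : measurable_fun setT (f \o @to_real R).
  exact: (measurableT_comp mf (@measurable_to_real R)).
rewrite integral_uniform//.
by rewrite subr0 invr1 mul1e.
Qed.

Lemma has_mean_unif01 (f : R -> R) (B : R) : measurable_fun setT f ->
  (forall u, `|f u| <= B) ->
  has_mean (unif01 R) f (\int[lebesgue_measure]_(u in `[0, 1]) f u).
Proof.
move=> mf fB; have [r [fi fr] _] := has_mean_bounded (unif01 R) mf fB.
rewrite (_ : \int[lebesgue_measure]_(u in `[0, 1]) f u = r)//.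
rewrite /Rintegral -[RHS]/(fine r%:E) -fr; congr fine.
have mf' : measurable_fun setT (EFin \o f) by exact/measurable_EFinP.
rewrite integralE [RHS]integralE !ge0_integral_unif01//.
- exact: measurable_funeneg.
- exact: measurable_funepos.
Qed.

Lemma unif01_itv (a b : R) : 0 <= a -> a < b -> b <= 1 ->
  ((b - a)%:E <= unif01 R `]a, b]%classic)%E.
Proof.
move=> a0 ab b1.
have : (unif01 R `]a, +oo[%classic <= unif01 R `]a, b]%classic + unif01 R `]b, +oo[%classic)%E.
  by apply: le_measureU => // x /=; rewrite !in_itv/= !andbT => ax;
    have [xb|xb] := leP x b; [left; rewrite ax|right].
set p := unif01 R `]a, b]%classic; rewrite !unif01_gt b1 (le_trans (ltW ab) b1) [(b <= 0)%R]leNgt (le_lt_trans a0 ab)/=.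
case: ifPn => [a0'|_].
  have -> : a = 0 by apply/eqP; rewrite eq_le a0' a0.
  by rewrite subr0; move: (p) => [r| |]; rewrite ?leey -?EFinD ?lee_fin //; lra.
by move: (p) => [r| |]; rewrite ?leey -?EFinD ?lee_fin //; lra.
Qed.

End uniform_mean.

Section scores.
Context (R : realType) (q : nat) (phi : 'I_q -> R -> R).
Hypothesis hphi : is_score phi.

Lemma score_out k u : ~~ (0 < u < 1) -> phi k u = 0.
Proof.
have [hs _ _ _ _] := hphi; have [_ sub] := hs k.
apply: contraNeq => pu; have : supp phi k u by apply: subset_closure.
by move/sub; rewrite /= in_itv.
Qed.

(** The Lipschitz bound on the unit interval extends to the line because the
    scores vanish at the end points and outside: clamping the argument to the
    interval does not change their values. *)
Lemma score_lipschitz : exists2 L, 0 < L &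
  forall k u v, `|phi k u - phi k v| <= L * `|u - v|.
Proof.
have [_ hl _ _ _] := hphi.
have /choice[L hL] k : exists L, 0 < L /\ forall u v, 0 <= u <= 1 -> 0 <= v <= 1 ->
    `|phi k u - phi k v| <= L * `|u - v|.
  have := hl k; rewrite /lipschitz_on => /pinfty_ex_gt0[L L0 h].
  by exists L; split=> // u v u01 v01; apply: (h (u, v)); split => /=; rewrite in_itv.
have L0 : 0 <= \sum_k L k by rewrite sumr_ge0// => k _; rewrite ltW//; case: (hL k).
exists (1 + \sum_k L k) => [|k u v]; first lra.
pose cl (x : R) := Num.max 0 (Num.min x 1).
have cl01 x : 0 <= cl x <= 1.
  by rewrite /cl le_max lexx ge_max ler01 ge_min lexx orbT.
have phicl x : phi k x = phi k (cl x).
  rewrite /cl; have [x0|x0] := ltP x 0.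
    rewrite (min_idPl _) ?(max_idPl _) ?score_out ?ltxx// ?ltW//; last lra.
    by rewrite ltNge (ltW x0).
  have [x1|x1] := leP x 1; first by rewrite (max_idPr _).
  by rewrite (max_idPr _)// !score_out ?ltxx ?andbF// [x < 1]ltNge (ltW x1) andbF.
have clL x y : `|cl x - cl y| <= `|x - y|.
  have := ler_norm (x - y); have := ler_norm (y - x); rewrite (distrC y x).
  rewrite /cl !minEle !maxEle ler_norml; case: (leP x 1) => ?; case: (leP y 1) => ?;
    rewrite ?ler01; try case: (leP 0 x) => ?; try case: (leP 0 y) => ?;
    move=> ? ?; apply/andP; split; lra.
rewrite (phicl u) (phicl v).
have [_ h] := hL k; apply: (le_trans (h _ _ (cl01 u) (cl01 v))).
apply: ler_pM => //; first by rewrite ltW//; case: (hL k).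
rewrite (bigD1 k)//=.
have : 0 <= \sum_(i < q | i != k) L i by rewrite sumr_ge0// => i _; rewrite ltW//; case: (hL i).
lra.
Qed.

Lemma lipschitz_measurable (f : R -> R) L : 0 < L ->
  (forall u v, `|f u - f v| <= L * `|u - v|) -> measurable_fun setT f.
Proof.
move=> L0 fL; apply: continuous_measurable_fun => x.
apply/cvgrPdist_le => e e0; near=> y; apply: (le_trans (fL _ _)).
rewrite -ler_pdivlMl//; near: y.
by apply: (@cvgr_dist_le _ R^o); [exact: cvg_id|rewrite mulr_gt0// invr_gt0].
Unshelve. all: by end_near. Qed.

Lemma measurable_score k : measurable_fun setT (phi k).
Proof. by have [L L0 hL] := score_lipschitz; exact: (lipschitz_measurable L0). Qed.

Lemma score_bounded : exists2 B, 0 < B & forall k u, `|phi k u| <= B.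
Proof.
have [L L0 hL] := score_lipschitz; exists L => // k u.
have [u01|u01] := boolP (0 < u < 1); last by rewrite score_out// normr0 ltW.
have := hL k u 0; rewrite (@score_out k 0) ?ltxx// !subr0 => /le_trans; apply.
by rewrite gtr0_norm; case/andP: u01 => // u0 u1; rewrite ler_piMr ?ltW.
Qed.

Lemma has_mean_score k : has_mean (unif01 R) (phi k) 0.
Proof.
have [B B0 hB] := score_bounded; have [_ _ h0 _ _] := hphi.
by have := has_mean_unif01 (measurable_score k) (hB k); rewrite h0.
Qed.

Lemma has_mean_scoreM k s :
  has_mean (unif01 R) (fun u => phi k u * phi s u) (Sigma phi k s).
Proof.
have [B B0 hB] := score_bounded; rewrite mxE.
apply: (@has_mean_unif01 _ _ (B * B)) => [|u].
  by apply: measurable_funM; exact: measurable_score.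
by rewrite normrM ler_pM.
Qed.

Lemma has_mean_score_comb (c e : 'I_q -> R) : has_mean (unif01 R)
  (fun u => (\sum_k c k * phi k u) * (\sum_s e s * phi s u))
  (\sum_k \sum_s c k * Sigma phi k s * e s).
Proof.
apply: has_mean_ext (has_mean_sum (fun k => has_mean_sum (fun s =>
  has_meanZ (c k * e s) (has_mean_scoreM k s)))) => [u|].
  rewrite mulr_suml; apply: eq_bigr => k _; rewrite mulr_sumr.
  by apply: eq_bigr => s _; ring.
by apply: eq_bigr => k _; apply: eq_bigr => s _; ring.
Qed.

Lemma Sigma_sym : (Sigma phi)^T = Sigma phi.
Proof.
apply/matrixP => i j; rewrite !mxE; congr Rintegral.
by apply/funext => u; rewrite mulrC.
Qed.

Lemma quadratic_Sigma (v : 'cV[R]_q) :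
  has_mean (unif01 R) (fun u => (\sum_k v k 0 * phi k u) ^+ 2)
    ((v^T *m Sigma phi *m v) 0 0).
Proof.
apply: has_mean_ext (has_mean_score_comb (v^~ 0) (v^~ 0)) => //.
rewrite mxE exchange_big/=; apply: eq_bigr => s _; rewrite mxE mulr_suml.
by apply: eq_bigr => k _; rewrite [v^T _ _]mxE.
Qed.

Lemma Sigma_psd : psd (Sigma phi).
Proof.
split=> [|v]; first exact: Sigma_sym.
apply: has_mean_le (has_mean_cst _ 0) (quadratic_Sigma v) _ => u.
exact: sqr_ge0.
Qed.

(** A combination of scores is continuous, so where it does not vanish it stays
    away from zero on an interval and has positive second moment; and the
    scores are linearly independent. *)
Lemma Sigma_definite (v : 'cV[R]_q) : (v^T *m Sigma phi *m v) 0 0 = 0 -> v = 0.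
Proof.
move=> v0; have [_ _ _ _ free] := hphi.
suff h u : 0 <= u <= 1 -> \sum_k v k 0 * phi k u = 0.
  by apply/colP => k; rewrite mxE; exact: (free _ h k).
move=> /andP[u0 u1]; apply/eqP/negPn/negP => fu0.
set f := fun u => \sum_k v k 0 * phi k u in fu0 *.
have [L L0 hL] := score_lipschitz.
pose M := 1 + \sum_k `|v k 0| * L.
have M0 : 0 < M by rewrite ltr_pwDl// sumr_ge0// => k _; rewrite mulr_ge0// ltW.
have fM x y : `|f x - f y| <= M * `|x - y|.
  rewrite /f -sumrB; apply: (le_trans (ler_norm_sum _ _ _)).
  rewrite mulrDl mul1r mulr_suml ler_wpDl// ler_sum// => k _.
  by rewrite -mulrBr normrM -mulrA ler_wpM2l.
pose c := `|f u|; have c0 : 0 < c by rewrite normr_gt0.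
pose dl := Num.min (c / (2 * M)) (2^-1).
have dl0 : 0 < dl by rewrite lt_min divr_gt0 ?mulr_gt0// invr_gt0 ltr0n.
have dlM : M * dl <= c / 2.
  have : dl <= c / (2 * M) by rewrite ge_min lexx.
  rewrite -(ler_pM2l M0) => /le_trans; apply.
  by rewrite le_eqVlt; apply/orP; left; apply/eqP; field; rewrite gt_eqF.
have dl2 : dl <= 2^-1 by rewrite ge_min lexx orbT.
have far x : `|x - u| <= dl -> (c / 2) ^+ 2 <= f x ^+ 2.
  move=> xu; rewrite -[leRHS]real_normK ?num_real// ler_sqr ?nnegrE//; last lra.
  have : `|f u - f x| <= c / 2.
    by apply: (le_trans (fM _ _)); rewrite distrC (le_trans _ dlM)// ler_pM2l.
  have : `|f u| - `|f x| <= `|f u - f x| by exact: lerB_dist.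
  rewrite -/c; lra.
have [a [b [a0 ab b1 abf]]] : exists a b, [/\ 0 <= a, a < b, b <= 1 &
    forall x, a < x <= b -> `|x - u| <= dl].
  have [u2|u2] := leP u 2^-1.
    exists u, (u + dl); split=> //; [lra|lra|].
    by move=> x /andP[ux xu]; rewrite gtr0_norm; lra.
  exists (u - dl), u; split=> //; [lra|lra|].
  by move=> x /andP[ux xu]; rewrite ler0_norm; lra.
have mJ : measurable (`]a, b] : set R) by exact: measurable_itv.
have hq := quadratic_Sigma v; rewrite v0 in hq.
have : (((c / 2) ^+ 2)%:E * unif01 R `]a, b]%classic <= 0%:E)%E.
  case: hq => _ <-; rewrite -[X in unif01 R X]setIT -integral_indic//.
  rewrite -ge0_integralZl//; last 2 first.
  - by apply/measurable_EFinP; exact: measurable_indic.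
  - by rewrite lee_fin sqr_ge0.
  apply: ge0_le_integral => //.
  - by move=> x _; rewrite mule_ge0 ?lee_fin ?sqr_ge0.
  - apply: emeasurable_funM => //; apply/measurable_EFinP; exact: measurable_indic.
  - apply/measurable_EFinP; apply: measurable_funX; apply: measurable_sum => k.
    by apply: measurable_funM => //; exact: measurable_score.
  - move=> x _; rewrite indicE -EFinM lee_fin.
    have [|_] := boolP (_ \in _); last by rewrite mulr0 sqr_ge0.
    by rewrite inE/= in_itv/= mulr1 => /abf; exact: far.
apply/negP; rewrite -ltNge.
apply: (@lt_le_trans _ _ (((c / 2) ^+ 2)%:E * (b - a)%:E)%E).
  by rewrite -EFinM lte_fin mulr_gt0// ?exprn_gt0 ?subr_gt0// divr_gt0.
by rewrite lee_wpmul2l ?lee_fin ?sqr_ge0//; exact: unif01_itv.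
Qed.

Definition whitening : 'M[R]_q := invmx (sqrtmx (Sigma phi)).

Lemma Sigma_unit : Sigma phi \in unitmx.
Proof.
rewrite -row_free_unit; apply/inj_row_free => v vS.
apply/trmx_inj; rewrite trmx0; apply: Sigma_definite.
by rewrite trmxK vS mul0mx mxE.
Qed.

Lemma whitening_sym : whitening^T = whitening.
Proof. by rewrite /whitening trmx_inv; have [[-> _] _] := sqrtmxP Sigma_psd. Qed.

Lemma whiteningK : whitening *m Sigma phi *m whitening = 1%:M.
Proof.
have [_ BB] := sqrtmxP Sigma_psd; rewrite /whitening -{2}BB.
have Bu : sqrtmx (Sigma phi) \in unitmx.
  by have := Sigma_unit; rewrite -{1}BB unitmx_mul => /andP[].
by rewrite mulKmx// mulmxV.
Qed.

(** The test statistic is built from the scores only through these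
    combinations, which are orthonormal. *)
Definition white_score (i : 'I_q) (u : R) : R := \sum_k whitening i k * phi k u.

Lemma has_mean_white_score i : has_mean (unif01 R) (white_score i) 0.
Proof.
apply: has_mean_ext (has_mean_sum (fun k =>
  has_meanZ (whitening i k) (has_mean_score k))) => //.
by rewrite big1// => k _; rewrite mulr0.
Qed.

Lemma has_mean_white_scoreM i j :
  has_mean (unif01 R) (fun u => white_score i u * white_score j u) (i == j)%:R.
Proof.
apply: has_mean_ext (has_mean_score_comb (whitening i) (whitening j)) => //.
transitivity ((whitening *m Sigma phi *m whitening^T) i j).
  rewrite mxE exchange_big/=; apply: eq_bigr => s _; rewrite !mxE mulr_suml.
  by apply: eq_bigr => k _.
by rewrite whitening_sym whiteningK mxE.
Qed.

Lemma white_score_lipschitz : exists2 L, 0 < L &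
  forall i u v, `|white_score i u - white_score i v| <= L * `|u - v|.
Proof.
have [L L0 hL] := score_lipschitz.
have S0 i : 0 <= \sum_k `|whitening i k| * L.
  by rewrite sumr_ge0// => k _; rewrite mulr_ge0// ltW.
exists (1 + \sum_i \sum_k `|whitening i k| * L).
  by rewrite ltr_pwDl// sumr_ge0.
move=> i u v; rewrite /white_score -sumrB; apply: (le_trans (ler_norm_sum _ _ _)).
apply: (@le_trans _ _ ((\sum_k `|whitening i k| * L) * `|u - v|)).
  rewrite mulr_suml ler_sum// => k _.
  by rewrite -mulrBr normrM -mulrA ler_wpM2l.
apply: ler_wpM2r => //; rewrite [X in _ <= 1 + X](bigD1 i)//=.
have : 0 <= \sum_(j < q | j != i) \sum_k `|whitening j k| * L by rewrite sumr_ge0.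
lra.
Qed.

Lemma white_score_out i u : ~~ (0 < u < 1) -> white_score i u = 0.
Proof. by move=> u01; rewrite /white_score big1// => k _; rewrite score_out// mulr0. Qed.

Lemma measurable_white_score i : measurable_fun setT (white_score i).
Proof. by have [L L0 hL] := white_score_lipschitz; exact: (lipschitz_measurable L0). Qed.

End scores.

(** * Estimated ranks *)

Section score_support.
Context (R : realType) (q : nat) (phi : 'I_q -> R -> R).
Hypotheses (hphi : is_score phi) (hq : (0 < q)%N).

Lemma supp_unionP u : (\bigcup_k supp phi k) u -> 0 < u < 1.
Proof.
by have [hs _ _ _ _] := hphi; move=> [k _ ku]; have [_ /(_ _ ku)] := hs k; rewrite /= in_itv.
Qed.

Lemma supp_union_neq0 : (\bigcup_k supp phi k) !=set0.
Proof.
have [hs _ _ h1 _] := hphi; pose k := Ordinal hq.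
have [|nz] := pselect (exists u, phi k u != 0).
  by move=> [u pu]; exists u; exists k => //; exact: subset_closure.
have := h1 k; rewrite (_ : \int[_]_(_ in _) _ = 0); first by move/eqP; rewrite eq_sym oner_eq0.
rewrite /Rintegral (eq_integral (fun=> 0%E)) ?integral0// => u _.
have [->|pu] := eqVneq (phi k u) 0; first by rewrite expr0n.
by exfalso; apply: nz; exists u.
Qed.

Lemma tau_min_bound u : phi ^~ u <> (fun=> 0) -> tau_min phi <= u <= tau_max phi.
Proof.
move=> pu; have [k ku] : exists k, phi k u != 0.
  apply: contrapT => h; apply: pu; apply/funext => k.
  by apply/eqP/negPn/negP => ku; apply: h; exists k.
have Su : (\bigcup_k supp phi k) u by exists k => //; exact: subset_closure.
apply/andP; split.
  apply: ge_inf => //; exists 0 => x /supp_unionP/andP[x0 _]; exact: ltW.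
apply: ub_le_sup => //; exists 1 => x /supp_unionP/andP[_ x1]; exact: ltW.
Qed.

Lemma tau_bounds : [/\ 0 <= tau_min phi, tau_min phi <= tau_max phi & tau_max phi <= 1].
Proof.
have [u Su] := supp_union_neq0.
split.
- by apply: lb_le_inf => [|x /supp_unionP/andP[/ltW]]; first by exists u.
- apply: (@le_trans _ _ u).
    by apply: ge_inf => //; exists 0 => x /supp_unionP/andP[/ltW].
  by apply: ub_le_sup => //; exists 1 => x /supp_unionP/andP[_ /ltW].
- by apply: ge_sup => [|x /supp_unionP/andP[_ /ltW]]; first by exists u.
Qed.

(** At the end points of the hull of the supports the scores vanish by
    continuity. *)
Lemma white_score_eq0 i u : ~~ (tau_min phi < u < tau_max phi) ->
  white_score phi i u = 0.
Proof.
have out v : ~~ (tau_min phi <= v <= tau_max phi) -> white_score phi i v = 0.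
  move=> hv; rewrite /white_score big1// => k _.
  have [->|pv] := eqVneq (phi k v) 0; first by rewrite mulr0.
  exfalso; move/negP: hv; apply; apply: tau_min_bound => p0.
  by move: pv; rewrite (congr1 (@^~ k) p0) eqxx.
have [L L0 hL] := white_score_lipschitz hphi.
have lim v : (forall e, 0 < e -> exists2 x, `|v - x| <= e &
    ~~ (tau_min phi <= x <= tau_max phi)) -> white_score phi i v = 0.
  move=> h; apply/eqP; rewrite -normr_le0; apply/ler_addgt0Pr => e e0.
  have [|x vx /out xo] := h (e / L); first by rewrite divr_gt0.
  have := hL i v x; rewrite xo subr0 add0r => /le_trans; apply.
  by rewrite -(ler_pM2l L0) mulrC in vx; rewrite mulrC (le_trans vx)// mulrC divfK// gt_eqF.
move=> hu; have [uin|/out//] := boolP (tau_min phi <= u <= tau_max phi).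
apply: lim => e e0; have [h|h] := leP u (tau_min phi).
  exists (u - e); first by rewrite opprB addrC subrK gtr0_norm.
  by rewrite negb_and -ltNge; apply/orP; left; lra.
exists (u + e); first by rewrite opprD addrA subrr add0r normrN gtr0_norm.
by rewrite negb_and -!ltNge; apply/orP; right; move: hu; rewrite h/= -leNgt; lra.
Qed.

End score_support.

Section quantiles.
Context (R : realType) (d : nat) (K : R.-pker covariate R d ~> R) (z : covariate R d).
Hypotheses (K01 : K z `[0%R, 1%R]%classic = 1%E)
  (Kc : continuous (fun t => cond_cdf K t z)).

Let KT : K z setT = 1%E. Proof. exact: prob_kernel. Qed.

(** The infimum that defines the quantile is attained by continuity of the
    distribution function, and the level is attained by the intermediate value
    theorem. *)
Lemma quantileP tau : 0 <= tau <= 1 ->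
  [/\ 0 <= quantile K tau z <= 1, cond_cdf K (quantile K tau z) z = tau &
      forall x, 0 <= x <= 1 -> tau <= cond_cdf K x z -> quantile K tau z <= x].
Proof.
move=> tau01; have [t t01 Ft] := cdf_surj K01 KT Kc tau01.
set S := [set t | 0 <= t <= 1 /\ tau <= cond_cdf K t z].
have St : S t by split; rewrite // -Ft.
have hl : has_lbound S by exists 0 => x [/andP[]].
have min x : S x -> quantile K tau z <= x by move=> Sx; exact: ge_inf.
have q0 : 0 <= quantile K tau z by apply: lb_le_inf; [exists t|move=> x [/andP[]]].
have qt := min _ St.
have hF := cdf_le_homo KT.
split; last by move=> x x01 Fx; apply: min.
  by rewrite q0 (le_trans qt)//; case/andP: t01.
apply/eqP; rewrite eq_le; apply/andP; split.
  by rewrite -[leRHS]Ft; exact: hF.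
rewrite leNgt; apply/negP => Fq.
have tq : 0 < tau - cond_cdf K (quantile K tau z) z by rewrite subr_gt0.
have Kq : cond_cdf K t z @[t --> quantile K tau z] --> cond_cdf K (quantile K tau z) z.
  exact: Kc.
move/cvgrPdist_lt : Kq => /(_ _ tq)[e /= e0 he].
have [x Sx xq] : exists2 x, S x & x < quantile K tau z + e.
  by apply: inf_adherent => //; split; [exists t|].
have := he x; rewrite /= distrC ger0_norm ?subr_ge0 ?min//.
have [_ taux] := Sx; have xe : x - quantile K tau z < e by rewrite ltrBlDl.
move=> /(_ xe); rewrite distrC ger0_norm ?subr_ge0; last exact: (le_trans (ltW Fq)).
by rewrite ltrD2r ltNge taux.
Qed.

End quantiles.

(** Inside the central region the two ranks are close. To the left of it the
    true rank lies below the hull of the supports, where the score vanishes; by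
    monotonicity the estimated rank is at most the one at the left end of the
    region, hence exceeds the hull's left end by no more than the error there.
    The right side is symmetric. *)
Lemma score_error (R : realType) (d q : nat) (phi : 'I_q -> R -> R)
    (K : R.-pker covariate R d ~> R) (z : covariate R d) (Fh : R -> R) (L B : R) i x :
  is_score phi -> (0 < q)%N ->
  0 <= L -> (forall u v, `|white_score phi i u - white_score phi i v| <= L * `|u - v|) ->
  K z `[0%R, 1%R]%classic = 1%E -> continuous (fun t => cond_cdf K t z) ->
  {in `[0, 1] &, {homo Fh : t u / t <= u}} ->
  (forall t, central phi K z t -> `|cond_cdf K t z - Fh t| <= B) ->
  0 <= x <= 1 ->
  `|white_score phi i (Fh x) - white_score phi i (cond_cdf K x z)| <= L * B.
Proof.
move=> hphi hq L0 hL K01 Kc Fmon err x01.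
have KT : K z setT = 1%E by exact: prob_kernel.
have [t0 t12 t1] := tau_bounds hphi hq.
have [|q101 Fq1 q1min] := @quantileP _ _ _ _ K01 Kc (tau_min phi).
  by rewrite t0 (le_trans t12).
have [|q201 Fq2 q2min] := @quantileP _ _ _ _ K01 Kc (tau_max phi).
  by rewrite t1 andbT (le_trans t0).
set q1 := quantile K (tau_min phi) z in q101 Fq1 q1min.
set q2 := quantile K (tau_max phi) z in q201 Fq2 q2min.
have hF := cdf_le_homo KT.
have q12 : q1 <= q2 by apply: q1min => //; rewrite Fq2.
have e1 := err q1; rewrite /central /= in_itv /= -/q1 -/q2 lexx q12 in e1.
have e2 := err q2; rewrite /central /= in_itv /= -/q1 -/q2 lexx q12 in e2.
have {e1} := e1 isT; rewrite Fq1 => e1; have {e2} := e2 isT; rewrite Fq2 => e2.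
have B0 : 0 <= B by exact: le_trans (normr_ge0 _) e1.
have in01 (y : R) : 0 <= y <= 1 -> y \in `[0, 1] by rewrite in_itv.
have [xq1|q1x] := ltP x q1.
  have Fx : cond_cdf K x z < tau_min phi.
    by rewrite ltNge; apply/negP => /(q1min _ x01); rewrite leNgt xq1.
  rewrite (white_score_eq0 hphi i (u := cond_cdf K x z)) ?subr0; last first.
    by rewrite ltNge (ltW Fx).
  have [h|h] := leP (Fh x) (tau_min phi).
    by rewrite white_score_eq0// ?normr0 ?mulr_ge0// ltNge h.
  have := hL (Fh x) (tau_min phi).
  rewrite (white_score_eq0 hphi i (u := tau_min phi)) ?ltxx// subr0 => /le_trans; apply.
  apply: ler_wpM2l => //; rewrite gtr0_norm ?subr_gt0//.
  have := Fmon x q1 (in01 _ x01) (in01 _ q101) (ltW xq1).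
  move: e1; rewrite ler_norml => /andP[? ?]; lra.
have [q2x|xq2] := ltP q2 x.
  have Fx : tau_max phi <= cond_cdf K x z by rewrite -Fq2; apply: hF; exact: ltW.
  rewrite (white_score_eq0 hphi i (u := cond_cdf K x z)) ?subr0; last first.
    by rewrite [_ < tau_max phi]ltNge Fx andbF.
  have [h|h] := leP (tau_max phi) (Fh x).
    by rewrite white_score_eq0// ?normr0 ?mulr_ge0// [_ < tau_max phi]ltNge h andbF.
  have := hL (Fh x) (tau_max phi).
  rewrite (white_score_eq0 hphi i (u := tau_max phi)) ?ltxx ?andbF// subr0 => /le_trans; apply.
  apply: ler_wpM2l => //; rewrite ltr0_norm ?subr_lt0//.
  have := Fmon q2 x (in01 _ q201) (in01 _ x01) (ltW q2x).
  move: e2; rewrite ler_norml => /andP[? ?]; lra.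
apply: (le_trans (hL _ _)); apply: ler_wpM2l => //; rewrite distrC.
by apply: err; rewrite /central /= in_itv/= q1x.
Qed.

Section product_scores.
Context (R : realType) (q m : nat) (phi : 'I_q -> R -> R).
Hypotheses (hphi : is_score phi) (hm : #|{: 'I_q * 'I_q}| = m.+1).
Notation psi := (white_score phi).

Lemma has_mean_white_comb_sqr c (b : 'I_q -> R) :
  has_mean (unif01 R) (fun u => (c + \sum_j b j * psi j u) ^+ 2)
    (c ^+ 2 + \sum_j b j ^+ 2).
Proof.
have cross := has_mean_sum (fun i => has_mean_sum (fun j =>
  has_meanZ (b i * b j) (has_mean_white_scoreM hphi i j))).
have lin := has_meanZ (2 * c) (has_mean_sum (fun j =>
  has_meanZ (b j) (has_mean_white_score hphi j))).
apply: has_mean_ext (has_meanD (has_mean_cst _ (c ^+ 2)) (has_meanD lin cross)) => [u|].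
  rewrite (_ : \sum_i \sum_j _ = (\sum_j b j * psi j u) ^+ 2) /=; first by ring.
  rewrite expr2 mulr_suml; apply: eq_bigr => i _; rewrite mulr_sumr.
  by apply: eq_bigr => j _; ring.
rewrite big1 => [|j _]; last by rewrite mulr0.
rewrite mulr0 add0r; congr (_ + _); apply: eq_bigr => i _.
rewrite (bigD1 i)//= eqxx mulr1 big1 ?addr0 ?expr2// => j ji.
by rewrite eq_sym (negbTE ji) mulr0.
Qed.

(** The q^2 products of scores form one vector; this numbers its coordinates. *)
Definition pair_of (l : 'I_m.+1) : 'I_q * 'I_q := enum_val (cast_ord (esym hm) l).

Lemma pair_of_sum (F : 'I_q * 'I_q -> R) : \sum_l F (pair_of l) = \sum_i \sum_j F (i, j).
Proof.
rewrite pair_bigA /= (reindex pair_of) /=; first by apply: eq_bigr => l _; case: (pair_of l).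
exists (fun p => cast_ord hm (enum_rank p)) => [l _|p _].
  by rewrite /pair_of enum_valK cast_ordKV.
by rewrite /pair_of cast_ordK enum_rankK.
Qed.

Context d (T : measurableType d) (P : probability T R) (U1 U2 : T -> R).
Hypotheses (mU1 : measurable_fun setT U1) (mU2 : measurable_fun setT U2).

Definition product_score (w : T) : m.+1.-tuple R :=
  [tuple psi (pair_of l).1 (U1 w) * psi (pair_of l).2 (U2 w) | l < m.+1].

Lemma measurable_product_score : measurable_fun setT product_score.
Proof.
apply/measurable_fun_tnthP => l.
rewrite (_ : _ \o _ = fun w => psi (pair_of l).1 (U1 w) * psi (pair_of l).2 (U2 w)).
  by apply: measurable_funM; apply: (measurableT_comp (measurable_white_score hphi _)).
by apply/funext => w /=; rewrite tnth_mktuple.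
Qed.

Lemma product_score_bounded : exists2 B, 0 < B &
  forall d' (T' : measurableType d') (V1 V2 : T' -> R) w l,
  `|psi (pair_of l).1 (V1 w) * psi (pair_of l).2 (V2 w)| <= B.
Proof.
have [L L0 hL] := white_score_lipschitz hphi.
have hb i u : `|psi i u| <= L.
  have [u01|u01] := boolP (0 < u < 1); last by rewrite white_score_out// normr0 ltW.
  have := hL i u 0; rewrite (white_score_out hphi i (u := 0)) ?ltxx// !subr0 => /le_trans; apply.
  by rewrite gtr0_norm; case/andP: u01 => // u0 u1; rewrite ler_piMr ?ltW.
by exists (L * L) => [|d' T' V1 V2 w l]; rewrite ?mulr_gt0// normrM ler_pM.
Qed.

(** Integrating over the second rank first turns a linear combination of
    products of scores into a sum of squares of linear combinations of scores of
    the first rank. *)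
Lemma isotropic_product_score :
  (forall f : R * R -> \bar R, measurable_fun setT f -> (forall z, 0 <= f z)%E ->
    \int[P]_w f (U1 w, U2 w) = \int[unif01 R]_u \int[unif01 R]_v f (u, v))%E ->
  isotropic P product_score.
Proof.
move=> indep c a.
pose f (z : R * R) :=
  (c + \sum_l a l * (psi (pair_of l).1 z.1 * psi (pair_of l).2 z.2)) ^+ 2.
have mf : measurable_fun setT (EFin \o f).
  apply/measurable_EFinP; apply: measurable_funX; apply: measurable_funD => //.
  apply: measurable_sum => l; apply: measurable_funM => //.
  apply: measurable_funM; apply: (measurableT_comp (measurable_white_score hphi _)).
    exact: measurable_fst.
  exact: measurable_snd.
transitivity (\int[P]_w (EFin \o f) (U1 w, U2 w))%E.
  apply: eq_integral => w _; rewrite /f /=; congr ((_ + _) ^+ 2)%:E.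
  by apply: eq_bigr => l _; rewrite tnth_mktuple.
rewrite indep//; last by move=> z; rewrite lee_fin sqr_ge0.
pose e l := cast_ord hm (enum_rank l).
have eK p : pair_of (e p) = p by rewrite /pair_of cast_ordK enum_rankK.
have Ee l : e (pair_of l) = l by rewrite /e /pair_of enum_valK cast_ordKV.
transitivity (\int[unif01 R]_u
  (c ^+ 2 + \sum_j (0 + \sum_i a (e (i, j)) * psi i u) ^+ 2)%:E)%E.
  apply: eq_integral => u _.
  have [_ <-] := has_mean_white_comb_sqr c (fun j => 0 + \sum_i a (e (i, j)) * psi i u).
  apply: eq_integral => v _; rewrite /f /=; congr ((_ + _) ^+ 2)%:E.
  transitivity (\sum_i \sum_j a (e (i, j)) * (psi i u * psi j v)).
    rewrite -(pair_of_sum (fun p => a (e p) * (psi p.1 u * psi p.2 v))).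
    by apply: eq_bigr => l _; rewrite Ee.
  rewrite exchange_big/=; apply: eq_bigr => j _; rewrite add0r mulr_suml.
  by apply: eq_bigr => i _; rewrite mulrA.
have [_] := has_meanD (has_mean_cst (unif01 R) (c ^+ 2)) (has_mean_sum (fun j =>
  has_mean_white_comb_sqr 0 (fun i => a (e (i, j))))).
move=> ->; congr (_ + _)%:E; transitivity (\sum_i \sum_j a (e (i, j)) ^+ 2).
  by rewrite exchange_big/=; apply: eq_bigr => j _; rewrite expr0n add0r.
rewrite -(pair_of_sum (fun p => a (e p) ^+ 2)).
by apply: eq_bigr => l _; rewrite Ee.
Qed.

Lemma sqnorm_walk_product n (s : n.-tuple T) :
  sqnorm (walk product_score s) = \sum_i \sum_j
    ((Num.sqrt n%:R)^-1 * \sum_(l < n) psi i (U1 (tnth s l)) * psi j (U2 (tnth s l))) ^+ 2.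
Proof.
rewrite -(pair_of_sum (fun p => ((Num.sqrt n%:R)^-1 *
  \sum_(l < n) psi p.1 (U1 (tnth s l)) * psi p.2 (U2 (tnth s l))) ^+ 2)).
rewrite /sqnorm; apply: eq_bigr => k _; rewrite tnth_mktuple.
congr ((_ * _) ^+ 2); apply: eq_bigr => l _; by rewrite tnth_mktuple.
Qed.

End product_scores.

(** Given the sample that determines the weights, the summands are independent
    and centred, so the second moment of the normalized sum is the mean square
    of the weights, at most c^2, and Markov's inequality applies. *)
Lemma weighted_score_tail (R : realType) d (T : measurableType d) (P : probability T R)
    d1 (T1 : measurableType d1) (P1 : probability T1 R) (A : T -> T1) (U b : _ -> R)
    n (a : 'I_n -> n.-tuple T1 -> R) (c dl : R) :
  (0 < n)%N -> 0 <= c -> 0 < dl ->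
  measurable_fun setT A -> measurable_fun setT (U : T -> R) ->
  measurable_fun setT (b : R -> R) ->
  (forall f : T1 * R -> \bar R, measurable_fun setT f -> (forall z, 0 <= f z)%E ->
    \int[P]_w f (A w, U w) = \int[P1]_x \int[unif01 R]_u f (x, u))%E ->
  (forall c a : R, \int[unif01 R]_u ((c + a * b u) ^+ 2)%:E = (c ^+ 2 + a ^+ 2)%:E)%E ->
  (forall i, measurable_fun setT (a i)) -> (forall i x, `|a i x| <= c) ->
  let W s := (Num.sqrt n%:R)^-1 *
    \sum_(i < n) a i (map_tuple A s) * b (U (tnth s i)) in
  measurable_fun setT W /\
  (iid_law P n [set s | dl < `|W s|]%R <= ((c / dl) ^+ 2)%:E)%E.
Proof.
move=> n0 c0 dl0 mA mU mb indep var_b ma ac W.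
pose g (z : n.-tuple T1 * n.-tuple R) := (Num.sqrt n%:R)^-1 *
  \sum_(i < n) a i z.1 * b (tnth z.2 i).
have mg : measurable_fun setT g.
  apply: measurable_funM => //; apply: measurable_sum => i; apply: measurable_funM.
    exact: (measurableT_comp (ma i)).
  apply: (measurableT_comp mb).
  exact: (measurableT_comp (@measurable_tnth _ _ _ i) measurable_snd).
have WE s : W s = g (map_tuple A s, map_tuple U s).
  by congr (_ * _); apply: eq_bigr => i _; rewrite tnth_map.
have mAU : measurable_fun setT (fun s : n.-tuple T => (map_tuple A s, map_tuple U s)).
  by apply/measurable_fun_pairP; split; exact: measurable_map_tuple.
have mW : measurable_fun setT W.
  by rewrite (funext WE); exact: (measurableT_comp mg mAU).
split=> //.
have m2 : measurable_fun setT (fun z => (g z ^+ 2)%:E).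
  by apply/measurable_EFinP; exact: measurable_funX.
have EW : (\int[iid_law P n]_s ((W s) ^+ 2)%:E <= (c ^+ 2)%:E)%E.
  under eq_integral do rewrite WE.
  rewrite (@ge0_integral_iid_indep _ _ _ _ _ _ _ _ P1 (unif01 R) A U mA mU indep n
    (fun z => (g z ^+ 2)%:E))//; last by move=> z; rewrite lee_fin sqr_ge0.
  rewrite -[leRHS](integral_cst_prob (iid_law P1 n)); apply: ge0_le_integral => //.
  - by move=> x _; apply: integral_ge0 => u _; rewrite lee_fin sqr_ge0.
  - apply: (@measurable_fun_fubini_tonelli_F _ _ _ _ _ _ (fun z => (g z ^+ 2)%:E)) => // z.
    by rewrite lee_fin sqr_ge0.
  - move=> x _.
    have := iid_sum_sqr mb var_b 0 (fun i => (Num.sqrt n%:R)^-1 * a i x).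
    under eq_integral => u _.
      rewrite add0r.
      under eq_bigr do rewrite -mulrA.
      rewrite -mulr_sumr.
      over.
    move=> /= ->; rewrite lee_fin expr0n add0r.
    apply: (@le_trans _ _ (\sum_(i < n) n%:R^-1 * c ^+ 2)).
      apply: ler_sum => i _; rewrite exprMn exprVn sqr_sqrtr ?ler0n// ler_wpM2l ?invr_ge0//.
      by rewrite -(ger0_norm c0) -[leLHS]real_normK ?num_real// ler_sqr ?nnegrE ?(ger0_norm c0).
    by rewrite sumr_const card_ord -mulrnAl -mulr_natl mulfV ?mul1r// pnatr_eq0 -lt0n.
have mS : measurable [set s | dl < `|W s|].
  rewrite (_ : [set s | _] = (fun s => `|W s|) @^-1` `]dl, +oo[%classic); last first.
    by apply/seteqP; split => s /=; rewrite in_itv/= andbT.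
  rewrite -[X in measurable X]setTI.
  have mn : measurable_fun setT (fun s => `|W s|) by exact: measurableT_comp.
  exact: mn.
have : ((dl ^+ 2)%:E * iid_law P n [set s | dl < `|W s|]%R <= (c ^+ 2)%:E)%E.
  apply: le_trans EW; rewrite -[X in iid_law P n X]setIT -integral_indic//.
  rewrite -ge0_integralZl//; last 2 first.
  - by apply/measurable_EFinP; exact: measurable_indic.
  - by rewrite lee_fin sqr_ge0.
  apply: ge0_le_integral => //.
  - by move=> s _; rewrite mule_ge0 ?lee_fin ?sqr_ge0.
  - apply: emeasurable_funM => //; apply/measurable_EFinP; exact: measurable_indic.
  - by apply/measurable_EFinP; exact: measurable_funX.
  - move=> s _; rewrite indicE -EFinM lee_fin.
    have [|_] := boolP (_ \in _); last by rewrite mulr0 sqr_ge0.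
    rewrite inE/= mulr1 => sdl; rewrite -[leRHS]real_normK ?num_real//.
    by rewrite ler_sqr ?nnegrE// ltW.
by rewrite -lee_pdivlMl ?exprn_gt0// -EFinM mulrC -exprVn -exprMn.
Qed.

Lemma T_statE (R : realType) (d q : nat) (phi : 'I_q -> R -> R) (FX FY : estimator R d)
    n (s : n.-tuple (obs R d)) : is_score phi ->
  T_stat phi FX FY s = \sum_i \sum_j (n%:R^-1 * \sum_(l < n)
    white_score phi i (residual FX (sampleXZ s) l) *
    white_score phi j (residual FY (sampleYZ s) l)) ^+ 2.
Proof.
move=> hphi; rewrite /T_stat -/(whitening phi) /frobenius sqr_sqrtr; last first.
  by rewrite sumr_ge0// => i _; rewrite sumr_ge0// => j _; rewrite sqr_ge0.
apply: eq_bigr => i _; apply: eq_bigr => j _; congr (_ ^+ 2).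
rewrite /rho_hat -scalemxAr -scalemxAl mxE; congr (_ * _).
rewrite mulmx_sumr mulmx_suml summxE; apply: eq_bigr => l _.
set u := phi_vec phi _; set v := phi_vec phi _.
have -> : whitening phi *m (u *m v^T) *m whitening phi =
    (whitening phi *m u) *m (v^T *m whitening phi) by rewrite !mulmxA.
rewrite mxE big_ord1; congr (_ * _).
  by rewrite mxE; apply: eq_bigr => k _; rewrite !mxE.
rewrite -{1}(whitening_sym hphi) -trmx_mul mxE mxE.
by apply: eq_bigr => k _; rewrite !mxE.
Qed.

(** * Events of full measure and outer probability *)

Section full_measure.
Local Open Scope ereal_scope.
Context (R : realType).

Lemma product_prob_full d1 d2 (T1 : measurableType d1) (T2 : measurableType d2)
    (P1 : probability T1 R) (P2 : probability T2 R) A B :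
  measurable A -> measurable B -> P1 A = 1 -> P2 B = 1 ->
  product_prob P1 P2 (A `*` B) = 1.
Proof.
move=> mA mB PA PB; rewrite [LHS](@product_measure1E _ _ _ _ _ P1 P2)//.
by rewrite [X in X * _]PA [X in _ * X]PB mule1.
Qed.

Lemma tuple_all_cons d (T : measurableType d) n (D : set T) :
  @tuple_cons _ T n @^-1` [set s | forall i, D (tnth s i)] =
  D `*` [set s | forall i, D (tnth s i)].
Proof.
apply/seteqP; split => -[x t] /=.
  move=> h; split=> [|i]; first by have := h ord0; rewrite tuple_consE.
  by have := h (lift ord0 i); rewrite tuple_consE.
by move=> [Dx Dt] i; case: (unliftP ord0 i) => [j ->|->]; rewrite tuple_consE.
Qed.

Lemma measurable_tuple_all d (T : measurableType d) n (D : set T) :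
  measurable D -> measurable [set s : n.-tuple T | forall i, D (tnth s i)].
Proof.
move=> mD; rewrite (_ : [set _ | _] =
  \bigcap_(i in [set: 'I_n]) ((fun s : n.-tuple T => tnth s i) @^-1` D)); last first.
  by apply/seteqP; split => s h i; [move=> _; exact: h|exact: (h i I)].
apply: fin_bigcap_measurable => // i _.
by rewrite -[X in measurable X]setTI; exact: measurable_tnth.
Qed.

Lemma iid_law_full d (T : measurableType d) (P : probability T R) n (D : set T) :
  measurable D -> P D = 1 -> iid_law P n [set s | forall i, D (tnth s i)] = 1.
Proof.
move=> mD PD; elim: n => [|n IH].
  by rewrite /= diracE mem_set// => -[].
rewrite [LHS](_ : _ = product_prob P (iid_law P n) (@tuple_cons _ T n @^-1`
  [set s | forall i, D (tnth s i)]))//.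
by rewrite tuple_all_cons product_prob_full//; exact: measurable_tuple_all.
Qed.

Lemma probability_fullC d (T : measurableType d) (P : probability T R) D :
  measurable D -> P D = 1 <-> P (~` D) = 0.
Proof.
move=> mD; rewrite probability_setC//.
have : P D \is a fin_num.
  by rewrite ge0_fin_numE// (le_lt_trans (probability_le1 _ mD))// ltry.
case: (P D) => // r _; rewrite -EFinD; split=> -[h]; congr (_%:E); lra.
Qed.

Lemma unif01_itv01 : unif01 R `[0%R, 1%R]%classic = 1.
Proof.
apply/eqP; rewrite eq_le probability_le1//=.
apply: (@le_trans _ _ (unif01 R `]0%R, 1%R]%classic)).
  by have := @unif01_itv R 0 1 (lexx _) ltr01 (lexx _); rewrite subr0.
by apply: le_measure; rewrite ?inE// => x /=; rewrite !in_itv/= => /andP[/ltW -> ->].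
Qed.

Context (d : nat).

Lemma cubeE : @cube R d = [set z : covariate R d | forall i, (`[0%R, 1%R]%classic : set R) (tnth z i)].
Proof. by apply/seteqP; split => z h i /=; have := h i; rewrite /= in_itv. Qed.

Lemma measurable_cube : measurable (@cube R d).
Proof. by rewrite cubeE; apply: measurable_tuple_all. Qed.

(** The observations almost surely lie here; outside of it nothing is known
    about the estimators and the conditional laws. *)
Definition obs_box : set (obs R d) :=
  (`[0%R, 1%R]%classic `*` `[0%R, 1%R]%classic) `*` @cube R d.

Lemma measurable_obs_box : measurable obs_box.
Proof.
apply: measurableX; last exact: measurable_cube.
by apply: measurableX; exact: measurable_itv.
Qed.

Lemma ac_laws_box (P : law R d) : ac_laws P -> P obs_box = 1.
Proof.
move=> acP; apply/(probability_fullC _ measurable_obs_box).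
have mC : measurable (~` obs_box) by apply: measurableC; exact: measurable_obs_box.
suff U : unif_cube R d (~` obs_box) = 0.
  by have /null_content_dominatesP := acP; apply.
apply/(probability_fullC _ measurable_obs_box).
apply: product_prob_full.
- by apply: measurableX; exact: measurable_itv.
- exact: measurable_cube.
- by apply: product_prob_full; rewrite ?unif01_itv01//; exact: measurable_itv.
- by rewrite cubeE; apply: iid_law_full; [exact: measurable_itv|exact: unif01_itv01].
Qed.

End full_measure.

Section outer_bounds.
Local Open Scope ereal_scope.
Context d (T : measurableType d) (R : realType) (P : probability T R).

Lemma union_bound (I : finType) (E : I -> set T) (c : R) : (0 <= c)%R ->
  (forall i, measurable (E i)) -> (forall i, P (E i) <= c%:E) ->
  measurable [set s | exists i, E i s] /\
  P [set s | exists i, E i s] <= (#|I|%:R * c)%:E.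
Proof.
move=> c0 mE Ec.
suff H (r : seq I) : measurable [set s | exists2 i, i \in r & E i s] /\
    P [set s | exists2 i, i \in r & E i s] <= ((size r)%:R * c)%:E.
  have [] := H (enum I); rewrite -cardE.
  suff -> : [set s | exists2 i, i \in enum I & E i s] = [set s | exists i, E i s] by [].
  apply/seteqP; split => s /=; first by move=> -[i _ Ei]; exists i.
  by move=> -[i Ei]; exists i => //; rewrite mem_enum.
elim: r => [|i r [mU IH]].
  rewrite (_ : [set _ | _] = set0); last by apply/seteqP; split => // s [].
  by rewrite measure0 mul0r.
have -> : [set s | exists2 j, j \in i :: r & E j s] =
    E i `|` [set s | exists2 j, j \in r & E j s].
  apply/seteqP; split => s.
    by move=> [j]; rewrite inE => /predU1P[->|jr] Es; [left|right; exists j].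
  by move=> [Es|[j jr Es]]; [exists i; rewrite ?mem_head|exists j; rewrite // inE jr orbT].
split; first exact: measurableU.
apply: (le_trans (@measureU2 _ _ _ P _ _ (mE i) mU)).
by rewrite /= -natr1 mulrDl mul1r [(_ + c)%R]addrC EFinD; exact: leeD.
Qed.

(** The exceptional set C comes from suprema over uncountable sets and need not
    be measurable, hence the outer measure. *)
Lemma le_measure_outer (A B C : set T) (r : R) :
  measurable A -> measurable B -> P^*%mu C <= r%:E -> A `<=` B `|` C ->
  P A <= P B + r%:E.
Proof.
move=> mA mB Cr ABC; rewrite -(measurable_mu_extE P mA) -(measurable_mu_extE P mB).
apply: (le_trans (le_outer_measure P^*%mu _ _ ABC)).
apply: (le_trans (outer_measureU2 P^*%mu B C)); exact: leeD.
Qed.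

End outer_bounds.

(** * The effect of estimating the ranks *)

Section clipping.
Context (R : realType).

(** The errors of the scores are small only with high probability; clipped,
    they are measurable functions of the sample with a deterministic bound. *)
Definition clip (c x : R) : R := Num.max (- c) (Num.min c x).

Lemma clip_bound c x : 0 <= c -> `|clip c x| <= c.
Proof.
move=> c0; rewrite ler_norml /clip le_max lexx /= ge_max ge_min lexx /= andbT.
by rewrite (le_trans _ c0)// oppr_le0.
Qed.

Lemma clip_id c x : `|x| <= c -> clip c x = x.
Proof.
rewrite ler_norml => /andP[h1 h2]; rewrite /clip (min_idPr h2).
by apply/max_idPr.
Qed.

Lemma measurable_clip c : measurable_fun setT (clip c).
Proof. by apply: measurable_maxr => //; exact: measurable_minr. Qed.

End clipping.

Section estimated_ranks.
Context (R : realType) (q : nat) (phi : 'I_q -> R -> R).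
Hypothesis hphi : is_score phi.
Notation psi := (white_score phi).
Context d (T : measurableType d) (P : probability T R)
  d1 (T1 : measurableType d1) (P1 P2 : probability T1 R).
Variables (A1 A2 : T -> T1) (r1 r2 : T1 -> R).
Hypotheses (mA1 : measurable_fun setT A1) (mA2 : measurable_fun setT A2)
  (mr1 : measurable_fun setT r1) (mr2 : measurable_fun setT r2).
Notation U1 := (fun w => r1 (A1 w)).
Notation U2 := (fun w => r2 (A2 w)).
Hypothesis indep1 : forall f : T1 * R -> \bar R, measurable_fun setT f ->
  (forall z, 0 <= f z)%E ->
  (\int[P]_w f (A1 w, U2 w) = \int[P1]_x \int[unif01 R]_u f (x, u))%E.
Hypothesis indep2 : forall f : T1 * R -> \bar R, measurable_fun setT f ->
  (forall z, 0 <= f z)%E ->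
  (\int[P]_w f (A2 w, U1 w) = \int[P2]_x \int[unif01 R]_u f (x, u))%E.

Context (n : nat) (n0 : (0 < n)%N).
Variables (R1 R2 : 'I_n -> n.-tuple T1 -> R).
Hypotheses (mR1 : forall l, measurable_fun setT (R1 l))
  (mR2 : forall l, measurable_fun setT (R2 l)).

Definition rank_failure (r : T1 -> R) (Rh : 'I_n -> n.-tuple T1 -> R) (c : R) :
    set (n.-tuple T1) :=
  [set x | ~ forall i l, `|psi i (Rh l x) - psi i (r (tnth x l))| <= c].

Let score_var j (c a : R) :
  (\int[unif01 R]_u ((c + a * psi j u) ^+ 2)%:E = (c ^+ 2 + a ^+ 2)%:E)%E.
Proof.
have [_] := has_mean_white_comb_sqr hphi c (fun k => if k == j then a else 0).
rewrite (bigD1 j)//= eqxx [X in _ + (_ + X)]big1 => [|k /negbTE ->]; last by rewrite expr0n.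
rewrite addr0 => <-; apply: eq_integral => u _; congr ((_ + _) ^+ 2)%:E.
by rewrite (bigD1 j)//= eqxx big1 ?addr0// => k /negbTE ->; rewrite mul0r.
Qed.

Let noise (P' : probability T1 R) (A : T -> T1) (U : T -> R) (r : T1 -> R)
    (Rh : 'I_n -> n.-tuple T1 -> R) (c dl : R) :
  0 <= c -> 0 < dl -> measurable_fun setT A -> measurable_fun setT U ->
  measurable_fun setT r -> (forall l, measurable_fun setT (Rh l)) ->
  (forall f : T1 * R -> \bar R, measurable_fun setT f -> (forall z, 0 <= f z)%E ->
    \int[P]_w f (A w, U w) = \int[P']_x \int[unif01 R]_u f (x, u))%E ->
  let D p s := (Num.sqrt n%:R)^-1 * \sum_(l < n)
    clip c (psi p.1 (Rh l (map_tuple A s)) - psi p.1 (r (tnth (map_tuple A s) l))) *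
    psi p.2 (U (tnth s l)) in
  let M := [set s | exists p, dl < `|D p s|] in
  measurable M /\ (iid_law P n M <= (#|{: 'I_q * 'I_q}|%:R * (c / dl) ^+ 2)%:E)%E.
Proof.
move=> c0 dl0 mA mU mr mRh indep D.
have h p := @weighted_score_tail R _ T P _ T1 P' A U (psi p.2) n
  (fun l x => clip c (psi p.1 (Rh l x) - psi p.1 (r (tnth x l)))) c dl n0 c0 dl0 mA mU
  (measurable_white_score hphi _) indep (score_var p.2).
have ma (p : 'I_q * 'I_q) l : measurable_fun setT (fun x : n.-tuple T1 =>
    clip c (psi p.1 (Rh l x) - psi p.1 (r (tnth x l)))).
  apply: (measurableT_comp (@measurable_clip R c)); apply: measurable_funB.
    exact: (measurableT_comp (measurable_white_score hphi _)).
  apply: (measurableT_comp (measurable_white_score hphi _)).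
  exact: measurable_tnth_comp.
apply: union_bound => [|p|p]; first exact: sqr_ge0.
- have [mW _] := h p (ma p) (fun l x => clip_bound _ c0).
  rewrite [X in measurable X](_ : _ = (fun s => `|D p s|) @^-1` `]dl, +oo[%classic); last first.
    by apply/seteqP; split => s /=; rewrite in_itv/= andbT.
  rewrite -[X in measurable X]setTI.
  have mn : measurable_fun setT (fun s => `|D p s|) by exact: measurableT_comp.
  exact: mn.
- by have [_] := h p (ma p) (fun l x => clip_bound _ c0).
Qed.

(** The product of two estimated scores differs from the product of the true
    ones by two terms that are linear in the errors of one side, which are
    conditionally centred, and by the product of the two errors. *)
Lemma estimated_scores_close (c1 c2 dl e1 e2 : R) : 0 <= c1 -> 0 <= c2 -> 0 < dl ->
  ((iid_law P n)^*%mu (@map_tuple n _ _ A1 @^-1` rank_failure r1 R1 c1) <= e1%:E)%E ->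
  ((iid_law P n)^*%mu (@map_tuple n _ _ A2 @^-1` rank_failure r2 R2 c2) <= e2%:E)%E ->
  ((iid_law P n)^*%mu [set s | ~ forall i j,
     `|(Num.sqrt n%:R)^-1 * (\sum_(l < n) psi i (R1 l (map_tuple A1 s)) *
                                          psi j (R2 l (map_tuple A2 s))) -
       (Num.sqrt n%:R)^-1 * (\sum_(l < n) psi i (U1 (tnth s l)) *
                                          psi j (U2 (tnth s l)))|
     <= 2 * dl + Num.sqrt n%:R * (c1 * c2)]%R <=
   (e1 + e2 + #|{: 'I_q * 'I_q}|%:R * ((c1 / dl) ^+ 2 + (c2 / dl) ^+ 2))%:E)%E.
Proof.
move=> c10 c20 dl0 he1 he2.
have mU1 : measurable_fun setT U1 by exact: measurableT_comp.
have mU2 : measurable_fun setT U2 by exact: measurableT_comp.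
have [] := noise c10 dl0 mA1 mU2 mr1 mR1 indep1.
set M1 := [set s | _] => mM1 hM1.
have [] := noise c20 dl0 mA2 mU1 mr2 mR2 indep2.
set M2 := [set s | _] => mM2 hM2.
set F1 := _ @^-1` _ in he1; set F2 := _ @^-1` _ in he2.
set Q := iid_law P n in he1 he2 hM1 hM2 *.
apply: (@le_trans _ _ (Q^*%mu ((F1 `|` F2) `|` (M1 `|` M2)))%E); last first.
  apply: (le_trans (outer_measureU2 _ _ _)).
  rewrite mulrDr EFinD; apply: leeD.
    by apply: (le_trans (outer_measureU2 _ _ _)); rewrite EFinD; exact: leeD.
  apply: (le_trans (outer_measureU2 _ _ _)); rewrite EFinD.
  rewrite -(measurable_mu_extE Q mM1) in hM1; rewrite -(measurable_mu_extE Q mM2) in hM2.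
  exact: leeD.
apply: le_outer_measure => s /= hs; apply: contrapT => /not_orP[].
move=> /not_orP[/contrapT h1 /contrapT h2] /not_orP[h3 h4]; apply: hs => i j.
set rn := (Num.sqrt n%:R)^-1; pose a l := psi i (R1 l (map_tuple A1 s)) - psi i (U1 (tnth s l)).
pose b l := psi j (R2 l (map_tuple A2 s)) - psi j (U2 (tnth s l)).
have ac l : `|a l| <= c1 by have := h1 i l; rewrite tnth_map.
have bc l : `|b l| <= c2 by have := h2 j l; rewrite tnth_map.
have D1 : `|rn * \sum_(l < n) a l * psi j (U2 (tnth s l))| <= dl.
  rewrite leNgt; apply/negP => h; apply: h3; exists (i, j) => /=.
  under eq_bigr do rewrite tnth_map.
  under eq_bigr => l _ do rewrite clip_id ?ac//.
  exact: h.
have D2 : `|rn * \sum_(l < n) b l * psi i (U1 (tnth s l))| <= dl.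
  rewrite leNgt; apply/negP => h; apply: h4; exists (j, i) => /=.
  under eq_bigr do rewrite tnth_map.
  under eq_bigr => l _ do rewrite clip_id ?bc//.
  exact: h.
have sn0 : 0 < Num.sqrt (n%:R : R) by rewrite sqrtr_gt0 ltr0n.
have D3 : `|rn * \sum_(l < n) a l * b l| <= Num.sqrt n%:R * (c1 * c2).
  rewrite normrM ger0_norm ?invr_ge0 ?sqrtr_ge0//.
  apply: (@le_trans _ _ (rn * \sum_(l < n) (c1 * c2))).
    rewrite ler_wpM2l ?invr_ge0 ?sqrtr_ge0//.
    apply: (le_trans (ler_norm_sum _ _ _)); apply: ler_sum => l _.
    by rewrite normrM ler_pM.
  rewrite le_eqVlt; apply/orP; left; apply/eqP.
  have rnn : rn * n%:R = Num.sqrt n%:R.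
    by rewrite -[X in _ * X](@sqr_sqrtr R n%:R) ?ler0n// expr2 mulKf// gt_eqF.
  by rewrite sumr_const card_ord -[(c1 * c2) *+ n]mulr_natl (mulrA rn) rnn.
have -> : rn * (\sum_(l < n) psi i (R1 l (map_tuple A1 s)) *
                             psi j (R2 l (map_tuple A2 s))) -
    rn * (\sum_(l < n) psi i (U1 (tnth s l)) * psi j (U2 (tnth s l))) =
    rn * (\sum_(l < n) a l * psi j (U2 (tnth s l))) +
    rn * (\sum_(l < n) b l * psi i (U1 (tnth s l))) + rn * (\sum_(l < n) a l * b l).
  rewrite -mulrBr -!mulrDr -sumrB -!big_split /=; congr (_ * _).
  by apply: eq_bigr => l _; rewrite /a /b; ring.
apply: (le_trans (ler_normD _ _)); apply: lerD => //.
by apply: (le_trans (ler_normD _ _)); rewrite mulr2n mulrDl mul1r lerD.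
Qed.

End estimated_ranks.

(** * Ranks in the model *)

Section model_ranks.
Context (R : realType) (d : nat).

Lemma measurable_obsX : measurable_fun setT (@obsX R d).
Proof. exact: (measurableT_comp measurable_fst measurable_fst). Qed.

Lemma measurable_obsY : measurable_fun setT (@obsY R d).
Proof. exact: (measurableT_comp measurable_snd measurable_fst). Qed.

Lemma measurable_obsZ : measurable_fun setT (@obsZ R d).
Proof. exact: measurable_snd. Qed.

Lemma cond_indep_sym dT dE dE' dG (T : measurableType dT) (E : measurableType dE)
    (E' : measurableType dE') (G : measurableType dG) (P : probability T R)
    (X : T -> E) (Y : T -> E') (Z : T -> G) :
  cond_indep P X Y Z -> cond_indep P Y X Z.
Proof.
move=> [KX [KY [hX hY hXY]]]; exists KY, KX; split=> // A B C mA mB mC.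
by rewrite (setIC (Y @^-1` A)) hXY//; apply: eq_integral => w _; rewrite muleC.
Qed.

Context (P : law R d) (V1 V2 : obs R d -> R) (K : R.-pker covariate R d ~> R).
Hypotheses (mV1 : measurable_fun setT V1) (mV2 : measurable_fun setT V2).
Hypotheses (Pbox : P (@obs_box R d) = 1%E) (hK : continuous_version P V2 K)
  (ci : cond_indep P V1 V2 (@obsZ R d)).

Lemma measurable_pair_obsZ (V : obs R d -> R) : measurable_fun setT V ->
  measurable_fun setT (fun w => (V w, obsZ w)).
Proof. by move=> mV; apply: measurable_fun_pair => //; exact: measurable_obsZ. Qed.

Lemma obsZ_cube_ae : P (@obsZ R d @^-1` (~` @cube R d)) = 0%E.
Proof.
have Pb := (probability_fullC P (@measurable_obs_box R d)).1 Pbox.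
apply/eqP; rewrite eq_le measure_ge0 andbT -Pb; apply: le_measure; rewrite ?inE.
- rewrite -[X in measurable X]setTI; apply: measurable_obsZ => //.
  by apply: measurableC; exact: measurable_cube.
- by apply: measurableC; exact: measurable_obs_box.
- by move=> w /= nw [].
Qed.

Lemma model_rank (f : (R * covariate R d) * R -> \bar R) :
  measurable_fun setT f -> (forall p, 0 <= f p)%E ->
  (\int[P]_w f ((V1 w, obsZ w), kernel_cdf K (V2 w, obsZ w)) =
   \int[distribution P (mfun_Sub (mem_set (measurable_pair_obsZ mV1)))]_a
     \int[unif01 R]_u f (a, u))%E.
Proof.
move=> mf f0; have [hc hg] := hK.
rewrite (ge0_integral_conditional_rank mV1 mV2 measurable_obsZ
  (@measurable_cube R d) obsZ_cube_ae (fun z h => (hg z h).1) (fun z h => (hg z h).2))//.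
rewrite ge0_integral_distribution//.
  exact: measurable_fun_fubini_tonelli_F.
by move=> x; exact: integral_ge0.
Qed.

(** Particular case of a function that ignores the pair (V1, Z). *)
Lemma model_rank_law (h : R -> \bar R) : measurable_fun setT h -> (forall u, 0 <= h u)%E ->
  (\int[P]_w h (kernel_cdf K (V2 w, obsZ w)) = \int[unif01 R]_u h u)%E.
Proof.
move=> mh h0; have := @model_rank (fun p => h p.2).
rewrite /= => ->//.
  by rewrite integral_cst_prob.
exact: (measurableT_comp mh measurable_snd).
Qed.

End model_ranks.

Section estimator_error.
Context (R : realType) (d q : nat) (phi : 'I_q -> R -> R).
Hypotheses (hphi : is_score phi) (hq : (0 < q)%N).
Context (F : estimator R d) (hF : is_estimator F).
Context (P : law R d) (V : obs R d -> R) (K : R.-pker covariate R d ~> R).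
Hypotheses (Pbox : P (@obs_box R d) = 1%E) (hK : continuous_version P V K)
  (V01 : forall w, obs_box w -> 0 <= V w <= 1).

(** On a sample in the unit cube, a bound on the relative error of the estimator
    over the central region bounds the errors of all scores. *)
Lemma rank_failure_outer n (a C L e : R) :
  a != 0 -> 0 < C -> 0 < L ->
  (forall i u v, `|white_score phi i u - white_score phi i v| <= L * `|u - v|) ->
  ((iid_law P n)^*%mu [set s | C%:E < `|normT phi K (fun t z =>
     cond_cdf K t z - F (map_tuple (fun w => (V w, obsZ w)) s) t z)%R * (a^-1)%:E|] <= e%:E)%E ->
  ((iid_law P n)^*%mu (@map_tuple n _ _ (fun w => (V w, obsZ w)) @^-1`
    rank_failure phi (kernel_cdf K) (fun l x => residual F x l) (L * (C * `|a|))%R) <= e%:E)%E.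
Proof.
move=> a0 C0 L0 hL; set S := map_tuple _; set Ev := [set s | _] => hEv.
pose G := [set s : n.-tuple (obs R d) | forall i, obs_box (tnth s i)].
have mG : measurable G by apply: measurable_tuple_all; exact: measurable_obs_box.
have G0 : iid_law P n (~` G) = 0%E.
  apply/(probability_fullC _ mG); apply: iid_law_full => //; exact: measurable_obs_box.
have [_ hg] := hK.
apply: (@le_trans _ _ ((iid_law P n)^*%mu (Ev `|` ~` G))); last first.
  apply: (le_trans (outer_measureU2 _ _ _)); rewrite -[leRHS]adde0; apply: leeD => //.
  by rewrite -G0 -(measurable_mu_extE _ (measurableC mG)).
apply: le_outer_measure => s /= hs; apply: contrapT => /not_orP[nE /contrapT Gs].
apply: hs => i l; rewrite /residual tnth_map /=.
have czl : cube (obsZ (tnth s l)) by have [] := Gs l.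
have [K01 Kc] := hg _ czl.
have Vl := V01 (Gs l).
have Sbox j : 0 <= (tnth (S s) j).1 <= 1 /\ cube (tnth (S s) j).2.
  by rewrite tnth_map /=; split; [exact: V01|have [] := Gs j].
have [Fmon _ _ _] := hF.1 n (S s) (obsZ (tnth s l)) Sbox czl.
apply: (score_error hphi hq (ltW L0) (hL i) K01 Kc Fmon) => // t ct.
move: nE; rewrite /Ev /=; set N := normT _ _ _ => nE.
have Nt : (`|cond_cdf K t (obsZ (tnth s l)) - @F n (S s) t (obsZ (tnth s l))|%:E <= N)%E.
  apply: (@le_trans _ _ (ereal_sup [set `|cond_cdf K t (obsZ (tnth s l)) -
      @F n (S s) t (obsZ (tnth s l))|%:E | t in central phi K (obsZ (tnth s l))])).
    by apply: ereal_sup_ubound; exists t.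
  by apply: ereal_sup_ubound; exists (obsZ (tnth s l)).
move/negP : nE; rewrite -leNgt.
move: Nt; case: N => [r| |] //=.
  rewrite !lee_fin normrM normfV ler_pdivrMr ?normr_gt0// => rt rC.
  by rewrite (le_trans rt)// (le_trans (ler_norm r)).
move=> _; rewrite mulyr; have [a1|a1] := ltP 0 (a^-1).
  by rewrite gtr0_sg// mul1e.
by rewrite ltr0_sg ?lt_neqAle ?invr_eq0 ?a0// mulN1e.
Qed.

End estimator_error.

(** * Quantiles of the chi-squared law *)

Section chi2_quantile.
Context (R : realType) (m : nat).
Notation G := (iid_law (std_normal R) m.+1).

Let mle (x : R) : measurable [set v : m.+1.-tuple R | sqnorm v <= x].
Proof.
apply: (@measurable_sqnorm_set R m.+1 [set y : R | y <= x]).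
by rewrite (_ : [set y | _] = `]-oo, x]%classic).
Qed.

Let cdfE (x : R) : (chi2_cdf m.+1 x)%:E = G [set v | sqnorm v <= x].
Proof.
rewrite /chi2_cdf -/(sqnorm _) fineK// ge0_fin_numE//.
by rewrite (le_lt_trans (probability_le1 _ (mle x)))// ltry.
Qed.

Lemma chi2_cdf_homo : {homo @chi2_cdf R m.+1 : x y / x <= y}.
Proof.
move=> x y xy; rewrite -lee_fin !cdfE; apply: le_measure; rewrite ?inE.
- exact: mle.
- exact: mle.
- by move=> v /= /le_trans; apply.
Qed.

Lemma chi2_cdf_lt0 (x : R) : x < 0 -> chi2_cdf m.+1 x = 0.
Proof.
move=> x0; apply: EFin_inj; rewrite cdfE (_ : [set v | _] = set0) ?measure0//.
apply/seteqP; split => // v /= vx.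
by have := le_lt_trans (le_trans (sqnorm_ge0 v) vx) x0; rewrite ltxx.
Qed.

Lemma chi2_cdf_gt (p : R) : p < 1 -> exists x, p <= chi2_cdf m.+1 x.
Proof.
move=> p1; pose E k := [set v : m.+1.-tuple R | sqnorm v <= k%:R].
have UE : \bigcup_k E k = setT.
  apply/seteqP; split => // v _; exists (Num.truncn (sqnorm v)).+1 => //=.
  by rewrite /E /= ltW// truncnS_gt.
have : G \o E @ \oo --> G (\bigcup_k E k).
  apply: nondecreasing_cvg_mu => [k||j k jk].
  - exact: mle.
  - by rewrite UE.
  - by apply/subsetPset => v /=; rewrite /E /= => /le_trans; apply; rewrite ler_nat.
rewrite UE probability_setT => /fine_cvgP[_ /cvgrPdist_lt/(_ (1 - p))].
rewrite subr_gt0 => /(_ p1)[k _ hk]; exists k%:R.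
have h : `|1 - chi2_cdf m.+1 (k%:R : R)| < 1 - p := hk k (leqnn _).
have := ler_norm (1 - chi2_cdf m.+1 (k%:R : R)); lra.
Qed.

(** Left of the quantile the distribution function is below 1 - alpha, right of
    it not; by continuity the values at nearby points on the two sides differ by
    at most e, so both are within e of 1 - alpha. *)
Lemma chi2_quantile_bracket (alpha e : R) : 0 < alpha < 1 -> 0 < e ->
  let z := chi2_quantile m.+1 (1 - alpha) in
  exists eta, [/\ 0 < eta, eta <= 1, 1 - chi2_cdf m.+1 (z - eta) <= alpha + e &
    alpha - e <= 1 - chi2_cdf m.+1 (z + eta)].
Proof.
move=> /andP[a0 a1] e0 z.
pose S := [set x : R | 1 - alpha <= chi2_cdf m.+1 x].
have S0 : S !=set0 by apply: chi2_cdf_gt; lra.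
have Sl : has_lbound S.
  exists 0 => x /= Sx; rewrite leNgt; apply/negP => x0.
  by move: Sx; rewrite /S /= chi2_cdf_lt0//; lra.
have [dl dl0 hdl] := chi2_small m z e0.
pose eta := Num.min dl 1.
have eta0 : 0 < eta by rewrite lt_min dl0 ltr01.
have etadl : eta <= dl by rewrite ge_min lexx.
have lo : chi2_cdf m.+1 (z - eta) < 1 - alpha.
  rewrite ltNge; apply/negP => h.
  have : z <= z - eta by apply: ge_inf.
  lra.
have hi : 1 - alpha <= chi2_cdf m.+1 (z + eta).
  have [x Sx xz] : exists2 x, S x & x < z + eta by apply: inf_adherent.
  by apply: (le_trans Sx); apply: chi2_cdf_homo; exact: ltW.
have mid : chi2_cdf m.+1 (z + eta) <= chi2_cdf m.+1 (z - eta) + e.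
  rewrite -lee_fin EFinD !cdfE.
  apply: le_trans (leeD (lexx _) hdl); apply: le_measureU => //.
  - apply: (@measurable_sqnorm_set R m.+1 [set y : R | `|y - z| <= dl]).
    rewrite (_ : [set y | _] = closed_ball z dl); first exact: measurable_closed_ball.
    by rewrite closed_ballE//; apply/seteqP; split => y /=; rewrite /closed_ball_/= distrC.
  - move=> v /= vz; have [?|?] := leP (sqnorm v) (z - eta); [by left|right => /=].
    rewrite ler_norml; apply/andP; split; lra.
exists eta; split=> //; [by rewrite ge_min lexx orbT|lra|lra].
Qed.

End chi2_quantile.

(** * The level of the test *)

Lemma sum_sqr_perturb (R : realType) (I : finType) (w w' : I -> R) (k : R) :
  0 <= k <= 1 -> (forall p, `|w' p - w p| <= k) ->
  `|\sum_p w' p ^+ 2 - \sum_p w p ^+ 2| <= k * (2 * #|I|%:R + \sum_p w p ^+ 2).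
Proof.
move=> /andP[k0 k1] ww; rewrite -sumrB; apply: (le_trans (ler_norm_sum _ _ _)).
have -> : 2 * #|I|%:R = \sum_(p : I) 2 :> R by rewrite sumr_const mulr_natr.
rewrite -big_split mulr_sumr /=.
apply: ler_sum => p _; have := ww p.
rewrite (_ : w' p ^+ 2 - w p ^+ 2 = (w' p - w p) * (2 * w p + (w' p - w p))); last by ring.
set x := w' p - w p => xk; rewrite normrM.
apply: (le_trans (ler_pM _ _ xk (lexx _))) => //.
rewrite ler_wpM2l//; apply: (le_trans (ler_normD _ _)).
rewrite normrM (ger0_norm (ler0n _ 2)).
have : 0 <= (1 - `|w p|) ^+ 2 by exact: sqr_ge0.
rewrite sqrrB expr1n mul1r -normrX (ger0_norm (sqr_ge0 (w p))).
lra.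
Qed.

(** The bound on |y - x| grows with x, as a perturbation of the vector does to
    its squared norm; thresholds near z are separated by eta all the same, since
    for x below z - eta the bound is at most eta, and for larger x it grows
    more slowly than x. *)
Lemma threshold_perturb (R : realType) (N k z eta x y : R) :
  0 < N -> 0 <= k -> k * (`|z| + 1 + 2 * N) <= eta -> eta <= 1 -> 0 <= x ->
  `|y - x| <= k * (2 * N + x) ->
  (z < y -> z - eta < x) /\ (z + eta < x -> z < y).
Proof.
move=> N0 k0 hk eta1 x0; rewrite ler_norml => /andP[lo up].
have zn := ler_norm z; have kz : k * z <= k * `|z| by rewrite ler_wpM2l.
have knn : 0 <= k * `|z| by rewrite mulr_ge0.
have kN : 0 <= k * N by rewrite mulr_ge0// ltW.
rewrite !mulrDr mulr1 in hk; rewrite mulrDr in lo up.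
split=> h; rewrite ltNge; apply/negP => h'.
  have : k * x <= k * (z - eta) by rewrite ler_wpM2l.
  have : 0 <= eta by apply: le_trans hk; rewrite !addr_ge0// mulr_ge0// mulr_ge0// ltW.
  move=> e0; have : 0 <= k * eta by rewrite mulr_ge0.
  rewrite mulrBr; lra.
have k1 : k < 1.
  rewrite ltNge; apply/negP => k1.
  have : 0 <= (k - 1) * N by rewrite mulr_ge0 ?subr_ge0// ltW.
  rewrite mulrBl mul1r; lra.
have : 0 < (1 - k) * (x - (z + eta)) by rewrite mulr_gt0 ?subr_gt0.
rewrite mulrBl mul1r mulrBr mulrDr.
have : k * eta <= k * 1 by rewrite ler_wpM2l.
have : 0 <= k * x by rewrite mulr_ge0.
lra.
Qed.

Section level.
Context (R : realType) (d q m : nat) (phi : 'I_q -> R -> R).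
Hypotheses (hphi : is_score phi) (hq : (0 < q)%N)
  (hm : #|{: 'I_q * 'I_q}| = m.+1).
Context (FX FY : estimator R d) (hFX : is_estimator FX) (hFY : is_estimator FY).
Context (P : law R d) (KX KY : R.-pker covariate R d ~> R).
Hypotheses (acP : ac_laws P) (ciP : cond_indep P (@obsX R d) (@obsY R d) (@obsZ R d))
  (hKX : continuous_version P (@obsX R d) KX) (hKY : continuous_version P (@obsY R d) KY).
Notation psi := (white_score phi).
Notation XZ := (fun w : obs R d => (obsX w, obsZ w)).
Notation YZ := (fun w : obs R d => (obsY w, obsZ w)).
Notation U1 := (fun w : obs R d => kernel_cdf KX (XZ w)).
Notation U2 := (fun w : obs R d => kernel_cdf KY (YZ w)).

Let Pbox : P (@obs_box R d) = 1%E. Proof. exact: ac_laws_box. Qed.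
Let mX := @measurable_obsX R d.
Let mY := @measurable_obsY R d.

Let mU1 : measurable_fun setT U1.
Proof.
apply: (measurableT_comp (measurable_kernel_cdf KX)); exact: measurable_pair_obsZ.
Qed.

Let mU2 : measurable_fun setT U2.
Proof.
apply: (measurableT_comp (measurable_kernel_cdf KY)); exact: measurable_pair_obsZ.
Qed.

(** The second rank is uniform and independent of (X, Z), and the first rank is
    a function of (X, Z) that is uniform in its turn. *)
Lemma ranks_independent (f : R * R -> \bar R) : measurable_fun setT f ->
  (forall z, 0 <= f z)%E ->
  (\int[P]_w f (U1 w, U2 w) = \int[unif01 R]_u \int[unif01 R]_v f (u, v))%E.
Proof.
move=> mf f0.
have mk : measurable_fun setT (fun p : (R * covariate R d) * R =>
    f (kernel_cdf KX p.1, p.2)).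
  apply: (measurableT_comp mf); apply: measurable_fun_pair => //.
  exact: (measurableT_comp (measurable_kernel_cdf KX)).
rewrite (model_rank mX mY Pbox hKY ciP mk)//.
have mh : measurable_fun setT (fun u => \int[unif01 R]_v f (u, v))%E.
  exact: measurable_fun_fubini_tonelli_F.
have h0 u : (0 <= \int[unif01 R]_v f (u, v))%E by exact: integral_ge0.
rewrite ge0_integral_distribution//=.
  by rewrite -(model_rank_law mY mX Pbox hKX (cond_indep_sym ciP) mh h0).
by apply: (measurableT_comp mh); exact: measurable_kernel_cdf.
Qed.

Let V := product_score phi hm U1 U2.

Lemma isotropic_ranks : isotropic P V.
Proof. by apply: isotropic_product_score => // f mf f0; exact: ranks_independent. Qed.

Context (n : nat) (n0 : (0 < n)%N).

(** The squares of these add up to n times the test statistic. *)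
Definition estimated_sum i j (s : n.-tuple (obs R d)) : R :=
  (Num.sqrt n%:R)^-1 * \sum_(l < n)
    psi i (residual FX (sampleXZ s) l) * psi j (residual FY (sampleYZ s) l).

Lemma measurable_estimated_sum i j : measurable_fun setT (estimated_sum i j).
Proof.
apply: measurable_funM => //; apply: measurable_sum => l; apply: measurable_funM.
  apply: (measurableT_comp (measurable_white_score hphi _)).
  apply: (measurableT_comp (hFX.2 n l)).
  by apply: measurable_map_tuple; exact: measurable_pair_obsZ.
apply: (measurableT_comp (measurable_white_score hphi _)).
apply: (measurableT_comp (hFY.2 n l)).
by apply: measurable_map_tuple; exact: measurable_pair_obsZ.
Qed.

Lemma test_event (z : R) (s : n.-tuple (obs R d)) :
  (n%:R^-1 * z < T_stat phi FX FY s) = (z < \sum_i \sum_j estimated_sum i j s ^+ 2).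
Proof.
have nR : 0 < n%:R^-1 :> R by rewrite invr_gt0 ltr0n.
rewrite T_statE// -[in RHS](ltr_pM2l nR) mulr_sumr; congr (_ < _).
apply: eq_bigr => i _; rewrite mulr_sumr; apply: eq_bigr => j _.
have rn : (Num.sqrt n%:R)^-1 ^+ 2 = n%:R^-1 :> R by rewrite exprVn sqr_sqrtr ?ler0n.
by rewrite /estimated_sum -rn; set t := \sum_(l < n) _; set c := _^-1; ring.
Qed.

(** Up to the exceptional set, the test rejects if the squared norm of the walk
    of true scores exceeds z + eta and only if it exceeds z - eta. All bounds
    are explicit in n, so that they can be made uniform over the laws. *)
Lemma level_bracket (alpha C1 C2 L dl e e1 e2 a b eta k : R) :
  let z := chi2_quantile (q ^ 2) (1 - alpha) in
  let r := e1 + e2 + m.+1%:R * ((L * (C1 * `|a|) / dl) ^+ 2 +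
                                (L * (C2 * `|b|) / dl) ^+ 2) in
  a != 0 -> b != 0 -> 0 < C1 -> 0 < C2 -> 0 < L -> 0 < dl ->
  (forall i u v, `|psi i u - psi i v| <= L * `|u - v|) ->
  ((iid_law P n)^*%mu [set s | C1%:E < `|normT phi KX (fun t z =>
     cond_cdf KX t z - @FX n (sampleXZ s) t z)%R * (a^-1)%:E|] <= e1%:E)%E ->
  ((iid_law P n)^*%mu [set s | C2%:E < `|normT phi KY (fun t z =>
     cond_cdf KY t z - @FY n (sampleYZ s) t z)%R * (b^-1)%:E|] <= e2%:E)%E ->
  2 * dl + Num.sqrt n%:R * ((L * (C1 * `|a|)) * (L * (C2 * `|b|))) <= k ->
  k * (`|z| + 1 + 2 * m.+1%:R) <= eta -> eta <= 1 ->
  (forall x, x = z - eta \/ x = z + eta ->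
    `|fine (iid_law P n [set s | x < sqnorm (walk V s)]) - (1 - chi2_cdf m.+1 x)| <= e) ->
  exists2 p, 'E_(iid_law P n)[@test R d q phi FX FY alpha n]%E = p%:E &
    (1 - chi2_cdf m.+1 (z + eta)) - e - r <= p <= (1 - chi2_cdf m.+1 (z - eta)) + e + r.
Proof.
move=> z r a0 b0 C10 C20 L0 dl0 hL hE1 hE2 hk hke eta1 clt.
set Q := iid_law P n in hE1 hE2 clt *.
pose Tst := [set s : n.-tuple (obs R d) | z < \sum_i \sum_j estimated_sum i j s ^+ 2].
have mgt (f : n.-tuple (obs R d) -> R) x : measurable_fun setT f ->
    measurable [set s | x < f s].
  move=> mf; rewrite (_ : [set s | _] = f @^-1` `]x, +oo[%classic); last first.
    by apply/seteqP; split => s /=; rewrite in_itv/= andbT.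
  by rewrite -[X in measurable X]setTI; exact: mf.
have mT : measurable Tst.
  apply: mgt; apply: measurable_sum => i; apply: measurable_sum => j.
  by apply: measurable_funX; exact: measurable_estimated_sum.
have mV : measurable_fun setT V by exact: measurable_product_score.
have mW x : measurable [set s : n.-tuple (obs R d) | x < sqnorm (walk V s)].
  apply: mgt; apply: (measurableT_comp (@measurable_sqnorm R m.+1)).
  exact: measurable_walk.
have fin A : measurable A -> (fine (Q A))%:E = Q A.
  by move=> mA; rewrite fineK// ge0_fin_numE// (le_lt_trans (probability_le1 _ mA))// ltry.
have ET : 'E_Q[@test R d q phi FX FY alpha n]%E = (fine (Q Tst))%:E.
  rewrite fin// unlock -(setIT Tst) -integral_indic//; apply: eq_integral => s _.
  rewrite /test -/z test_event indicE; congr (_%:R%:E).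
  apply/esym; have [h|h] := boolP (z < \sum_i \sum_j estimated_sum i j s ^+ 2).
    by rewrite mem_set.
  by rewrite memNset//; exact/negP.
exists (fine (Q Tst)) => //.
pose bad := [set s : n.-tuple (obs R d) | ~ forall i j,
   `|estimated_sum i j s - (Num.sqrt n%:R)^-1 *
      (\sum_(l < n) psi i (U1 (tnth s l)) * psi j (U2 (tnth s l)))| <= k].
have hbad : (Q^*%mu bad <= r%:E)%E.
  have A1 (w : obs R d) : obs_box w -> 0 <= obsX w <= 1.
    by move=> [[]]; rewrite /= !in_itv.
  have A2 (w : obs R d) : obs_box w -> 0 <= obsY w <= 1.
    by move=> [[]]; rewrite /= !in_itv.
  have f1 := rank_failure_outer hphi hq hFX Pbox hKX A1 a0 C10 L0 hL hE1.
  have f2 := rank_failure_outer hphi hq hFY Pbox hKY A2 b0 C20 L0 hL hE2.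
  have c10 : 0 <= L * (C1 * `|a|) by rewrite !mulr_ge0// ltW.
  have c20 : 0 <= L * (C2 * `|b|) by rewrite !mulr_ge0// ltW.
  have := estimated_scores_close hphi (measurable_pair_obsZ mX) (measurable_pair_obsZ mY)
    (measurable_kernel_cdf KX) (measurable_kernel_cdf KY)
    (model_rank mX mY Pbox hKY ciP) (model_rank mY mX Pbox hKX (cond_indep_sym ciP))
    n0 (fun l => hFX.2 n l) (fun l => hFY.2 n l) c10 c20 dl0 f1 f2.
  rewrite hm; apply: le_trans; apply: le_outer_measure => s /= hs hc.
  by apply: hs => i j; apply: le_trans hk; exact: hc.
have k0 : 0 <= k.
  apply: le_trans hk; rewrite addr_ge0 ?mulr_ge0 ?sqrtr_ge0//; exact: ltW.
have k1 : k <= 1.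
  apply: le_trans (le_trans hke eta1); rewrite ler_peMr//.
  have : 0 <= `|z| by []. have : 0 <= m.+1%:R :> R by rewrite ler0n. lra.
have good s : ~ bad s ->
    `|\sum_i \sum_j estimated_sum i j s ^+ 2 - sqnorm (walk V s)| <=
    k * (2 * m.+1%:R + sqnorm (walk V s)).
  move=> /contrapT gs; rewrite sqnorm_walk_product !pair_bigA /= -hm.
  by apply: sum_sqr_perturb => [|p]; [rewrite k0 k1|exact: gs].
have key s : ~ bad s -> (z < \sum_i \sum_j estimated_sum i j s ^+ 2 ->
    z - eta < sqnorm (walk V s)) /\ (z + eta < sqnorm (walk V s) ->
    z < \sum_i \sum_j estimated_sum i j s ^+ 2).
  move=> nb; apply: (threshold_perturb (ltr0Sn _ m) k0 hke eta1 (sqnorm_ge0 _)).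
  exact: good.
have up : (Q Tst <= Q [set s | z - eta < sqnorm (walk V s)]%R + r%:E)%E.
  apply: (le_measure_outer mT (mW _) hbad) => s Ts.
  by have [bs|nb] := pselect (bad s); [right|left; apply: (key s nb).1].
have lo : (Q [set s | z + eta < sqnorm (walk V s)]%R <= Q Tst + r%:E)%E.
  apply: (le_measure_outer (mW _) mT hbad) => s Ts.
  by have [bs|nb] := pselect (bad s); [right|left; apply: (key s nb).2].
rewrite -(fin _ mT) -(fin _ (mW (z - eta))) -EFinD lee_fin in up.
rewrite -(fin _ mT) -(fin _ (mW (z + eta))) -EFinD lee_fin in lo.
have := clt (z - eta) (or_introl erefl); have := clt (z + eta) (or_intror erefl).
rewrite !ler_norml => /andP[? ?] /andP[? ?]; apply/andP; split; lra.
Qed.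

End level.

Lemma bigO_unif_bound d (T : measurableType d) (R : realType)
    (M : set (probability T R)) (X : forall n, probability T R -> n.-tuple T -> \bar R)
    (a : nat -> R) (e : R) : bigO_unif M X a -> 0 < e ->
  exists2 C, 0 < C & forall n P, (0 < n)%N -> M P ->
    ((iid_law P n)^*%mu [set s | (C%:E < `|X n P s * ((a n)^-1)%:E|)%E] <= e%:E)%E.
Proof.
move=> [_ h] e0; have [C C0 hC] := h e e0; exists C => // n P n0 MP.
apply: (le_trans _ (ltW hC)).
apply: (@le_trans _ _ (ereal_sup [set ((iid_law P n)^*%mu
    [set s | C%:E < `|X n P s * ((a n)^-1)%:E|])%E | P in M])).
  by apply: ereal_sup_ubound; exists P.
by apply: ereal_sup_ubound; exists n.
Qed.

Lemma cvg0_small (R : realType) (u : nat -> R) (e : R) :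
  u n @[n --> \oo] --> (0 : R) -> 0 < e ->
  exists N, forall n, (N <= n)%N -> `|u n| <= e.
Proof.
move=> /cvgrPdist_le/(_ e) h /h[N _ hN]; exists N => n Nn.
by have := hN n Nn; rewrite /= sub0r normrN.
Qed.

Lemma sqr_scaled_small (R : realType) (m : nat) (c e : R) : 0 < c -> 0 < e ->
  exists2 t : R, 0 < t & forall x : R, `|x| <= t -> m.+1%:R * (c * `|x|) ^+ 2 <= e.
Proof.
move=> c0 e0; pose t := Num.min 1 (e / m.+1%:R).
have m0 : 0 < m.+1%:R :> R by rewrite ltr0Sn.
have t0 : 0 < t by rewrite lt_min ltr01 divr_gt0.
have t1 : t <= 1 by rewrite ge_min lexx.
have te : t <= e / m.+1%:R by rewrite ge_min lexx orbT.
exists (t / c) => [|x xt]; first by rewrite divr_gt0.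
have ct : c * `|x| <= t by rewrite mulrC -ler_pdivlMr.
apply: (@le_trans _ _ (m.+1%:R * t)).
  apply: ler_wpM2l; first exact: ltW.
  apply: (@le_trans _ _ (t ^+ 2)).
    by rewrite ler_sqr ?nnegrE ?mulr_ge0// ltW.
  by rewrite expr2 ler_piMr// ltW.
by rewrite mulrC -ler_pdivlMr.
Qed.

Section uniform_level.
Context (R : realType) (d q : nat) (phi : 'I_q -> R -> R).
Hypotheses (hq : (0 < q)%N) (hphi : is_score phi).
Context (FX FY : estimator R d) (hFX : is_estimator FX) (hFY : is_estimator FY)
  (P0 : set (law R d)) (hP0 : P0 `<=` @ac_laws R d)
  (KX KY : law R d -> (R.-pker covariate R d ~> R))
  (hKX : forall P, P0 P -> continuous_version P (@obsX R d) (KX P))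
  (hKY : forall P, P0 P -> continuous_version P (@obsY R d) (KY P))
  (g h : nat -> R)
  (hg : g n @[n --> \oo] --> (0 : R)) (hh : h n @[n --> \oo] --> (0 : R))
  (hX : bigO_unif P0 (fun n P s => normT phi (KX P) (fun t z =>
          cond_cdf (KX P) t z - @FX n (sampleXZ s) t z)) g)
  (hY : bigO_unif P0 (fun n P s => normT phi (KY P) (fun t z =>
          cond_cdf (KY P) t z - @FY n (sampleYZ s) t z)) h)
  (hgh : Num.sqrt n%:R * g n * h n @[n --> \oo] --> (0 : R))
  (alpha : R) (halpha : 0 < alpha < 1).

(** The choices are made in an order that keeps N independent of the law: first
    the margin eta around the critical value, then the admissible size k of the
    perturbation, and then the sample size from which on the rates g, h and
    their product meet k and the central limit theorem is accurate at both ends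
    of the margin. *)
Lemma uniform_level (e : R) : 0 < e -> exists N, forall n P, (N <= n)%N ->
  (P0 `&` @ci_laws R d) P -> exists2 p,
  'E_(iid_law P n)[@test R d q phi FX FY alpha n]%E = p%:E & `|alpha - p| <= e.
Proof.
move=> e0; pose e8 := e / 8; have e80 : 0 < e8 by rewrite divr_gt0.
pose m := (q * q).-1.
have qq : (q * q)%N = m.+1 by rewrite prednK// muln_gt0 hq.
have hm : #|{: 'I_q * 'I_q}| = m.+1 by rewrite card_prod card_ord.
have [L L0 hL] := white_score_lipschitz hphi.
have [C1 C10 hC1] := bigO_unif_bound hX e80.
have [C2 C20 hC2] := bigO_unif_bound hY e80.
have [eta [eta0 eta1 hz1 hz2]] := chi2_quantile_bracket m halpha e80.
set z := chi2_quantile _ _ in hz1 hz2.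
pose M : R := `|z| + 1 + 2 * m.+1%:R.
have M0 : 0 < M by rewrite addr_gt0 ?ltr_wpDl// mulr_gt0 ?ltr0Sn.
pose k := eta / M; have k0 : 0 < k by rewrite divr_gt0.
pose dl := k / 4; have dl0 : 0 < dl by rewrite divr_gt0.
have [t1 t10 ht1] := @sqr_scaled_small R m (L * C1 / dl) e8
  (divr_gt0 (mulr_gt0 L0 C10) dl0) e80.
have [t2 t20 ht2] := @sqr_scaled_small R m (L * C2 / dl) e8
  (divr_gt0 (mulr_gt0 L0 C20) dl0) e80.
pose c := L * C1 * (L * C2); have c0 : 0 < c by rewrite !mulr_gt0.
have [N1 hN1] := cvg0_small hg t10.
have [N2 hN2] := cvg0_small hh t20.
have [|N3 hN3] := @cvg0_small _ _ (k / 2 / c) hgh; first by rewrite !divr_gt0.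
have [B B0 hB] := product_score_bounded hphi hm.
have [N4 hN4] := clt_sqnorm m (z - eta) (ltW B0) e80.
have [N5 hN5] := clt_sqnorm m (z + eta) (ltW B0) e80.
exists (N1 + N2 + N3 + N4 + N5).+1 => n P hn [P0P [acP ciP]].
have n0 : (0 < n)%N by apply: leq_trans hn.
have [n1 n2 n3 n4 n5] : [/\ N1 <= n, N2 <= n, N3 <= n, N4 <= n & N5 <= n]%N.
  by clear -hn; split; lia.
have g0 : g n != 0 by have [+ _] := hX; apply.
have h0 : h n != 0 by have [+ _] := hY; apply.
have hk : 2 * dl + Num.sqrt n%:R * ((L * (C1 * `|g n|)) * (L * (C2 * `|h n|))) <= k.
  have := hN3 n n3; rewrite -(ler_pM2l c0) [c * (k / 2 / c)]mulrC divfK ?gt_eqF//.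
  rewrite !normrM (ger0_norm (sqrtr_ge0 _)) /c /dl => hh3.
  rewrite (_ : Num.sqrt n%:R * _ = L * C1 * (L * C2) * (Num.sqrt n%:R * `|g n| * `|h n|)).
    by lra.
  by ring.
have hke : k * M <= eta by rewrite divfK ?gt_eqF.
have qz : chi2_quantile (q ^ 2) (1 - alpha) = z by rewrite -mulnn qq.
have [|||p -> /andP[pl pu]] := @level_bracket R d q m phi hphi hq hm FX FY hFX hFY P (KX P) (KY P)
  (hP0 P0P) ciP (hKX P0P) (hKY P0P) n n0 alpha C1 C2 L dl e8 e8 e8 (g n) (h n) eta k
  g0 h0 C10 C20 L0 dl0 hL (hC1 n P n0 P0P) (hC2 n P n0 P0P) hk.
- by rewrite qz.
- exact: eta1.
- rewrite qz => x xz.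
  have mU1 : measurable_fun setT (fun w : obs R d => kernel_cdf (KX P) (obsX w, obsZ w)).
    apply: (measurableT_comp (measurable_kernel_cdf (KX P))).
    exact: (measurable_pair_obsZ (@measurable_obsX R d)).
  have mU2 : measurable_fun setT (fun w : obs R d => kernel_cdf (KY P) (obsY w, obsZ w)).
    apply: (measurableT_comp (measurable_kernel_cdf (KY P))).
    exact: (measurable_pair_obsZ (@measurable_obsY R d)).
  have mV := measurable_product_score hphi hm mU1 mU2.
  have iso := isotropic_ranks hphi hm (hP0 P0P) ciP (hKX P0P) (hKY P0P).
  have VB t l : `|tnth (product_score phi hm
      (fun w : obs R d => kernel_cdf (KX P) (obsX w, obsZ w))
      (fun w : obs R d => kernel_cdf (KY P) (obsY w, obsZ w)) t) l| <= B.
    rewrite tnth_mktuple.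
    exact: (hB _ _ (fun w : obs R d => kernel_cdf (KX P) (obsX w, obsZ w))
      (fun w : obs R d => kernel_cdf (KY P) (obsY w, obsZ w))).
  by case: xz => ->; [exact: hN4|exact: hN5].
exists p => //; rewrite qz in pl pu.
have := ht1 _ (hN1 n n1); have := ht2 _ (hN2 n n2).
rewrite (_ : L * C1 / dl * `|g n| = L * (C1 * `|g n|) / dl); last by ring.
rewrite (_ : L * C2 / dl * `|h n| = L * (C2 * `|h n|) / dl); last by ring.
rewrite mulrDr in pl pu; rewrite ler_norml => ? ?.
have e8E : e = 8 * e8 by rewrite mulrC divfK.
apply/andP; split; lra.
Qed.

End uniform_level.

Theorem corollary22 (R : realType) (d q : nat) (hq : (0 < q)%N)
    (phi : 'I_q -> R -> R) (hphi : is_score phi)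
    (FX FY : estimator R d) (hFX : is_estimator FX) (hFY : is_estimator FY)
    (P0 : set (law R d)) (hP0 : P0 `<=` @ac_laws R d)
    (KX KY : law R d -> (R.-pker covariate R d ~> R))
    (hKX : forall P, P0 P -> continuous_version P (@obsX R d) (KX P))
    (hKY : forall P, P0 P -> continuous_version P (@obsY R d) (KY P))
    (hH0 : P0 `&` @ci_laws R d !=set0)
    (g h : nat -> R)
    (hg : g n @[n --> \oo] --> (0 : R)) (hh : h n @[n --> \oo] --> (0 : R))
    (xi xi' : R -> covariate R d -> R)
    (hiX : bigO_unif P0 (fun n P s => normT phi (KX P) (fun t z =>
             cond_cdf (KX P) t z - FX n (sampleXZ s) t z)) g)
    (hiY : bigO_unif P0 (fun n P s => normT phi (KY P) (fun t z =>
             cond_cdf (KY P) t z - FY n (sampleYZ s) t z)) h)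
    (hiiX : bigO_unif P0 (fun n P s => normTc phi (KX P) (fun t z =>
              xi t z - FX n (sampleXZ s) t z)) g)
    (hiiY : bigO_unif P0 (fun n P s => normTc phi (KY P) (fun t z =>
              xi' t z - FY n (sampleYZ s) t z)) h)
    (hgh : Num.sqrt n%:R * g n * h n @[n --> \oo] --> (0 : R))
    (alpha : R) (halpha : 0 < alpha < 1) :
  limn_esup (fun n => ereal_sup
    [set 'E_(iid_law P n)[@test R d q phi FX FY alpha n]%E
      | P in P0 `&` @ci_laws R d]) = alpha%:E.
Proof.
set u := (fun n => _).
suff cvu : u @ \oo --> alpha%:E by rewrite (cvg_limn_einf_sup cvu).2.
have near_alpha e : 0 < e -> \forall n \near \oo, exists2 p, u n = p%:E & `|alpha - p| <= e.
  move=> e0; have [N hN] := uniform_level hq hphi hFX hFY hP0 hKX hKY hg hh hiX hiY hgh halpha e0.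
  exists N => // n /= Nn; have [P HP] := hH0.
  have [p Ep pe] := hN n P Nn HP.
  have up : (u n <= (alpha + e)%:E)%E.
    apply: ge_ereal_sup => _ [P' HP' <-]; have [p' -> pe'] := hN n P' Nn HP'.
    by rewrite lee_fin; move: pe'; rewrite ler_norml => /andP[? ?]; lra.
  have lo : ((alpha - e)%:E <= u n)%E.
    apply: (@le_trans _ _ p%:E); last by apply: ereal_sup_ubound; exists P.
    by rewrite lee_fin; move: pe; rewrite ler_norml => /andP[? ?]; lra.
  move: up lo; case: (u n) => [r| |]//; rewrite !lee_fin => ru rl.
  by exists r => //; rewrite ler_norml; apply/andP; split; lra.
apply/fine_cvgP; split.
  by apply: filterS (near_alpha _ ltr01) => n [p -> _].
apply/cvgrPdist_le => e /near_alpha; apply: filterS => n [p up pe].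
by rewrite /= up.
Qed.
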